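(* Let $1\le n\le7$ and let $f_1,\dots,f_n$ be even Schwartz functions with $\widehat f_1,\dots,\widehat f_n$ supported in $\sum_{i=1}^n|u_i|<2$. Then the Fourier Identity $$\sum_{\underline F\in\Pi(n)}C(\underline F)=E(\underline O)$$ holds.
   Context: Fourier transform: $\widehat f(u)=\int_{\mathbb{R}}f(x)e^{-2\pi i xu}\,dx$. ''Supported in $\sum|u_i|<2$'' means there are $\sigma_i>0$ with $\operatorname{supp}\widehat f_i\subseteq[-\sigma_i,\sigma_i]$ and $\sum\sigma_i<2$. $\Pi(n)$ is the set of set partitions of $\{1,\dots,n\}$; $\nu(\underline F)$ is the number of blocks of $\underline F=\{F_1,\dots,F_{\nu(\underline F)}\}$; $\underline O$ is the partition into singletons and $\underline N$ the one-block partition; $\mu(\underline F,\underline N)=(-1)^{\nu(\underline F)-1}(\nu(\underline F)-1)!$. Write $F_l(x)=\prod_{i\in F_l}f_i(x)$ and $$C(\underline F)=\frac12\int_{\mathbb{R}^{\nu(\underline F)}}\Big(\mu(\underline F,\underline N)+(-1)^{\nu(\underline F)}\chi^*_{\nu(\underline F)}(u_1,\dots,u_{\nu(\underline F)})\Big)\prod_{l=1}^{\nu(\underline F)}\widehat{F_l}(u_l)\,du_l,$$ $$E(\underline O)=\int_{\mathbb{R}^n_{\ge0}}\Big(\sum_{I\subseteq\{1,\dots,n\}}(-1)^{|I|+1}\tilde\chi\big(\textstyle\sum_{i\in I}u_i-\sum_{i\notin I}u_i\big)\Big)\prod_{i=1}^n\widehat f_i(u_i)\,du_i,$$ where $\tilde\chi$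 is the indicator function of $(1,\infty)$, $\chi$ that of $[-1,1]$, and $$\chi^*_k(u_1,\dots,u_k)=\sum_{\substack{\pi\in S_k\\\pi(1)=1}}\prod_{i=1}^k\chi\big(u_{\pi(1)}+\cdots+u_{\pi(i)}-u_{\pi(i+1)}-\cdots-u_{\pi(k)}\big).$$ (The integrals do not depend on the labelling of the blocks.) *)

(* Defs.v *)
From HB Require Import structures.
From mathcomp Require Import all_boot all_order all_algebra all_fingroup.
From mathcomp Require Import all_classical all_reals all_analysis.
From mathcomp Require Import complex.

Set Implicit Arguments.
Unset Strict Implicit.
Unset Printing Implicit Defensive.
Import Order.TTheory GRing.Theory Num.Theory.
Import numFieldNormedType.Exports.

Local Open Scope classical_set_scope.
Local Open Scope ring_scope.
Local Open Scope complex_scope.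

Section lebesgue_tuple.
Variable R : realType.

Definition tcons (n : nat) (p : R * n.-tuple R) : n.+1.-tuple R :=
  [tuple of p.1 :: p.2].

Definition tuncons (n : nat) (u : n.+1.-tuple R) : R * n.-tuple R :=
  (thead u, [tuple of behead u]).

Lemma measurable_tcons n : measurable_fun setT (@tcons n).
Proof.
apply: (@measurable_cons _ _ _ _ (fun p : R * n.-tuple R => p.1) n (fun p => p.2)).
  exact: measurable_fst.
exact: measurable_snd.
Qed.

Lemma measurable_tuncons n : measurable_fun setT (@tuncons n).
Proof.
apply: measurable_fun_pair.
  exact: measurable_tnth.
exact: measurable_behead.
Qed.

Lemma tconsK n : cancel (@tcons n) (@tuncons n).
Proof. by case=> x t; rewrite /tuncons; congr pair; apply: val_inj. Qed.

Definition lebesgue_tupleS (n : nat) (mu : set (n.-tuple R) -> \bar R) :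
    set (n.+1.-tuple R) -> \bar R :=
  pushforward (product_measure1 (@lebesgue_measure R) mu) (@tcons n).

(* Lebesgue measure on R^n; lebesgue_tuple_box gives its value on boxes. *)
Fixpoint lebesgue_tuple (n : nat) : set (n.-tuple R) -> \bar R :=
  if n is m.+1 then lebesgue_tupleS (@lebesgue_tuple m) else dirac [tuple].

End lebesgue_tuple.

Section lebesgue_tupleS_measure.
Variables (R : realType) (m : nat).
Variable mu : {sigma_finite_measure set (m.-tuple R) -> \bar R}.
Let nu := [the {measure set _ -> \bar R} of
  product_measure1 (@lebesgue_measure R) mu].
Let rho : set (m.+1.-tuple R) -> \bar R := lebesgue_tupleS mu.

Let mpre (A : set (m.+1.-tuple R)) :
  measurable A -> measurable (@tcons R m @^-1` A : set (measurableTypeR R * m.-tuple R)).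
Proof.
by move=> mA; rewrite -[X in measurable X]setTI; exact: (measurable_tcons measurableT).
Qed.

Let rho0 : rho set0 = 0%E.
Proof. by rewrite /rho /lebesgue_tupleS /pushforward preimage_set0 measure0. Qed.

Let rho_ge0 A : (0 <= rho A)%E.
Proof. exact: (@measure_ge0 _ _ _ nu). Qed.

Let rho_additive : semi_sigma_additive rho.
Proof.
move=> F mF tF mUF; rewrite /rho /lebesgue_tupleS /pushforward preimage_bigcup.
apply: measure_semi_sigma_additive.
- by move=> n; exact: mpre.
- apply/trivIsetP => /= i j _ _ ij; rewrite -preimage_setI.
  by move/trivIsetP : tF => /(_ _ _ _ _ ij) ->//; rewrite preimage_set0.
- by rewrite -preimage_bigcup; exact: mpre.
Qed.

HB.instance Definition _ := isMeasure.Build _ _ _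
  (lebesgue_tupleS mu) rho0 rho_ge0 rho_additive.

Let rho_sigma_finite : sigma_finite setT rho.
Proof.
have /sigma_finiteP[F [FT ndF Foo]] := sigma_finiteT (@lebesgue_measure R).
have /sigma_finiteP[G [GT ndG Goo]] := sigma_finiteT mu.
exists (fun k => @tuncons R m @^-1` (F k `*` G k)).
  apply/seteqP; split => // u _.
  have [i _ Fi] : (\bigcup_i F i) (tuncons u).1 by rewrite -FT.
  have [j _ Gj] : (\bigcup_i G i) (tuncons u).2 by rewrite -GT.
  exists (maxn i j) => //; split.
    by move: Fi; exact/subsetPset/ndF/leq_maxl.
  by move: Gj; exact/subsetPset/ndG/leq_maxr.
move=> k; have [mF Fk] := Foo k; have [mG Gk] := Goo k; split.
  rewrite -[X in measurable X]setTI; apply: (measurable_tuncons measurableT).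
  exact: measurableX.
rewrite /rho /lebesgue_tupleS /pushforward -comp_preimage.
rewrite (_ : @tuncons R m \o @tcons R m = id); last first.
  by apply/funext => p; exact: tconsK.
by rewrite preimage_id /nu /= product_measure1E// lte_mul_pinfty// ge0_fin_numE.
Qed.

HB.instance Definition _ := Measure_isSigmaFinite.Build _ _ _
  (lebesgue_tupleS mu) rho_sigma_finite.

End lebesgue_tupleS_measure.

Section lebesgue_tuple_measure.
Variable R : realType.

Let bundled n :
  {mu : {sigma_finite_measure set (n.-tuple R) -> \bar R} |
     (mu : set _ -> \bar R) = @lebesgue_tuple R n}.
Proof.
elim: n => [|n [mu muE]]; first by exists (dirac [tuple]).
by exists (lebesgue_tupleS mu); rewrite /= -muE.
Qed.

Let lt0 n : @lebesgue_tuple R n set0 = 0%E.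
Proof. by case: (bundled n) => mu <-; exact: measure0. Qed.

Let lt_ge0 n A : (0 <= @lebesgue_tuple R n A)%E.
Proof. by case: (bundled n) => mu <-; exact: measure_ge0. Qed.

Let lt_additive n : semi_sigma_additive (@lebesgue_tuple R n).
Proof. by case: (bundled n) => mu <-; exact: measure_semi_sigma_additive. Qed.

HB.instance Definition _ n :=
  isMeasure.Build _ _ _ (@lebesgue_tuple R n) (@lt0 n) (@lt_ge0 n) (@lt_additive n).

Let lt_sigma_finite n : sigma_finite setT (@lebesgue_tuple R n).
Proof. by case: (bundled n) => mu <-; exact: sigma_finiteT. Qed.

HB.instance Definition _ n :=
  Measure_isSigmaFinite.Build _ _ _ (@lebesgue_tuple R n) (@lt_sigma_finite n).

Lemma lebesgue_tuple_box n (A : 'I_n -> set R) :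
  (forall i, measurable (A i)) ->
  lebesgue_tuple [set u : n.-tuple R | forall i, A i (tnth u i)] =
  (\prod_(i < n) (@lebesgue_measure R (A i)))%E.
Proof.
elim: n A => [|n IH] A mA.
  rewrite big_ord0 /= diracE mem_set//= => -[]//.
pose B := [set u : n.-tuple R | forall i, A (lift ord0 i) (tnth u i)].
have mB : measurable B.
  rewrite (_ : B = \bigcap_(i in [set: 'I_n])
      ((@tnth n R)^~ i @^-1` A (lift ord0 i))); last first.
    by apply/seteqP; split => u /= h i; [move=> _|]; exact: h.
  apply: fin_bigcap_measurable => // i _.
  rewrite -[X in measurable X]setTI.
  by apply: (measurable_tnth _ measurableT); exact: mA.
rewrite big_ord_recl /= /lebesgue_tupleS /pushforward.
rewrite (_ : _ @^-1` _ = A ord0 `*` B).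
  rewrite product_measure1E//.
    by congr (_ * _)%E; apply: (IH (fun i => A (lift ord0 i))).
  exact: mA.
apply/seteqP; split => -[x u] /=.
  move=> h; split; first exact: (h ord0).
  by move=> i; have := h (lift ord0 i); rewrite tnthS.
move=> [hx hu] i; have [j ->|->//] := unliftP ord0 i.
by rewrite tnthS; exact: hu.
Qed.

End lebesgue_tuple_measure.

Section complex_analysis.
Variable R : realType.

(* The library has no integral of complex-valued functions and no derivative
   of functions from R to R[i], so these notions are taken on the real and
   imaginary parts. *)
Definition cintegral d (T : measurableType d) (mu : {measure set T -> \bar R})
    (D : set T) (g : T -> R[i]) : R[i] :=
  (\int[mu]_(x in D) complex.Re (g x)) +i* (\int[mu]_(x in D) complex.Im (g x)).

(* e^{it} for real t *)
Definition expi (t : R) : R[i] := cos t +i* sin t.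

Definition fourier (f : R -> R[i]) (u : R) : R[i] :=
  cintegral (@lebesgue_measure R) setT (fun x => f x * expi (- (2 * pi * x * u))).

Definition real_schwartz (g : R -> R) : Prop :=
  (forall k x, derivable (derive1n k g) x 1) /\
  (forall j k, exists M, forall x, `|x ^+ j * derive1n k g x| <= M).

Definition schwartz (f : R -> R[i]) : Prop :=
  real_schwartz (fun x => complex.Re (f x)) /\
  real_schwartz (fun x => complex.Im (f x)).

Definition even_function (f : R -> R[i]) : Prop := forall x, f (- x) = f x.

Definition supp (g : R -> R[i]) : set R := closure [set u | g u != 0].

(* "the Fourier transforms are supported in \sum_i |u_i| < b" *)
Definition fourier_supported (n : nat) (f : 'I_n -> R -> R[i]) (b : R) : Prop :=
  exists sigma : 'I_n -> R,
    [/\ forall i, 0 < sigma i,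
        forall i, supp (fourier (f i)) `<=` `[- sigma i, sigma i] &
        \sum_(i < n) sigma i < b].

End complex_analysis.

Section fourier_identity.
Variable R : realType.

Definition chi (x : R) : R := \1_(`[-1, 1]) x.

Definition chi_tilde (x : R) : R := \1_(`]1, +oo[) x.

(* The indices 1, ..., k of the mathematical formula are 0, ..., k - 1 here. *)
Definition chi_star (k : nat) (u : k.-tuple R) : R :=
  \sum_(s : {perm 'I_k} | [forall i : 'I_k, (val i == 0%N) ==> (s i == i)])
    \prod_(i < k) chi (\sum_(j < k | (j <= i)%N) tnth u (s j)
                       - \sum_(j < k | (i < j)%N) tnth u (s j)).

Definition set_partitions (n : nat) : {set {set {set 'I_n}}} :=
  [set F : {set {set 'I_n}} | finset.partition F [set: 'I_n]]%SET.

(* mu(F, N), where N is the one-block partition *)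
Definition mobius_top (n : nat) (F : {set {set 'I_n}}) : R :=
  (- 1) ^+ #|F|.-1 * (#|F|.-1)`!%:R.

Definition block_prod (n : nat) (f : 'I_n -> R -> R[i]) (B : {set 'I_n})
    (x : R) : R[i] :=
  \prod_(i in B) f i x.

(* The blocks F_l of F are labelled by the enumeration enum_val. *)
Definition C_term (n : nat) (f : 'I_n -> R -> R[i]) (F : {set {set 'I_n}}) : R[i] :=
  2^-1 * cintegral (@lebesgue_tuple R #|F|) setT (fun u =>
    (mobius_top F + (- 1) ^+ #|F| * chi_star u)%:C *
    \prod_(l < #|F|) fourier (block_prod f (enum_val l)) (tnth u l)).

(* E(O), where O is the partition into singletons *)
Definition E_singletons (n : nat) (f : 'I_n -> R -> R[i]) : R[i] :=
  cintegral (@lebesgue_tuple R n)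
    [set u : n.-tuple R | forall i, 0 <= tnth u i]
    (fun u =>
      (\sum_(I : {set 'I_n}) (- 1) ^+ (#|I| + 1) *
         chi_tilde (\sum_(i in I) tnth u i - \sum_(i | i \notin I) tnth u i))%:C *
      \prod_(i < n) fourier (f i) (tnth u i)).

End fourier_identity.

(* Main.v *)
Require Import Defs.
From HB Require Import structures.
From mathcomp Require Import all_boot all_order all_algebra all_fingroup.
From mathcomp Require Import ring lra.

(** Fourier inversion for even Schwartz functions (by damping with the Poisson
    kernel) turns the transform of a product of functions into a convolution, so
    that each [C_term] becomes an integral over R^n of the kernel evaluated at the
    block sums of the variables.  As the transforms are even, the kernels may be
    summed over all sign changes of a point v with v_i >= 0 and sum v_i < 2, and
    it remains to prove a pointwise identity, which holds for every n >= 1.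

    Call a sign pattern x (its set of minus signs) bad if |w x| > 1, where w x is
    the signed sum of the v_i.  The products of [chi] count cyclic paths from a
    pattern to its opposite through good patterns, each step flipping a block.
    Weighted by (-1)^k / k these are the trace of a logarithm in the algebra of
    flipping kernels; if N is the sum of all nonempty flips and M its Moebius
    counterpart, then 1 + N D_good = (1 + N) (1 + (M - 1) D_bad), so the good
    paths can be traded for bad ones, the factor 1 + N accounting exactly for the
    constants [mobius_top].  A step between bad patterns of opposite sign flips
    weight more than 1 and the total weight is less than 2, so a bad path crosses
    exactly once.  Rooting it at the crossing leaves the chains inside the
    down-closed family w x > 1; those starting at x <> set0 cancel because
    B |-> B :|: x retracts them to a cone, and those starting at set0 give the
    alternating sum over the family, which is the kernel of [E_singletons]. *)

Set Implicit Arguments.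
Unset Strict Implicit.
Unset Printing Implicit Defensive.
Import Order.TTheory GRing.Theory Num.Theory.
Local Open Scope ring_scope.

(** * The algebra of sign-flipping kernels *)

(** The kernel of a single partition singles out one block, since the permutations in [chi_star] fix
    the first index. The sum over all sign patterns removes this asymmetry: a path through all
    blocks leads from x to its complement, where the weights are the same as at x, so it may be
    rotated to begin with any block. The fixed first block is thereby traded for the factor 1 / k,
    the coefficient of a logarithm. The gain is that the factorisation of 1 + N D_good becomes a
    sum, although its factors do not commute: only the trace of the logarithm is additive, and this
    follows from cyclicity and the derivation that multiplies a (x, D) by the size of D.

    On the analytic side the asymmetry is deliberate. Adding a factor to a product uses the
    inversion formula of the new factor alone, so the partial products need only be even and
    integrable with an integrable transform, and inversion is proved for single Schwartz
    functions. *)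

Section symmetric_difference.
Variable T : finType.
Implicit Types A B D x : {set T}.

Definition sdiff A B : {set T} := [set i | (i \in A) (+) (i \in B)]%SET.

Lemma in_sdiff A B i : (i \in sdiff A B) = (i \in A) (+) (i \in B).
Proof. by rewrite inE. Qed.

Lemma sdiffC : commutative sdiff.
Proof. by move=> A B; apply/setP => i; rewrite !in_sdiff addbC. Qed.

Lemma sdiff0 A : sdiff A set0 = A.
Proof. by apply/setP => i; rewrite in_sdiff inE addbF. Qed.

Lemma sdiffT A : sdiff A setT = (~: A)%SET.
Proof. by apply/setP => i; rewrite in_sdiff !inE addbT. Qed.

Lemma sdiffK B : involutive (sdiff^~ B).
Proof. by move=> A; apply/setP => i; rewrite !in_sdiff -addbA addbb addbF. Qed.

Lemma sdiff_setU x B D : [disjoint B & D] -> sdiff x (B :|: D)%SET = sdiff (sdiff x B) D.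
Proof.
move=> dBD; apply/setP => i; rewrite !in_sdiff inE -addbA; congr (_ (+) _).
have := disjointFr dBD (x := i); case: (i \in B) => [->|] //.
Qed.

Lemma sdiff_setD x B D : B \subset D -> sdiff (sdiff x B) (D :\: B)%SET = sdiff x D.
Proof.
move=> sBD; rewrite -sdiff_setU.
  by congr sdiff; apply/setP => i; rewrite !inE; have /implyP := subsetP sBD i; case: (i \in B) => //= ->.
by rewrite -setI_eq0; apply/eqP/setP => i; rewrite !inE; case: (i \in B).
Qed.

Lemma sdiff_setC x B : sdiff (sdiff x B) (~: B)%SET = (~: x)%SET.
Proof. by rewrite -(sdiffT x) -(sdiff_setD x (subsetT B)) setTD. Qed.

End symmetric_difference.

(** * The ring of kernels, its cyclic trace and its derivation *)

Section kernel_ring.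
Variables (T : finType) (R : comPzRingType).
Implicit Types B D x : {set T}.

(* a (x, B) is the weight of the step which flips the signs in B, starting at
   the sign pattern with set of minus signs x; a product flips disjoint sets. *)
Definition kern := {ffun {set T} * {set T} -> R}.

HB.instance Definition _ := GRing.Zmodule.on kern.
Implicit Types a b c : kern.

Definition kern_one : kern := [ffun p : {set T} * {set T} => (p.2 == set0)%:R].

Definition kern_mul a b : kern :=
  [ffun p : {set T} * {set T} => \sum_(B : {set T} | B \subset p.2) a (p.1, B) * b (sdiff p.1 B, p.2 :\: B)%SET].

(** Both bracketings sum over the chains [B \subset C \subset D]; writing [C] as [B :|: E] with [E]
    disjoint from [B] matches the two indexings. *)
Lemma kern_mulA : associative kern_mul.
Proof.
move=> a b c; apply/ffunP => -[x D]; rewrite !ffunE /=.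
transitivity (\sum_(B : {set T} | B \subset D) \sum_(C : {set T} | (B \subset C) && (C \subset D))
    a (x, B) * b (sdiff x B, C :\: B)%SET * c (sdiff x C, D :\: C)%SET); last first.
  rewrite (exchange_big_dep (fun C : {set T} => C \subset D)) /=; last by move=> B C _ /andP[].
  apply: eq_bigr => C CD; rewrite ffunE mulr_suml; apply: eq_big => [B|B _] //=.
  by rewrite CD andbT; case: (boolP (B \subset C)) => [BC|]; rewrite ?andbF// (subset_trans BC CD).
apply: eq_bigr => B BD; rewrite ffunE mulr_sumr /=.
rewrite [RHS](reindex_onto (fun E => B :|: E)%SET (fun C => C :\: B)%SET) /=; last first.
  by move=> C /andP[BC _]; rewrite -[RHS](setID C B) (setIidPr BC).
apply: eq_big => [E|E].
  by rewrite subsetUl subUset BD setDUl setDv set0U subsetD; congr (_ && _); apply/setDidPl/eqP.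
rewrite subsetD => /andP[_ EB].
rewrite mulrA setDUl setDv set0U (setDidPl EB) setDDl sdiff_setU// disjoint_sym//.
Qed.

Lemma kern_mul1r : left_id kern_one kern_mul.
Proof.
move=> a; apply/ffunP => -[x D]; rewrite ffunE /= (bigD1 set0) ?sub0set//= ffunE eqxx.
rewrite sdiff0 setD0 mul1r big1 ?addr0// => B /andP[_ B0].
by rewrite ffunE /= (negbTE B0) mul0r.
Qed.

Lemma kern_mulr1 : right_id kern_one kern_mul.
Proof.
move=> a; apply/ffunP => -[x D]; rewrite ffunE /= (bigD1 D)//= ffunE /= setDv eqxx mulr1.
rewrite big1 ?addr0// => B /andP[BD nBD]; rewrite ffunE /= setD_eq0.
suff /negbTE -> : ~~ (D \subset B) by rewrite mulr0.
by apply: contra nBD => DB; rewrite eqEsubset BD.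
Qed.

Lemma kern_mulDl : left_distributive kern_mul +%R.
Proof.
move=> a b c; apply/ffunP => -[x D]; rewrite !ffunE -big_split /=.
by apply: eq_bigr => B _; rewrite ffunE mulrDl.
Qed.

Lemma kern_mulDr : right_distributive kern_mul +%R.
Proof.
move=> a b c; apply/ffunP => -[x D]; rewrite !ffunE -big_split /=.
by apply: eq_bigr => B _; rewrite ffunE mulrDr.
Qed.

HB.instance Definition _ := GRing.Zmodule_isPzRing.Build kern
  kern_mulA kern_mul1r kern_mulr1 kern_mulDl kern_mulDr.

Lemma kernM a b x D :
  (a * b) (x, D) = \sum_(B : {set T} | B \subset D) a (x, B) * b (sdiff x B, D :\: B)%SET.
Proof. by rewrite /GRing.mul /= ffunE. Qed.

Lemma kernD a b p : (a + b) p = a p + b p. Proof. by rewrite ffunE. Qed.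
Lemma kernN a p : (- a) p = - a p. Proof. by rewrite ffunE. Qed.
Lemma kern0 p : (0 : kern) p = 0. Proof. by rewrite ffunE. Qed.
Lemma kern1 x D : (1 : kern) (x, D) = (D == set0)%:R.
Proof. by rewrite /GRing.one /= ffunE. Qed.
Lemma kern_sum I (r : seq I) (P : pred I) (F : I -> kern) p :
  (\sum_(i <- r | P i) F i) p = \sum_(i <- r | P i) F i p.
Proof. by apply: (big_morph (fun a : kern => a p)) => [a b|]; rewrite ffunE. Qed.

(** A multiplicative filtration by the size of the flipped set, which makes every kernel of level 1
    nilpotent. *)
Definition trunc_kern (m : nat) a := forall x D, (#|D| < m)%N -> a (x, D) = 0.

Lemma trunc_kernM m m' a b : trunc_kern m a -> trunc_kern m' b -> trunc_kern (m + m') (a * b).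
Proof.
move=> ta tb x D Dm; rewrite kernM big1// => B BD.
have [Bm|Bm] := ltnP #|B| m; first by rewrite ta ?mul0r.
rewrite tb ?mulr0// cardsD (setIidPr BD).
by rewrite ltn_subLR ?subset_leq_card// (leq_trans Dm)// leq_add2r.
Qed.

Lemma trunc_kernX a k : trunc_kern 1 a -> trunc_kern k (a ^+ k).
Proof.
move=> ta; elim: k => [|k IH]; first by [].
by rewrite exprS; exact: (@trunc_kernM 1 k).
Qed.

Lemma trunc_kern_eq0 a : trunc_kern #|T|.+1 a -> a = 0.
Proof.
move=> ta; apply/ffunP => -[x D]; rewrite ffunE ta// ltnS; exact: max_card.
Qed.

Definition antipodal a := forall x D, a (~: x, D)%SET = a (x, D).

Lemma sdiffCl x B : sdiff (~: x)%SET B = (~: sdiff x B)%SET.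
Proof. by apply/setP => i; rewrite !(in_sdiff, inE) addNb. Qed.

Lemma antipodalM a b : antipodal a -> antipodal b -> antipodal (a * b).
Proof.
move=> ha hb x D; rewrite !kernM; apply: eq_bigr => B _.
by rewrite ha sdiffCl hb.
Qed.

Lemma antipodalD a b : antipodal a -> antipodal b -> antipodal (a + b).
Proof. by move=> ha hb x D; rewrite !kernD ha hb. Qed.

Lemma antipodalN a : antipodal a -> antipodal (- a).
Proof. by move=> ha x D; rewrite !kernN ha. Qed.

Lemma antipodal1 : antipodal 1.
Proof. by move=> x D; rewrite !kern1. Qed.

Lemma antipodal0 : antipodal 0.
Proof. by move=> x D; rewrite !kern0. Qed.

Lemma antipodalX a k : antipodal a -> antipodal (a ^+ k).
Proof.
by move=> ha; elim: k => [|k IH]; [exact: antipodal1|rewrite exprS; exact: antipodalM].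
Qed.

Lemma antipodal_sum I (r : seq I) (P : pred I) (F : I -> kern) :
  (forall i, antipodal (F i)) -> antipodal (\sum_(i <- r | P i) F i).
Proof.
by move=> aF; apply: big_ind => // [|a b]; [exact: antipodal0|exact: antipodalD].
Qed.

(** The paths counted flip every index exactly once, so they run from [x] to [~: x]; they close up
    only modulo complementation. *)
Definition ktrace a := \sum_(x : {set T}) a (x, setT).

Lemma ktraceD a b : ktrace (a + b) = ktrace a + ktrace b.
Proof. by rewrite -big_split; apply: eq_bigr => x _; rewrite kernD. Qed.
Lemma ktraceN a : ktrace (- a) = - ktrace a.
Proof. by rewrite /ktrace -sumrN; apply: eq_bigr => x _; rewrite kernN. Qed.
Lemma ktrace0 : ktrace 0 = 0.
Proof. by rewrite /ktrace big1// => x _; rewrite kern0. Qed.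
Lemma ktrace_sum I (r : seq I) (P : pred I) (F : I -> kern) :
  ktrace (\sum_(i <- r | P i) F i) = \sum_(i <- r | P i) ktrace (F i).
Proof. by apply: big_morph; [exact: ktraceD|exact: ktrace0]. Qed.

(** A path from [x] over [sdiff x B] to [~: x] is restarted at its middle pattern and prolonged by
    flipping [B] at [~: x]. Antipodality of [a] gives this flip the weight it had at [x]. *)
Lemma ktraceC a b : antipodal a -> ktrace (a * b) = ktrace (b * a).
Proof.
move=> ha; rewrite /ktrace.
under eq_bigr do rewrite kernM; under [RHS]eq_bigr do rewrite kernM.
rewrite exchange_big /= [RHS]exchange_big /= [RHS](reindex_inj (@setC_inj T)) /=.
rewrite (eq_bigl _ _ (fun B => subsetT B)) [RHS](eq_bigl _ _ (fun B => subsetT _)).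
apply: eq_bigr => B _; rewrite [RHS](reindex_inj (inv_inj (@sdiffK _ B))) /=.
by apply: eq_bigr => x _; rewrite sdiff_setC ha !setTD setCK mulrC.
Qed.

(** The Euler derivation of the grading by the size of the flipped set; it obeys the Leibniz rule
    because a product flips disjoint sets. *)
Definition kderiv a : kern := [ffun p : {set T} * {set T} => #|p.2|%:R * a p].

Lemma kderivD a b : kderiv (a + b) = kderiv a + kderiv b.
Proof. by apply/ffunP => p; rewrite !ffunE mulrDr. Qed.

Lemma kderiv1 : kderiv 1 = 0.
Proof.
apply/ffunP => -[x D]; rewrite kern0 [LHS]ffunE kern1 /=.
by have [->|] := eqVneq D set0; rewrite ?cards0 ?mul0r ?mulr0.
Qed.

Lemma kderivM a b : kderiv (a * b) = kderiv a * b + a * kderiv b.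
Proof.
apply/ffunP => -[x D]; rewrite kernD ffunE !kernM /= mulr_sumr -big_split /=.
apply: eq_bigr => B BD; rewrite !ffunE /=.
rewrite -(cardsID B D) (setIidPr BD) natrD; ring.
Qed.

Lemma kderiv_trunc m a : trunc_kern m a -> trunc_kern m (kderiv a).
Proof. by move=> ta x D Dm; rewrite ffunE /= ta ?mulr0. Qed.

Lemma ktrace_kderiv a : ktrace (kderiv a) = #|T|%:R * ktrace a.
Proof. by rewrite /ktrace mulr_sumr; apply: eq_bigr => x _; rewrite ffunE cardsT. Qed.

(** [kderiv a] need not commute with [a]; the terms of the Leibniz rule agree only under the trace,
    by cyclicity. *)
Lemma ktrace_kderivX a k : antipodal a ->
  ktrace (kderiv (a ^+ k.+1)) = k.+1%:R * ktrace (kderiv a * a ^+ k).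
Proof.
move=> ha.
(* The commuting factor [c] absorbs the copies of [a] that the induction moves around the trace. *)
suff h c : antipodal c -> GRing.comm a c ->
    ktrace (kderiv (a ^+ k.+1) * c) = k.+1%:R * ktrace (kderiv a * (a ^+ k * c)).
  by have := h 1 antipodal1 (commr1 a); rewrite !mulr1.
elim: k c => [|k IH] c hc ac; first by rewrite expr1 expr0 mul1r mul1r.
rewrite exprS kderivM mulrDl ktraceD -mulrA.
rewrite -(mulrA a) (ktraceC _ ha) -mulrA -ac IH; last 2 first.
- exact: antipodalM.
- by apply: commrM.
rewrite -[in RHS]natr1 mulrDl mul1r addrC; congr (_ * ktrace (_ * _) + _).
by rewrite mulrA -exprSr.
Qed.

End kernel_ring.

(** * The trace of a logarithm and the passage from good to bad patterns *)

Section trace_log.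
Variables (T : finType) (R : numFieldType).
Hypothesis T0 : (0 < #|T|)%N.
Implicit Types B D x : {set T}.
Implicit Types a b c : kern T R.

Definition kinv a : kern T R := \sum_(i < #|T|.+1) (- a) ^+ i.

Lemma trunc_kernN m a : trunc_kern m a -> trunc_kern m (- a).
Proof. by move=> ta x D Dm; rewrite kernN ta ?oppr0. Qed.

Lemma trunc_kernD m a b : trunc_kern m a -> trunc_kern m b -> trunc_kern m (a + b).
Proof. by move=> ta tb x D Dm; rewrite kernD ta ?tb ?addr0. Qed.

Lemma kern_nilpotent a : trunc_kern 1 a -> a ^+ #|T|.+1 = 0.
Proof. by move=> ta; apply: trunc_kern_eq0; exact: trunc_kernX. Qed.

Lemma kinvr a : trunc_kern 1 a -> (1 + a) * kinv a = 1.
Proof.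
move=> ta; have := subrX1 (- a) #|T|.+1.
rewrite kern_nilpotent; last exact: trunc_kernN.
rewrite sub0r -opprD addrC mulNr => /oppr_inj.
by rewrite addrC => <-.
Qed.

Lemma kinvl a : trunc_kern 1 a -> kinv a * (1 + a) = 1.
Proof.
move=> ta; rewrite -[RHS](kinvr ta); symmetry.
suff : GRing.comm (1 + a) (kinv a) by [].
apply: commr_sym; apply: commrD; first exact: commr1.
apply: commr_sym; apply: commr_sum => i _; apply: commrX; apply: commrN; exact: commr_refl.
Qed.

Lemma kinv_antipodal a : antipodal a -> antipodal (kinv a).
Proof. by move=> ha; apply: antipodal_sum => i; apply/antipodalX/antipodalN. Qed.

(** This is - tr log (1 + a): for [a] of level 1 the powers with exponent above #|T| vanish. *)
Definition ktrace_log a : R :=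
  \sum_(k < #|T|) (- 1) ^+ k.+1 / k.+1%:R * ktrace (a ^+ k.+1).

(* [kderiv] is a derivation that [ktrace] turns into multiplication by #|T|, so
   up to the factor - #|T| this is the trace of a logarithmic derivative. *)
Lemma ktrace_logE a : trunc_kern 1 a -> antipodal a ->
  #|T|%:R * ktrace_log a = - ktrace (kderiv a * kinv a).
Proof.
move=> ta ha; rewrite mulr_sumr.
have nilp : kderiv a * (- a) ^+ #|T| = 0.
  apply: trunc_kern_eq0; rewrite -add1n; apply: trunc_kernM; first exact: kderiv_trunc.
  exact/trunc_kernX/trunc_kernN.
rewrite /kinv big_ord_recr /= mulrDr nilp addr0 mulr_sumr ktrace_sum -sumrN.
apply: eq_bigr => k _.
rewrite mulrCA -ktrace_kderiv ktrace_kderivX// (exprNn a).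
rewrite mulrA mulfVK ?pnatr_eq0//.
rewrite exprS mulN1r mulNr; congr (- _).
rewrite -signr_odd -[in RHS]signr_odd; case: (odd k) => /=.
  by rewrite !expr1 !mulN1r mulrN ktraceN.
by rewrite !expr0 !mul1r.
Qed.

(** The logarithmic derivative of the product is (dz (1 + b) + (1 + z) db) (1 + b)^-1 (1 + z)^-1. In
    its second term the trace rotates 1 + z next to its inverse, so the factors need not commute. *)
Lemma ktrace_logM a z b : trunc_kern 1 z -> trunc_kern 1 b -> antipodal z -> antipodal b ->
  1 + a = (1 + z) * (1 + b) -> ktrace_log a = ktrace_log z + ktrace_log b.
Proof.
move=> tz tb hz hb e.
have aE : a = z + b + z * b.
  apply: (addrI 1); rewrite e mulrDl mul1r mulrDr mulr1 -!addrA; congr (_ + _).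
  by rewrite addrCA.
have ta : trunc_kern 1 a.
  rewrite aE; apply: trunc_kernD; first exact: trunc_kernD.
  by move=> x D D1; apply: (@trunc_kernM _ _ 1 1) => //; exact: leq_trans D1 _.
have ha : antipodal a.
  by rewrite aE; apply: antipodalD; [exact: antipodalD|exact: antipodalM].
have n0 : (#|T|%:R : R) != 0 by rewrite pnatr_eq0 -lt0n.
apply: (mulfI n0); rewrite mulrDr !ktrace_logE// -opprD; congr (- _).
have ia : kinv a = kinv b * kinv z.
  have l : kinv b * kinv z * (1 + a) = 1.
    by rewrite e mulrA -(mulrA (kinv b)) kinvl// mulr1 kinvl.
  by rewrite -[LHS]mul1r -l -mulrA kinvr// mulr1.
have da : kderiv a = kderiv z * (1 + b) + (1 + z) * kderiv b.
  have h (y : kern T R) : kderiv y = kderiv (1 + y) by rewrite kderivD kderiv1 add0r.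
  by rewrite (h a) e kderivM -(h z) -(h b).
rewrite da ia mulrDl ktraceD; congr (ktrace _ + _).
  by rewrite -!mulrA; congr (_ * _); rewrite !mulrA kinvr// mul1r.
rewrite -mulrA ktraceC; last by apply: antipodalD => //; exact: antipodal1.
by rewrite -!mulrA kinvl// mulr1.
Qed.

Definition kdiag (f : {set T} -> R) : kern T R := [ffun p : {set T} * {set T} => (p.2 == set0)%:R * f p.1].

Lemma kdiagMl f a x D : (kdiag f * a) (x, D) = f x * a (x, D).
Proof.
rewrite kernM (bigD1 set0) ?sub0set//= big1 ?addr0 => [|B /andP[_ B0]].
  by rewrite ffunE /= eqxx mul1r sdiff0 setD0.
by rewrite ffunE /= (negbTE B0) !mul0r.
Qed.

Lemma kdiagMr f a x D : (a * kdiag f) (x, D) = a (x, D) * f (sdiff x D).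
Proof.
rewrite kernM (bigD1 D)//= big1 ?addr0 => [|B /andP[BD nBD]].
  by rewrite ffunE /= setDv eqxx mul1r.
rewrite ffunE /= setD_eq0; suff /negbTE -> : ~~ (D \subset B) by rewrite mul0r mulr0.
by apply: contra nBD => DB; rewrite eqEsubset BD.
Qed.

Lemma kdiagM f g : kdiag f * kdiag g = kdiag (fun x => f x * g x).
Proof.
by apply/ffunP => -[x D]; rewrite kdiagMl !ffunE /= mulrCA.
Qed.

Lemma kdiag_antipodal f : (forall x, f (~: x)%SET = f x) -> antipodal (kdiag f).
Proof. by move=> hf x D; rewrite !ffunE /= hf. Qed.

Definition kstep : kern T R := [ffun p : {set T} * {set T} => (p.2 != set0)%:R].
(** The Moebius function of the subset lattice without its value at the empty set, so that 1 +
    [kmoebius] is inverse to 1 + [kstep]. *)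
Definition kmoebius : kern T R := [ffun p : {set T} * {set T} => (p.2 != set0)%:R * (-1) ^+ #|p.2|].

Lemma trunc_kern_kstep : trunc_kern 1 kstep.
Proof. by move=> x D; rewrite ltnS leqn0 cards_eq0 => /eqP ->; rewrite ffunE /= eqxx. Qed.
Lemma trunc_kern_kmoebius : trunc_kern 1 kmoebius.
Proof. by move=> x D; rewrite ltnS leqn0 cards_eq0 => /eqP ->; rewrite ffunE /= eqxx mul0r. Qed.
Lemma kstep_antipodal : antipodal kstep. Proof. by move=> x D; rewrite !ffunE. Qed.
Lemma kmoebius_antipodal : antipodal kmoebius. Proof. by move=> x D; rewrite !ffunE. Qed.

Lemma trunc_kern_diag f a : trunc_kern 1 a -> trunc_kern 1 (a * kdiag f).
Proof. by move=> ta x D D1; rewrite kdiagMr ta ?mul0r. Qed.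

(** Toggling a fixed element [i] of [D] is a sign-reversing involution on the subsets of [D]. *)
Lemma sum_subset_sign D : \sum_(B : {set T} | B \subset D) (-1) ^+ #|B| = (D == set0)%:R :> R.
Proof.
have [->|/set0Pn[i iD]] := eqVneq D set0.
  by rewrite (big_pred1 set0) ?cards0// => B; rewrite subset0.
pose h B := sdiff B [set i].
have hK : involutive h by exact: sdiffK.
have hD B : (h B \subset D) = (B \subset D).
  apply/subsetP/subsetP => hB j; have := hB j; rewrite in_sdiff inE.
    by have [->|_] := eqVneq j i; rewrite ?iD// addbF.
  by have [->|_] := eqVneq j i; rewrite ?iD// addbF.
have hS B : (-1) ^+ #|h B| = - (-1) ^+ #|B| :> R.
  have [iB|iB] := boolP (i \in B).
    have -> : h B = (B :\ i)%SET.
      by apply/setP => j; rewrite in_sdiff !inE; have [->|_] := eqVneq j i; rewrite ?iB// addbF.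
    by rewrite [in RHS](cardsD1 i) iB exprS mulN1r opprK.
  have -> : h B = (i |: B)%SET.
    by apply/setP => j; rewrite in_sdiff !inE; have [->|_] := eqVneq j i; rewrite ?(negbTE iB)// addbF.
  by rewrite cardsU1 iB exprS mulN1r.
set s := \sum_(B | _) _; have : s = - s; last by move/eqP; rewrite -addr_eq0 -mulr2n mulrn_eq0 => /eqP.
rewrite {1}/s (reindex_inj (inv_inj hK)) -sumrN /=.
by apply: eq_big => [B|B _]; [exact: hD|exact: hS].
Qed.

Lemma kstep_kmoebius : (1 + kstep) * (1 + kmoebius) = 1.
Proof.
apply/ffunP => -[x D]; rewrite kernM kern1 -sum_subset_sign.
rewrite [RHS](reindex_onto (fun B => D :\: B)%SET (fun B => D :\: B)%SET) /=; last first.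
  by move=> B BD; rewrite setDDr setDv set0U (setIidPr BD).
apply: eq_big => [B|B BD].
  rewrite subsetDl setDDr setDv set0U; apply/idP/eqP => [/setIidPr //|<-]; exact: subsetIl.
rewrite !kernD !kern1 !ffunE /=.
have -> : (B == set0)%:R + (B != set0)%:R = 1 :> R by case: (B == set0); rewrite ?addr0 ?add0r.
rewrite mul1r; case: eqVneq => [->|_]; first by rewrite cards0 mul0r addr0.
by rewrite add0r mul1r.
Qed.

(** With b the diagonal kernel of 1 - g, the left side is 1 + [kstep] - [kstep] b, and Moebius
    inversion gives (1 + [kstep]) [kmoebius] = - [kstep]. *)
Lemma kstep_diag (g : {set T} -> R) :
  1 + kstep * kdiag g = (1 + kstep) * (1 + kmoebius * kdiag (fun x => 1 - g x)).
Proof.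
pose b := kdiag (fun x => 1 - g x).
have gE : kdiag g = 1 - b.
  by apply/ffunP => -[x D]; rewrite kernD kernN kern1 !ffunE /= mulrBr mulr1 subKr.
rewrite -/b gE mulrBr mulr1 [RHS]mulrDr mulr1 mulrA.
have -> : (1 + kstep) * kmoebius = - kstep.
  apply: (addrI (1 + kstep)); rewrite -{1}(mulr1 (1 + kstep)) -mulrDr kstep_kmoebius.
  by rewrite addrK.
by rewrite mulNr addrA.
Qed.

Lemma ktrace_log_step (g : {set T} -> R) : (forall x, g (~: x)%SET = g x) ->
  ktrace_log (kstep * kdiag g) = ktrace_log kstep + ktrace_log (kmoebius * kdiag (fun x => 1 - g x)).
Proof.
move=> gC; apply: ktrace_logM (kstep_diag g).
- exact: trunc_kern_kstep.
- exact/trunc_kern_diag/trunc_kern_kmoebius.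
- exact: kstep_antipodal.
- by apply: antipodalM; [exact: kmoebius_antipodal|apply: kdiag_antipodal => x; rewrite gC].
Qed.

(** Cyclicity brings one copy of the idempotent to the front, which confines the paths to the
    support of [f] from their start on. *)
Lemma ktrace_log_compress m (f : {set T} -> R) : (forall x, f x * f x = f x) ->
  (forall x, f (~: x)%SET = f x) ->
  ktrace_log (m * kdiag f) = ktrace_log (kdiag f * m * kdiag f).
Proof.
move=> ff fC; apply: eq_bigr => k _; congr (_ * _).
have DD : kdiag f * kdiag f = kdiag f.
  by rewrite kdiagM; apply/ffunP => p; rewrite !ffunE ff.
have e1 j : (m * kdiag f) ^+ j.+1 = (m * kdiag f) ^+ j.+1 * kdiag f.
  by rewrite exprSr -!mulrA DD.
have e2 j : kdiag f * (m * kdiag f) ^+ j.+1 = (kdiag f * m * kdiag f) ^+ j.+1.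
  elim: j => [|j IH]; first by rewrite !expr1 mulrA.
  rewrite [in RHS]exprS -IH [in LHS]exprS !mulrA; congr (_ * _).
  by rewrite -[RHS]mulrA DD.
by rewrite e1 -ktraceC ?e2//; exact: kdiag_antipodal.
Qed.

End trace_log.

(** * Bad patterns: [p] stands for w > 1, [q] for w < -1, and [V] for the weight of a set of
    indices *)

Section bad_patterns.
Variables (T : finType) (R : realFieldType).
Hypothesis T0 : (0 < #|T|)%N.
Implicit Types A B D x y : {set T}.
Implicit Types a b : kern T R.
Variables (p : {set T} -> bool) (V : {set T} -> R).
Let q x := p (~: x)%SET.
Hypothesis p_excl : forall x, p x -> ~~ q x.
Hypothesis p_down : forall A B, A \subset B -> p B -> p A.
Hypothesis V0 : V set0 = 0.
Hypothesis V_add : forall B D, B \subset D -> V D = V B + V (D :\: B)%SET.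
Hypothesis V_cross : forall x B, p x -> q (sdiff x B) -> 1 <= V B.
Hypothesis V_T : V setT < 2.

Let qC x : q (~: x)%SET = p x. Proof. by rewrite /q setCK. Qed.

Let same x y := (p x && p y) || (q x && q y).
Let cross x y := (p x && q y) || (q x && p y).

Let V_cross_sym x B : cross x (sdiff x B) -> 1 <= V B.
Proof.
move=> /orP[/andP[px qy]|/andP[qx py]]; first exact: V_cross px qy.
by apply: (@V_cross (~: x)%SET); rewrite ?sdiffCl ?qC.
Qed.

Let same_trans x y z : same x y -> same y z -> same x z.
Proof.
rewrite /same; have := @p_excl y.
by case: (p x); case: (p y); case: (p z); case: (q x); case: (q y); case: (q z) => // /(_ isT).
Qed.

Let same_cross x y z : same x y -> cross y z -> cross x z.
Proof.
rewrite /same /cross; have := @p_excl y.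
by case: (p x); case: (p y); case: (p z); case: (q x); case: (q y); case: (q z) => // /(_ isT).
Qed.

Let same_compl x : same x (~: x)%SET = false.
Proof. rewrite /same qC -/(q x); have := @p_excl x.
by case: (p x); case: (q x) => // /(_ isT). Qed.

(** The compressed kernel is split into the steps that stay on one side, [p] or [q], and the steps
    [c] that change sides. *)
Let e : kern T R := [ffun r : {set T} * {set T} => (same r.1 (sdiff r.1 r.2))%:R * kmoebius T R r].
Let c : kern T R := [ffun r : {set T} * {set T} => (cross r.1 (sdiff r.1 r.2))%:R * kmoebius T R r].
Let f x : R := (p x || q x)%:R.

Let eE x B : e (x, B) = (same x (sdiff x B))%:R * kmoebius T R (x, B).
Proof. by rewrite ffunE. Qed.
Let cE x B : c (x, B) = (cross x (sdiff x B))%:R * kmoebius T R (x, B).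
Proof. by rewrite ffunE. Qed.

Let ecE : kdiag f * kmoebius T R * kdiag f = e + c.
Proof.
apply/ffunP => -[x B]; rewrite kdiagMr kdiagMl kernD eE cE mulrAC -mulrDl; congr (_ * _).
rewrite -natrM -natrD /same /cross; congr _%:R.
have := @p_excl x; have := @p_excl (sdiff x B).
case: (p x); case: (q x); case: (p _); case: (q _) => // h1 h2;
  by first [by have := h1 isT|by have := h2 isT].
Qed.

Let sameC x y : same (~: x)%SET (~: y)%SET = same x y.
Proof. by rewrite /same /q !setCK orbC. Qed.
Let crossC x y : cross (~: x)%SET (~: y)%SET = cross x y.
Proof. by rewrite /cross /q !setCK orbC. Qed.

Let e_trunc : trunc_kern 1 e.
Proof. by move=> x D D1; rewrite eE trunc_kern_kmoebius ?mulr0. Qed.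
Let c_trunc : trunc_kern 1 c.
Proof. by move=> x D D1; rewrite cE trunc_kern_kmoebius ?mulr0. Qed.
Let e_antip : antipodal e.
Proof. by move=> x D; rewrite !eE sdiffCl sameC kmoebius_antipodal. Qed.
Let c_antip : antipodal c.
Proof. by move=> x D; rewrite !cE sdiffCl crossC kmoebius_antipodal. Qed.

Let eX_same k x B : (e ^+ k.+1) (x, B) != 0 -> same x (sdiff x B).
Proof.
elim: k x B => [|k IH] x B.
  by rewrite expr1 eE; case: (same _ _) => //; rewrite mul0r eqxx.
rewrite exprS kernM => h.
have [C /andP[CB]] : exists C : {set T}, (C \subset B) && (e (x, C) * (e ^+ k.+1) (sdiff x C, B :\: C)%SET != 0).
  apply/existsP; apply: contraNT h; rewrite negb_exists => /forallP h.
  apply/eqP; rewrite big1// => C CB; apply/eqP.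
  by have := h C; rewrite CB negbK.
rewrite mulf_eq0 negb_or => /andP[h1 /IH].
rewrite sdiff_setD//; apply: same_trans.
by move: h1; rewrite eE; case: (same _ _) => //; rewrite mul0r eqxx.
Qed.

(** A path of steps in [e] remains on one side, whereas a traced path ends at the complement of its
    start. *)
Let ktrace_log_e : ktrace_log e = 0.
Proof.
rewrite /ktrace_log big1// => k _; rewrite [ktrace _]big1 ?mulr0// => x _.
by apply/eqP; apply: contraTT isT => /eX_same; rewrite sdiffT same_compl.
Qed.

Let E := kinv e.
(** Chosen so that 1 + e + c = (1 + e) (1 + c'): it collects the paths that stay on one side until
    their last step, which crosses. *)
Let c' := E * c.

Let E_same x B : E (x, B) != 0 -> B != set0 -> same x (sdiff x B).
Proof.
move=> h B0; move: h; rewrite /E /kinv kern_sum big_ord_recl expr0 kern1 (negbTE B0) add0r => h.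
have [k] : exists k : 'I_#|T|, ((- e) ^+ (lift ord0 k)) (x, B) != 0.
  apply/existsP; apply: contraNT h; rewrite negb_exists => /forallP h.
  by apply/eqP; rewrite big1// => k _; apply/eqP; have := h k; rewrite negbK.
rewrite lift0 exprNn => hk; apply: (@eX_same k); apply: contraNneq hk => hk.
by rewrite -signr_odd; case: (odd _); rewrite ?expr1 ?expr0 ?mulN1r ?mul1r ?kernN hk ?oppr0.
Qed.

Let c'_cross x B : c' (x, B) != 0 -> cross x (sdiff x B).
Proof.
rewrite /c' kernM => h.
have [C /andP[CB]] : exists C : {set T}, (C \subset B) && (E (x, C) * c (sdiff x C, B :\: C)%SET != 0).
  apply/existsP; apply: contraNT h; rewrite negb_exists => /forallP h.
  apply/eqP; rewrite big1// => C CB; apply/eqP.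
  by have := h C; rewrite CB negbK.
rewrite mulf_eq0 negb_or => /andP[h1]; rewrite cE sdiff_setD// => h2.
have h3 : cross (sdiff x C) (sdiff x B).
  by move: h2; case: (cross _ _) => //; rewrite mul0r eqxx.
have [C0|C0] := eqVneq C set0; first by move: h3; rewrite C0 sdiff0.
exact: same_cross (E_same h1 C0) h3.
Qed.

Let heavy (t : R) a := forall x B, a (x, B) != 0 -> t <= V B.

Let heavyM s t a b : heavy s a -> heavy t b -> heavy (s + t) (a * b).
Proof.
move=> ha hb x B; rewrite kernM => h.
have [C /andP[CB]] : exists C : {set T}, (C \subset B) && (a (x, C) * b (sdiff x C, B :\: C)%SET != 0).
  apply/existsP; apply: contraNT h; rewrite negb_exists => /forallP h.
  apply/eqP; rewrite big1// => C CB; apply/eqP.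
  by have := h C; rewrite CB negbK.
rewrite mulf_eq0 negb_or => /andP[/ha h1 /hb h2].
by rewrite (V_add CB) lerD.
Qed.

(** Every factor [c'] flips a set of weight at least 1, so [V_T] leaves only the first power of [c']
    in the logarithm. *)
Let c'_heavy k : heavy k%:R (c' ^+ k).
Proof.
elim: k => [|k IH].
  move=> x B; rewrite expr0 kern1; have [->|_] := eqVneq B set0; last by rewrite eqxx.
  by rewrite V0.
rewrite exprS -natr1 addrC; apply: heavyM => // x B /c'_cross; exact: V_cross_sym.
Qed.

Let ktrace_log_c' : ktrace_log c' = - ktrace c'.
Proof.
rewrite /ktrace_log -(prednK T0) big_ord_recl /= expr1 divr1 mulN1r big1 ?addr0// => k _.
rewrite [ktrace _]big1 ?mulr0// => x _.
apply/eqP; apply: contraTT V_T => /c'_heavy; rewrite -leNgt; apply: le_trans.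
by rewrite ler_nat.
Qed.

(** For [p x] this is the Moebius function from the empty set to [B] in the poset of the sets [B]
    with [p (sdiff x B)], ordered by inclusion; [kernE] is its recursion. *)
Let h x B : R := (-1) ^+ #|B| * E (x, B).

(** This is the entry at (x, D) of [kinv e * (1 + e) = 1] multiplied by the sign of [D], which turns
    the sign of the last flip [D :\: B] into that of [B]. *)
Let kernE x D : p x -> p (sdiff x D) ->
  \sum_(B : {set T} | (B \subset D) && p (sdiff x B)) h x B = (D == set0)%:R.
Proof.
move=> px pD.
have := congr1 (fun a : kern T R => a (x, D)) (kinvl e_trunc); rewrite kernM kern1 => hE.
transitivity ((-1) ^+ #|D| * (D == set0)%:R : R); last first.
  by have [->|] := eqVneq D set0; rewrite ?mulr0 ?cards0 ?mulr1.
rewrite -hE mulr_sumr big_mkcondr /=; apply: eq_bigr => B BD.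
rewrite kernD kern1 eE ffunE /= sdiff_setD// setD_eq0.
have -> : same (sdiff x B) (sdiff x D) = p (sdiff x B).
  by rewrite /same pD (negbTE (p_excl pD)) andbF orbF andbT.
have cD : #|D| = (#|B| + #|D :\: B|)%N by rewrite -(cardsID B D) (setIidPr BD).
have [DB|DB] := boolP (D \subset B).
  have -> : B = D by apply/eqP; rewrite eqEsubset BD.
  by rewrite pD mul0r mulr0 addr0 mulr1.
case: ifP => _; last by rewrite mul0r addr0 !mulr0.
have s2 : (-1) ^+ #|D :\: B| * (-1) ^+ #|D :\: B| = 1 :> R by rewrite -expr2 sqrr_sign.
rewrite add0r !mul1r /h cD exprD; set s := (-1) ^+ #|D :\: B| in s2 *.
by transitivity ((-1) ^+ #|B| * E (x, B) * (s * s)); [rewrite s2 mulr1|ring].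
Qed.

Let down_setU x B : p (sdiff x B) -> p (sdiff x (B :|: x)%SET).
Proof.
apply: p_down; apply/subsetP => i; rewrite !in_sdiff inE.
by case: (i \in x); case: (i \in B).
Qed.

(** Rota's closure argument: B |-> B :|: x is a closure operator on the poset, by [down_setU], and
    the empty set is not closed. By [kernE] the sum over all B below [U] vanishes, and by induction
    so do the fibres over smaller sets; only the fibre over [U] remains. *)
Let sum_h_fiber x U : p x -> x != set0 ->
  \sum_(B : {set T} | p (sdiff x B) && ((B :|: x)%SET == U)) h x B = 0.
Proof.
move=> px x0; have [m] := ubnP #|U|; elim: m U => // m IH U Um.
have [/andP[pU xU]|nU] := boolP (p (sdiff x U) && (x \subset U)); last first.
  rewrite big_pred0// => B; apply/negbTE; apply: contra nU => /andP[pB /eqP <-].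
  by rewrite down_setU//= subsetUr.
have U0 : (U == set0) = false.
  by apply: contraNF x0 => /eqP U0; rewrite -subset0 -U0.
have := kernE px pU; rewrite U0 mulr0n.
rewrite (partition_big (fun B => (B :|: x)%SET) (fun W => W \subset U)) /=; last first.
  by move=> B /andP[BU _]; rewrite subUset BU xU.
rewrite (bigD1 U)//= [X in _ + X]big1 => [|W /andP[WU nWU]].
  rewrite addr0 => s0; rewrite -[RHS]s0; apply: eq_bigl => B.
  have [/eqP e1|//] := boolP ((B :|: x)%SET == U); last by rewrite !andbF.
  by rewrite -e1 subsetUl.
have Wm : (#|W| < m)%N.
  by rewrite ltnS in Um; apply: leq_trans Um; apply: proper_card; rewrite properEneq nWU.
rewrite -[RHS](IH W Wm).
apply: eq_bigl => B; have [/eqP e1|//] := boolP ((B :|: x)%SET == W); last by rewrite !andbF.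
by rewrite !andbT (subset_trans _ WU)// -e1 subsetUl.
Qed.

Let sum_h_eq0 x : p x -> x != set0 -> \sum_(B : {set T} | p (sdiff x B)) h x B = 0.
Proof.
move=> px x0; rewrite (partition_big (fun B => (B :|: x)%SET) xpredT) //=.
by rewrite big1// => U _; exact: sum_h_fiber.
Qed.

(** Starting from the empty pattern the poset is the down-closed family [p] itself, whose intervals
    from the empty set are full Boolean lattices. *)
Let h0E B : p B -> h set0 B = (-1) ^+ #|B|.
Proof.
have s0 D : sdiff set0 D = D by rewrite sdiffC sdiff0.
have [m] := ubnP #|B|; elim: m B => // m IH B Bm pB.
have p0 : p set0 by apply: p_down pB; exact: sub0set.
have := @kernE set0 B p0; rewrite s0 => /(_ pB).
rewrite -sum_subset_sign.
rewrite (eq_bigl (fun D => D \subset B)); last first.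
  by move=> D; rewrite s0; have [DB|//] := boolP (D \subset B); exact: p_down pB.
rewrite (bigD1 B)//= [RHS](bigD1 B)//=.
rewrite (eq_bigr (fun D => (-1) ^+ #|D|)); first exact: addIr.
move=> D /andP[DB nDB]; apply: IH; last exact: p_down pB.
by rewrite ltnS in Bm; apply: leq_trans Bm; apply: proper_card; rewrite properEneq nDB.
Qed.

(** As [~: x] lies in [q], the last step flips [~: B] at a pattern of [p]; its sign is that of [B]
    up to the global sign. *)
Let c'T x : p x -> c' (x, setT) = (-1) ^+ #|T| * \sum_(B : {set T} | p (sdiff x B)) h x B.
Proof.
move=> px; rewrite /c' kernM mulr_sumr [RHS]big_mkcond /=.
rewrite (eq_bigl xpredT); last by move=> B; rewrite subsetT.
apply: eq_bigr => B _; rewrite setTD cE sdiff_setC.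
have qx : q (~: x)%SET by rewrite qC.
have npx : p (~: x)%SET = false by apply/negbTE; have := p_excl px.
have -> : cross (sdiff x B) (~: x)%SET = p (sdiff x B) by rewrite /cross qx npx andbT andbF orbF.
case: ifP => [pB|_]; last by rewrite mul0r mulr0.
(* [kmoebius] vanishes at the empty flip, so the case [B = setT] has to be excluded: it would put
   [~: x] in [p]. *)
have nB : (~: B)%SET != set0.
  apply: contraTneq pB => nB; have -> : B = setT by rewrite -[B]setCK nB setC0.
  by rewrite sdiffT npx.
rewrite ffunE /= nB !mul1r /h.
have -> : #|T| = (#|B| + #|~: B|)%N by rewrite cardsC.
have s2 : (-1) ^+ #|B| * (-1) ^+ #|B| = 1 :> R by rewrite -expr2 sqrr_sign.
rewrite exprD; set s := (-1) ^+ #|B| in s2 *.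
by transitivity (E (x, B) * (-1) ^+ #|~: B| * (s * s)); [rewrite s2 mulr1|ring].
Qed.

Let c'_antip : antipodal c'.
Proof. by apply: antipodalM => //; exact: kinv_antipodal. Qed.

(** The starts in [q] mirror those in [p], whence the 2; among the latter only the empty set
    contributes, by [sum_h_eq0]. *)
Let ktrace_c' : ktrace c' = 2 * (-1) ^+ #|T| * \sum_(A : {set T} | p A) (-1) ^+ #|A|.
Proof.
have half : \sum_(x | p x) c' (x, setT) = (-1) ^+ #|T| * \sum_(A : {set T} | p A) (-1) ^+ #|A|.
  have [p0|p0] := boolP (p set0); last first.
    rewrite !big_pred0 ?mulr0// => A; apply: contraNF p0 => pA; apply: p_down pA; exact: sub0set.
  rewrite (bigD1 set0)//= big1 ?addr0 => [|x /andP[px x0]]; last by rewrite c'T// sum_h_eq0// mulr0.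
  rewrite c'T//; congr (_ * _); apply: eq_big => [B|B pB]; first by rewrite sdiffC sdiff0.
  by apply: h0E; move: pB; rewrite sdiffC sdiff0.
rewrite /ktrace (bigID p) /= half.
rewrite [X in _ + X = _](bigID q) /= [X in _ + (_ + X) = _]big1 ?addr0; last first.
  move=> x /andP[npx nqx]; apply/eqP; apply: contraNT npx => /c'_cross.
  by rewrite /cross (negbTE nqx) orbF => /andP[].
rewrite [X in _ + X = _](_ : _ = \sum_(x | p x) c' (x, setT)); first by rewrite half; ring.
rewrite (reindex_inj (@setC_inj T)) /=; apply: eq_big => [x|x _]; last by rewrite c'_antip.
by rewrite qC -/(q x) andbC; have := @p_excl x; case: (p x) => //= ->.
Qed.

Lemma ktrace_log_bad :
  ktrace_log (kmoebius T R * kdiag (fun x => (p x || p (~: x)%SET)%:R)) =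
  - 2 * (-1) ^+ #|T| * \sum_(A : {set T} | p A) (-1) ^+ #|A|.
Proof.
rewrite ktrace_log_compress => [|x|x]; last 2 first.
- by rewrite -natrM mulnb andbb.
- by rewrite setCK orbC.
rewrite -/f ecE (@ktrace_logM _ _ T0 (e + c) e c')//; last 2 first.
- by rewrite /c' => x D D1; rewrite (@trunc_kernM _ _ 0 1 E c).
- by rewrite mulrDr mulr1 /c' mulrA kinvr// mul1r addrA.
by rewrite ktrace_log_e add0r ktrace_log_c' ktrace_c'; ring.
Qed.

End bad_patterns.

(** * Ordered set partitions *)

Section ordered_partitions.
Variable T : finType.
Implicit Types (B D x : {set T}) (l : seq {set T}).

(** The recursion follows the product of kernels, where each flip is removed from the set still to
    be flipped. *)
Fixpoint ordpart D l : bool :=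
  if l is B :: l' then [&& B != set0, B \subset D & ordpart (D :\: B)%SET l'] else D == set0.

Lemma ordpartE D l : ordpart D l = uniq l && partition [set B in l]%SET D.
Proof.
elim: l D => [|B l IH] D /=.
  rewrite (_ : [set B in [::]]%SET = set0); last by apply/setP => B; rewrite !inE.
  by rewrite /partition /trivIset /cover !big_set0 cards0 eqxx inE !andbT eq_sym.
rewrite IH set_cons.
apply/and3P/andP => [[B0 BD /andP[ul pl]]|[/andP[Bl ul] pl]].
  have lD C : C \in l -> C \subset (D :\: B)%SET.
    by move=> Cl; apply: (partitionS pl); rewrite inE.
  split.
    rewrite ul andbT; apply: contra B0 => /lD; rewrite subsetD => /andP[_].
    by rewrite -setI_eq0 setIid.
  have -> : D = (B :|: (D :\: B))%SET by rewrite -[LHS](setID D B) (setIidPr BD).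
  apply: partitionU1 => //.
  by rewrite disjoint_sym; have := subxx (D :\: B)%SET; rewrite subsetD => /andP[].
have Bin : B \in (B |: [set C in l])%SET by rewrite setU11.
have [h1 h2 h3] := and3P pl.
split.
- by apply: contraNneq h3 => <-.
- exact: partitionS pl Bin.
- rewrite ul /=; have := partitionD1 pl Bin; congr partition.
  by rewrite setU1K// inE.
Qed.

End ordered_partitions.

(** * Powers of the step kernel as sums over paths of sign patterns *)

Section sign_paths.
Variables (T : finType) (R : numFieldType) (g : {set T} -> R).
Implicit Types (B D x : {set T}) (l : seq {set T}).

(** The start carries no factor of its own: when the blocks cover everything, its complement is the
    last pattern and is counted there. *)
Fixpoint flip_path x l : R :=
  if l is B :: l' then g (sdiff x B) * flip_path (sdiff x B) l' else 1.

Lemma big_tuple_cons k (P : seq {set T} -> bool) (F : seq {set T} -> R) :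
  \sum_(t : k.+1.-tuple {set T} | P t) F t =
  \sum_(B : {set T}) \sum_(t : k.-tuple {set T} | P (B :: t)) F (B :: t).
Proof.
rewrite pair_big_dep /= (reindex (fun r : {set T} * k.-tuple {set T} => [tuple of r.1 :: r.2])) //=.
exists (fun t => (thead t, [tuple of behead t])) => [[B t] _|t _] /=.
  by congr pair; apply: val_inj.
by apply: val_inj; case/tupleP: t => B t.
Qed.

Lemma kstep_diagX k x D :
  ((kstep T R * kdiag g) ^+ k) (x, D) = \sum_(t : k.-tuple {set T} | ordpart D t) flip_path x t.
Proof.
elim: k x D => [|k IH] x D.
  rewrite expr0 kern1; have [->|D0] := eqVneq D set0.
    rewrite (big_pred1 [tuple]) => [|t]; first by [].
    by rewrite (tuple0 t) /= !eqxx.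
  by rewrite big_pred0// => t; rewrite (tuple0 t) /= (negbTE D0).
rewrite exprS kernM big_tuple_cons big_mkcond; apply: eq_bigr => B _ /=.
case: (boolP (B \subset D)) => BD; last by rewrite big_pred0// => t; rewrite andbF.
rewrite kdiagMr ffunE /=; have [_|B0] := eqVneq B set0.
  by rewrite !mul0r big_pred0.
by rewrite mul1r IH mulr_sumr.
Qed.

Lemma flip_path_rcons x l B :
  flip_path x (rcons l B) = flip_path x l * g (sdiff (foldl (@sdiff T) x l) B).
Proof. by elim: l x => [|C l IH] x /=; rewrite ?mulr1 ?mul1r// IH mulrA. Qed.

Lemma flip_path_prod x l :
  flip_path x l = \prod_(i < size l) g (foldl (@sdiff T) x (take i.+1 l)).
Proof.
elim: l x => [|C l IH] x /=; first by rewrite big_ord0.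
by rewrite big_ord_recl /= take0 IH.
Qed.

Lemma foldl_sdiff_ordpart x D l : ordpart D l -> foldl (@sdiff T) x l = sdiff x D.
Proof.
elim: l x D => [|B l IH] x D /=; first by move=> /eqP ->; rewrite sdiff0.
by move=> /and3P[_ BD /IH ->]; rewrite sdiff_setD.
Qed.

Hypothesis gC : forall x, g (~: x)%SET = g x.

(** With the start moved to [sdiff x B], the factor lost at the first pattern reappears at the last
    one, its complement. *)
Lemma sum_flip_path_rot l : ordpart setT l ->
  \sum_x flip_path x (rot 1 l) = \sum_x flip_path x l.
Proof.
case: l => [|B l] //= /and3P[_ BT ol].
rewrite rot1_cons [LHS](reindex_inj (inv_inj (@sdiffK _ B))) /=.
apply: eq_bigr => x _; rewrite flip_path_rcons (foldl_sdiff_ordpart _ ol).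
by rewrite setTD sdiff_setC sdiffCl gC mulrC.
Qed.

Section blocks.
Variables (k : nat) (b : 'I_k -> {set T}).
Hypothesis b_part : forall s : 'S_k, ordpart setT [seq b (s i) | i <- enum 'I_k].

Let psi (s : 'S_k) : R := \sum_x flip_path x [seq b (s i) | i <- enum 'I_k].

Let psi_ordS (s : 'S_k) : psi (perm (@ordS_inj k) * s)%g = psi s.
Proof.
rewrite /psi -(sum_flip_path_rot (b_part s)); apply: eq_bigr => x _; congr flip_path.
have sz : size [seq b (s i) | i <- enum 'I_k] = k by rewrite size_map size_enum_ord.
apply: (@eq_from_nth _ set0); first by rewrite size_rot !size_map.
move=> i; rewrite size_map size_enum_ord => ik.
have k0 : (0 < k)%N by exact: leq_ltn_trans ik.
pose j := Ordinal ik.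
rewrite (nth_map j) ?size_enum_ord// (nth_ord_enum j j) permM permE.
have -> : nth set0 (rot 1 [seq b (s i0) | i0 <- enum 'I_k]) i =
    nth set0 [seq b (s i0) | i0 <- enum 'I_k] (ordS j).
  rewrite /rot nth_cat size_drop sz /=.
  case: ltnP => [ik1|ik1]; first by rewrite ltn_subRL add1n in ik1; rewrite nth_drop add1n modn_small.
  have ei : i = k.-1 by apply/eqP; rewrite eqn_leq -subn1 ik1 subn1 -ltnS (prednK k0) ik.
  by rewrite ei subn1 subnn (prednK k0) modnn nth_take.
by rewrite (nth_map j) ?size_enum_ord// nth_ord_enum.
Qed.

(** By rotation the sum over the permutations sending j to a does not depend on j, and over all j
    these sums exhaust the permutations. This undoes the normalisation of the first entry in
    [chi_star]. *)
Lemma sum_flip_path_perm (a : 'I_k) (j : 'I_k) :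
  k%:R * \sum_(s : 'S_k | s j == a) psi s = \sum_(s : 'S_k) psi s.
Proof.
pose A (i : 'I_k) := \sum_(s : 'S_k | s i == a) psi s.
have AS i : A (ordS i) = A i.
  rewrite /A [RHS](reindex_inj (mulgI (perm (@ordS_inj k)))) /=.
  by apply: eq_big => [s|s _]; rewrite ?permM ?permE ?psi_ordS.
have Aiter m i : A (iter m (@ordS k) i) = A i by elim: m => //= m IH; rewrite AS.
have Aj i : A i = A j.
  (* This many cyclic successor steps lead from [j] to [i] modulo k. *)
  rewrite -(Aiter (i + (k - j))%N j); congr A; apply: val_inj.
  have h m : val (iter m (@ordS k) j) = ((j + m) %% k)%N.
    elim: m => [|m IH] /=; first by rewrite addn0 modn_small.
    by rewrite IH -[X in (X %% _)%N = _]addn1 modnDml addn1 addnS.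
  by rewrite h addnCA subnKC 1?ltnW// modnDr modn_small.
transitivity (\sum_(i < k) A i).
  by rewrite [RHS](eq_bigr (fun=> A j)) => [|i _ //]; rewrite [RHS]sumr_const card_ord mulr_natl.
rewrite /A (exchange_big_dep xpredT) //=; apply: eq_bigr => s _.
rewrite (big_pred1 ((s^-1)%g a)) // => i; apply/eqP/eqP => [<-|->]; by rewrite ?permK ?permKV.
Qed.

End blocks.

Lemma sum_tuple_perm (F : {set {set T}}) (phi : seq {set T} -> R) :
  \sum_(t : #|F|.-tuple {set T} | uniq t && ([set B in t]%SET == F)) phi t =
  \sum_(s : 'S_#|F|) phi [seq enum_val (s i) | i <- enum 'I_#|F|].
Proof.
pose h (s : 'S_#|F|) : #|F|.-tuple {set T} := [tuple enum_val (s i) | i < #|F|].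
have hI : injective h.
  move=> s s' e; apply/permP => i; apply: enum_val_inj.
  by have := congr1 (fun t => tnth t i) e; rewrite !tnth_mktuple.
rewrite (eq_bigl (mem (h @: setT))); last first.
  move=> t; apply/andP/imsetP => [[ut /eqP tF]|[s _ ->]].
    have tin i : tnth t i \in F by have /setP/(_ (tnth t i)) := tF; rewrite inE mem_tnth => <-.
    pose f i := enum_rank_in (tin i) (tnth t i).
    have fE i : enum_val (f i) = tnth t i by rewrite enum_rankK_in.
    have fI : injective f.
      move=> i j /(congr1 enum_val); rewrite !fE => e.
      exact: (tuple_uniqP _ ut).
    exists (perm fI) => //; apply: eq_from_tnth => i.
    by rewrite tnth_mktuple permE fE.
  split.
    apply/tuple_uniqP => i j; rewrite !tnth_mktuple => /enum_val_inj; exact: perm_inj.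
  apply/eqP/setP => B; rewrite inE; apply/tnthP/idP => [[i ->]|BF].
    by rewrite tnth_mktuple enum_valP.
  by exists ((s^-1)%g (enum_rank_in BF B)); rewrite tnth_mktuple permKV enum_rankK_in.
rewrite big_imset /=; last by move=> s s' _ _; exact: hI.
by apply: eq_bigl => s; rewrite inE.
Qed.

Lemma sum_ordpart k (phi : seq {set T} -> R) :
  \sum_(t : k.-tuple {set T} | ordpart setT t) phi t =
  \sum_(F : {set {set T}} | partition F setT && (#|F| == k))
    \sum_(s : 'S_#|F|) phi [seq enum_val (s i) | i <- enum 'I_#|F|].
Proof.
rewrite (partition_big (fun t : k.-tuple {set T} => [set B in t]%SET)
  (fun F => partition F setT && (#|F| == k))) /=; last first.
  move=> t; rewrite ordpartE => /andP[ut ->] /=.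
  by rewrite cardsE (card_uniqP ut) size_tuple.
apply: eq_bigr => F /andP[pF /eqP Fk]; subst k.
rewrite -sum_tuple_perm; apply: eq_bigl => t; rewrite ordpartE.
by have [->|] := eqVneq ([set B in t])%SET F; rewrite ?pF ?andbT ?andbF.
Qed.

Lemma card_partition_le (F : {set {set T}}) : partition F setT -> (#|F| <= #|T|)%N.
Proof.
move=> pF; rewrite -cardsT (card_partition pF) -sum1_card leq_sum// => B BF.
by rewrite card_gt0 (partition_neq0 pF BF).
Qed.

(** The k-th power sums over ordered partitions, that is, over partitions into k blocks together
    with an order of the blocks. A partition has at most #|T| blocks, so the finite logarithm
    reaches all of them. *)
Lemma ktrace_log_partition : (0 < #|T|)%N ->
  ktrace_log (kstep T R * kdiag g) =
  \sum_(F : {set {set T}} | partition F setT) (-1) ^+ #|F| / #|F|%:R *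
    \sum_(s : 'S_#|F|) \sum_x flip_path x [seq enum_val (s i) | i <- enum 'I_#|F|].
Proof.
move=> T0; rewrite /ktrace_log.
transitivity (\sum_(k < #|T|) \sum_(F : {set {set T}} | partition F setT && (#|F| == k.+1))
  (-1) ^+ #|F| / #|F|%:R *
    \sum_(s : 'S_#|F|) \sum_x flip_path x [seq enum_val (s i) | i <- enum 'I_#|F|]).
  apply: eq_bigr => k _; rewrite /ktrace.
  under eq_bigr do rewrite kstep_diagX.
  rewrite exchange_big /= (sum_ordpart k.+1 (fun l => \sum_x flip_path x l)) mulr_sumr.
  by apply: eq_bigr => F /andP[_ /eqP Fk]; congr (_ ^+ _ / _%:R * _).
rewrite (exchange_big_dep (fun F => partition F setT)) /=; last by move=> k F _ /andP[].
apply: eq_bigr => F pF.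
have F0 : (0 < #|F|)%N.
  rewrite card_gt0; apply: contraTneq T0 => F0; move: (cover_partition pF).
  by rewrite F0 /cover big_set0 -cardsT => <-; rewrite cards0.
have FT : (#|F|.-1 < #|T|)%N by rewrite prednK// card_partition_le.
rewrite (big_pred1 (Ordinal FT)) // => k; rewrite pF /=.
by rewrite -[in LHS](prednK F0) eqSS eq_sym.
Qed.

End sign_paths.

From mathcomp Require Import all_classical all_reals all_analysis.
From mathcomp Require Import measurable_realfun complex.
Import numFieldNormedType.Exports.
Local Open Scope classical_set_scope.
Local Open Scope ring_scope.

(** * Real and complex integrals *)

Section real_integral.
Context d (T : measurableType d) (R : realType) (mu : {measure set T -> \bar R}).
Implicit Types f g : T -> R.

Definition rintegrable f := mu.-integrable setT (EFin \o f).

Lemma rintegrable_meas f : rintegrable f -> measurable_fun setT f.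
Proof. by move=> /measurable_int/measurable_EFinP. Qed.

Lemma rintegrable_dom f g : measurable_fun setT f -> rintegrable g ->
  (forall x, `|f x| <= g x) -> rintegrable f.
Proof.
move=> mf ig fg; apply: (le_integrable measurableT _ _ ig).
  exact/measurable_EFinP.
move=> x _ /=; rewrite lee_fin (le_trans (fg x))// ler_norm//.
Qed.

Lemma rintegrableD f g : rintegrable f -> rintegrable g ->
  rintegrable (fun x => f x + g x).
Proof. by move=> fi gi; exact: (integrableD measurableT fi gi). Qed.

Lemma rintegrableZ c f : rintegrable f -> rintegrable (fun x => c * f x).
Proof. by move=> fi; exact: (integrableZl measurableT c fi). Qed.

Lemma rintegrable_norm f : rintegrable f -> rintegrable (fun x => `|f x|).
Proof. by move=> /integrable_norm. Qed.

Lemma rintegrable0 : rintegrable (fun=> 0).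
Proof. exact: integrable0. Qed.

Lemma EFin_Rintegral f : rintegrable f ->
  (\int[mu]_x (f x)%:E)%E = (\int[mu]_x f x)%:E.
Proof. by move=> i; rewrite fineK//; exact: integrable_fin_num. Qed.

Lemma rintegrable_mulr f g (M : R) : rintegrable f -> measurable_fun setT g ->
  (forall x, `|g x| <= M) -> rintegrable (fun x => f x * g x).
Proof.
move=> fi mg gM; apply: (@rintegrable_dom _ (fun x => M * `|f x|)).
- by apply: measurable_funM => //; exact: rintegrable_meas.
- exact/rintegrableZ/rintegrable_norm.
- by move=> x; rewrite normrM mulrC ler_wpM2r.
Qed.

End real_integral.

Section real_fubini.
Context d1 d2 (T1 : measurableType d1) (T2 : measurableType d2) (R : realType).

(** The positive and negative parts are integrated in the extended reals, where Tonelli's theorem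
    provides measurability. *)
Lemma measurable_Rintegral_param (m2 : {sigma_finite_measure set T2 -> \bar R})
    (F : T1 * T2 -> R) : measurable_fun setT F ->
  measurable_fun setT (fun x => \int[m2]_y F (x, y)).
Proof.
move=> mF; apply: measurableT_comp => //.
rewrite (_ : (fun x => _) = (fun x => (\int[m2]_y ((EFin \o F)^\+ (x, y)) -
                                \int[m2]_y ((EFin \o F)^\- (x, y)))%E)).
  apply: emeasurable_funB.
    apply: (measurable_fun_fubini_tonelli_F (m2 := m2)) => //.
    by apply: measurable_funepos; exact/measurable_EFinP.
  apply: (measurable_fun_fubini_tonelli_F (m2 := m2)) => //.
  by apply: measurable_funeneg; exact/measurable_EFinP.
apply/funext => x; rewrite [LHS]integralE.
by congr (_ - _)%E; apply: eq_integral => y _; rewrite ?funeposE ?funenegE.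
Qed.

Lemma rintegrable_prod (m1 : {sigma_finite_measure set T1 -> \bar R})
    (m2 : {sigma_finite_measure set T2 -> \bar R}) (F : T1 * T2 -> R) (g : T1 -> R) :
  measurable_fun setT F -> rintegrable m1 g ->
  (forall x, rintegrable m2 (fun y => F (x, y))) ->
  (forall x, \int[m2]_y `|F (x, y)| <= g x) ->
  rintegrable (m1 \x m2)%E F.
Proof.
move=> mF ig i2 Fg; apply/integrable12ltyP; first exact/measurable_EFinP.
apply: (@le_lt_trans _ _ (\int[m1]_x `|(g x)%:E|)%E); last first.
  by case/integrableP: ig.
apply: ge0_le_integral => //.
- by move=> x _; exact: integral_ge0.
- apply: (@measurable_fun_fubini_tonelli_F _ _ _ _ _ m2 (abse \o (EFin \o F))) => //.
  by apply: measurableT_comp => //; exact/measurable_EFinP.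
  by move=> p; exact: abse_ge0.
- by apply: measurableT_comp => //; exact: measurable_int ig.
- move=> x _ /=; have /EFin_Rintegral : rintegrable m2 (fun y => `|F (x, y)|).
    exact: rintegrable_norm.
  rewrite /= => ->; rewrite lee_fin.
  exact: le_trans (ler_norm _).
Qed.

Lemma rintegrable_prod_swap (m1 : {sigma_finite_measure set T1 -> \bar R})
    (m2 : {sigma_finite_measure set T2 -> \bar R}) (F : T1 * T2 -> R) :
  rintegrable (m1 \x m2)%E F -> rintegrable (m2 \x m1)%E (fun p => F (p.2, p.1)).
Proof.
move=> iF; have mF := rintegrable_meas iF.
apply/integrable12ltyP.
  by apply/measurable_EFinP; apply: (measurableT_comp mF); apply: measurable_fun_pair; [exact: measurable_snd|exact: measurable_fst].
have mE : measurable_fun setT (EFin \o F) by exact/measurable_EFinP.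
by have /(integrable21ltyP m1 m2 mE) := iF.
Qed.

Section fubini.
Variables (m1 : {sigma_finite_measure set T1 -> \bar R})
  (m2 : {sigma_finite_measure set T2 -> \bar R}).
Variable F : T1 * T2 -> R.
Hypothesis iF : rintegrable (m1 \x m2)%E F.
Hypothesis i2 : forall x, rintegrable m2 (fun y => F (x, y)).

Lemma rintegrable_fubini : rintegrable m1 (fun x => \int[m2]_y F (x, y)).
Proof.
have := integrable_fubini_F iF; congr (integrable _ _ _).
by apply/funext => x; exact: (EFin_Rintegral (i2 x)).
Qed.

(** Integrability of every section makes the extended inner integral finite at each point, hence
    equal to the real one. *)
Lemma Rintegral_prod : \int[(m1 \x m2)%E]_z F z = \int[m1]_x \int[m2]_y F (x, y).
Proof.
rewrite /Rintegral -integral12_prod_meas1//.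
congr fine; apply: eq_integral => x _; rewrite /fubini_F.
by rewrite fineK//; apply: integrable_fin_num => //; exact: i2.
Qed.

Hypothesis i1 : forall y, rintegrable m1 (fun x => F (x, y)).

Lemma Rintegral_fubini :
  \int[m1]_x \int[m2]_y F (x, y) = \int[m2]_y \int[m1]_x F (x, y).
Proof.
rewrite -Rintegral_prod /Rintegral -integral21_prod_meas1//.
congr fine; apply: eq_integral => x _; rewrite /fubini_G.
by rewrite fineK//; apply: integrable_fin_num => //; exact: i1.
Qed.

End fubini.
End real_fubini.

(** * Affine substitution in integrals over the line *)

Section affine.
Variable R : realType.
Notation lam := (@lebesgue_measure R).

Let affine (a b : R) (x : measurableTypeR R) : measurableTypeR R := a * x + b.

Let measurable_affine a b : measurable_fun setT (affine a b).
Proof. by apply: measurable_funD => //; apply: measurable_funM. Qed.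

Let affine_measure a b : {measure set (measurableTypeR R) -> \bar R} :=
  [the {measure set (measurableTypeR R) -> \bar R} of
   mscale (NngNum (normr_ge0 a))
    (measure_function_pushforward__canonical__measure_function_Measure
       lam (@measurable_affine a b))].

(** By uniqueness it is enough to compare lengths of half-open intervals; for negative [a] the
    preimage is half-open on the other side. *)
Lemma lebesgue_measure_affine (a b : R) (A : set R) : a != 0 -> measurable A ->
  (lam A = `|a|%:E * lam ((fun x : R => a * x + b)%R @^-1` A))%E.
Proof.
move=> a0 mA.
apply: (@lebesgue_measure_unique _ (affine_measure a b)) => // X [[c e]] /= _ <-.
rewrite /affine_measure /mscale /pushforward /= !lebesgue_measure_itv /=.
case: (ltgtP 0 a) a0 => // a0 _.
  rewrite (_ : pushforward _ _ _ = lam `](c - b) / a, (e - b) / a]%classic); last first.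
    congr (lam _); apply/seteqP; split => x; rewrite /affine /= !in_itv /= ltr_pdivrMr// ler_pdivlMr//; lra.
  rewrite lebesgue_measure_itv /= !lte_fin ltr_pM2r ?invr_gt0// ltrD2r.
  case: ifPn => _; last by rewrite mule0.
  by rewrite (gtr0_norm a0) -!EFinB -EFinM; congr EFin; field; rewrite gt_eqF.
rewrite (_ : pushforward _ _ _ = lam `[(e - b) / a, (c - b) / a[%classic); last first.
  congr (lam _); apply/seteqP; split => x; rewrite /affine /= !in_itv /= ltr_ndivlMr// ler_ndivrMr//; lra.
rewrite lebesgue_measure_itv /= !lte_fin ltr_nM2r ?invr_lt0// ltrD2r.
case: ifPn => _; last by rewrite mule0.
by rewrite (ltr0_norm a0) -!EFinB -EFinM; congr EFin; field; rewrite lt_eqF.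
Qed.

Lemma ge0_integral_affine (a b : R) (f : R -> \bar R) : a != 0 ->
  measurable_fun setT f -> (forall x, 0 <= f x)%E ->
  (\int[lam]_x f x = `|a|%:E * \int[lam]_x f (a * x + b)%R)%E.
Proof.
move=> a0 mf f0.
rewrite (@eq_measure_integral _ _ _ _ (affine_measure a b)); last first.
  by move=> A mA _; exact: lebesgue_measure_affine.
by rewrite ge0_integral_mscale// ge0_integral_pushforward.
Qed.

Lemma rintegrable_affine (a b : R) (f : R -> R) : a != 0 ->
  rintegrable lam f -> rintegrable lam (fun x => f (a * x + b)).
Proof.
move=> a0 fi; have mf := rintegrable_meas fi.
apply/integrableP; split.
  by apply/measurable_EFinP; exact: (measurableT_comp mf (@measurable_affine a b)).
case/integrableP: (fi) => _; rewrite (@ge0_integral_affine a b)//; last first.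
  by apply: measurableT_comp => //; exact/measurable_EFinP.
by rewrite !ltey; apply: contraNN => /eqP /= ->; rewrite gt0_muley// lte_fin normr_gt0.
Qed.

Lemma Rintegral_affine (a b : R) (f : R -> R) : a != 0 -> rintegrable lam f ->
  \int[lam]_x f x = `|a| * \int[lam]_x f (a * x + b).
Proof.
move=> a0 fi; have fai := rintegrable_affine b a0 fi.
suff h : (\int[lam]_x (f x)%:E = `|a|%:E * \int[lam]_x (f (a * x + b))%:E)%E.
  by apply: EFin_inj; rewrite EFinM -!EFin_Rintegral.
have mf : measurable_fun setT (EFin \o f) by apply/measurable_EFinP; exact: rintegrable_meas fi.
rewrite [LHS]integralE (@ge0_integral_affine a b _ a0 (measurable_funepos mf))//.
rewrite (@ge0_integral_affine a b _ a0 (measurable_funeneg mf))//.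
rewrite [X in _ = (_ * X)%E]integralE [RHS]muleBr//; last first.
  by rewrite fin_num_adde_defr//; exact: integrable_pos_fin_num.
congr (_ * _ - _ * _)%E; apply: eq_integral => x _.
  by rewrite !funeposE.
by rewrite !funenegE.
Qed.

End affine.

Local Open Scope complex_scope.

Section complex_part.
Variable R : realType.
Implicit Types z w : R[i].

Lemma Re_add z w : complex.Re (z + w) = complex.Re z + complex.Re w.
Proof. by case: z w => [a b] [c d]. Qed.
Lemma Im_add z w : complex.Im (z + w) = complex.Im z + complex.Im w.
Proof. by case: z w => [a b] [c d]. Qed.
Lemma Re_mul z w : complex.Re (z * w) =
  complex.Re z * complex.Re w - complex.Im z * complex.Im w.
Proof. by case: z w => [a b] [c d]. Qed.
Lemma Im_mul z w : complex.Im (z * w) =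
  complex.Re z * complex.Im w + complex.Im z * complex.Re w.
Proof. by case: z w => [a b] [c d]. Qed.
Lemma complex_ext z w : complex.Re z = complex.Re w ->
  complex.Im z = complex.Im w -> z = w.
Proof. by case: z w => [a b] [c d] /= -> ->. Qed.

(* Real-valued, unlike the norm of R[i]. *)
Definition norm1c z : R := `|complex.Re z| + `|complex.Im z|.

Lemma norm1c_ge0 z : 0 <= norm1c z. Proof. by rewrite addr_ge0. Qed.
Lemma norm1c_Re z : `|complex.Re z| <= norm1c z. Proof. by rewrite lerDl. Qed.
Lemma norm1c_Im z : `|complex.Im z| <= norm1c z. Proof. by rewrite lerDr. Qed.
Lemma norm1cM z w : norm1c (z * w) <= norm1c z * norm1c w.
Proof.
rewrite /norm1c Re_mul Im_mul.
apply: (le_trans (lerD (ler_normB _ _) (ler_normD _ _))).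
rewrite !normrM; lra.
Qed.
Lemma norm1c_real (x : R) : norm1c x%:C = `|x|.
Proof. by rewrite /norm1c /= normr0 addr0. Qed.

End complex_part.

Section cmeasurable.
Context d (T : measurableType d) (R : realType).
Implicit Types f g : T -> R[i].

Definition cmeasurable f :=
  measurable_fun setT (fun x => complex.Re (f x)) /\
  measurable_fun setT (fun x => complex.Im (f x)).

Lemma cmeasurableM f g : cmeasurable f -> cmeasurable g ->
  cmeasurable (fun x => f x * g x).
Proof.
move=> [? ?] [? ?]; split.
  by under eq_fun do rewrite Re_mul; apply: measurable_funB; exact: measurable_funM.
by under eq_fun do rewrite Im_mul; apply: measurable_funD; exact: measurable_funM.
Qed.

Lemma cmeasurable_cst c : cmeasurable (fun=> c).
Proof. by split; exact: measurable_cst. Qed.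

Lemma cmeasurable_real (f : T -> R) : measurable_fun setT f ->
  cmeasurable (fun x => (f x)%:C).
Proof. by move=> mf; split => //=; exact: measurable_cst. Qed.

Lemma cmeasurable_prod I (r : seq I) (P : pred I) (F : I -> T -> R[i]) :
  (forall i, cmeasurable (F i)) -> cmeasurable (fun x => \prod_(i <- r | P i) F i x).
Proof.
move=> mF; elim: r => [|i r IH].
  by under eq_fun do rewrite big_nil; exact: cmeasurable_cst.
under eq_fun do rewrite big_cons.
by case: (P i) => //; exact: cmeasurableM.
Qed.

End cmeasurable.

Lemma cmeasurable_comp d d' (S : measurableType d) (T : measurableType d')
  (R : realType) (f : T -> R[i]) (h : S -> T) :
  cmeasurable f -> measurable_fun setT h -> cmeasurable (fun x => f (h x)).
Proof. by move=> [mr mi] mh; split; [exact: (measurableT_comp mr)|exact: (measurableT_comp mi)]. Qed.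

Section cintegrable.
Context d (T : measurableType d) (R : realType) (mu : {measure set T -> \bar R}).
Implicit Types f g : T -> R[i].

Definition cintegrable f :=
  rintegrable mu (fun x => complex.Re (f x)) /\
  rintegrable mu (fun x => complex.Im (f x)).

Lemma cintegrable_meas f : cintegrable f -> cmeasurable f.
Proof. by move=> [fr fi]; split; [exact: rintegrable_meas fr|exact: rintegrable_meas fi]. Qed.

Lemma cintegrable_dom f (g : T -> R) : cmeasurable f -> rintegrable mu g ->
  (forall x, norm1c (f x) <= g x) -> cintegrable f.
Proof.
move=> [mr mi] ig fg; split; apply: (rintegrable_dom _ ig) => // x.
  exact: le_trans (norm1c_Re _) (fg x).
exact: le_trans (norm1c_Im _) (fg x).
Qed.

Lemma cintegrable_norm1c f : cintegrable f -> rintegrable mu (fun x => norm1c (f x)).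
Proof. by move=> [? ?]; apply: rintegrableD; exact: rintegrable_norm. Qed.

Lemma cintegrable_bddM f g (M : R) : cmeasurable f -> (forall x, norm1c (f x) <= M) ->
  cintegrable g -> cintegrable (fun x => f x * g x).
Proof.
move=> mf fM ig; apply: (cintegrable_dom (g := fun x => M * norm1c (g x))).
- by apply: cmeasurableM => //; exact: cintegrable_meas ig.
- exact/rintegrableZ/cintegrable_norm1c.
- move=> x; apply: (le_trans (norm1cM _ _)); apply: ler_wpM2r => //.
  exact: norm1c_ge0.
Qed.

Lemma cintegrableD f g : cintegrable f -> cintegrable g ->
  cintegrable (fun x => f x + g x).
Proof.
move=> [? ?] [? ?]; split.
  by under eq_fun do rewrite Re_add; exact: rintegrableD.
by under eq_fun do rewrite Im_add; exact: rintegrableD.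
Qed.

Lemma cintegrableZ (c : R[i]) f : cintegrable f -> cintegrable (fun x => c * f x).
Proof.
by move=> fi; apply: (@cintegrable_bddM (fun=> c) f (norm1c c)).
Qed.

Lemma cintegrable0 : cintegrable (fun=> 0).
Proof. by split; exact: rintegrable0. Qed.

Lemma cintegralD f g : cintegrable f -> cintegrable g ->
  cintegral mu setT (fun x => f x + g x) = cintegral mu setT f + cintegral mu setT g.
Proof.
move=> [? ?] [? ?]; apply: complex_ext => /=.
  by under eq_Rintegral do rewrite Re_add; exact: RintegralD.
by under eq_Rintegral do rewrite Im_add; exact: RintegralD.
Qed.

Lemma cintegralZ (c : R[i]) f : cintegrable f ->
  cintegral mu setT (fun x => c * f x) = c * cintegral mu setT f.
Proof.
move=> [? ?]; apply: complex_ext => /=.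
  under eq_Rintegral do rewrite Re_mul.
  rewrite RintegralB//; try exact: rintegrableZ.
  by rewrite !RintegralZl// Re_mul.
under eq_Rintegral do rewrite Im_mul.
rewrite RintegralD//; try exact: rintegrableZ.
by rewrite !RintegralZl// Im_mul.
Qed.

Lemma cintegral_sum (I : Type) (r : seq I) (P : pred I) (F : I -> T -> R[i]) :
  (forall i, cintegrable (F i)) ->
  cintegral mu setT (fun x => \sum_(i <- r | P i) F i x) =
  \sum_(i <- r | P i) cintegral mu setT (F i).
Proof.
move=> iF.
suff [] : cintegrable (fun x => \sum_(i <- r | P i) F i x) /\
  cintegral mu setT (fun x => \sum_(i <- r | P i) F i x) =
  \sum_(i <- r | P i) cintegral mu setT (F i) by [].
elim: r => [|i r [IH1 IH2]].
  under eq_fun do rewrite big_nil; rewrite big_nil; split; first exact: cintegrable0.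
  by apply: complex_ext => /=; rewrite Rintegral_cst//= mul0r.
under eq_fun do rewrite big_cons; rewrite big_cons.
case: (P i) => //; split; first exact: cintegrableD.
by rewrite cintegralD// IH2.
Qed.

Lemma norm1c_cintegral f : cintegrable f ->
  norm1c (cintegral mu setT f) <= \int[mu]_x norm1c (f x).
Proof.
move=> [fr fi]; rewrite /norm1c RintegralD//; try exact: rintegrable_norm.
by apply: lerD; exact: le_normr_Rintegral.
Qed.

Lemma eq_cintegral f g : f =1 g -> cintegral mu setT f = cintegral mu setT g.
Proof. by move=> /funext ->. Qed.

End cintegrable.

Section cfubini.
Context d1 d2 (T1 : measurableType d1) (T2 : measurableType d2) (R : realType).
Variables (m1 : {sigma_finite_measure set T1 -> \bar R})
  (m2 : {sigma_finite_measure set T2 -> \bar R}).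

Lemma cmeasurable_param (F : T1 * T2 -> R[i]) : cmeasurable F ->
  cmeasurable (fun x => cintegral m2 setT (fun y => F (x, y))).
Proof. by move=> [mr mi]; split; [exact: (measurable_Rintegral_param m2 mr)|exact: (measurable_Rintegral_param m2 mi)]. Qed.

Lemma cintegrable_prod (F : T1 * T2 -> R[i]) (g : T1 -> R) :
  cmeasurable F -> rintegrable m1 g ->
  (forall x, cintegrable m2 (fun y => F (x, y))) ->
  (forall x, \int[m2]_y norm1c (F (x, y)) <= g x) ->
  cintegrable (m1 \x m2)%E F.
Proof.
move=> [mr mi] ig iF Fg; split; apply: (rintegrable_prod _ ig) => //.
- by move=> x; case: (iF x).
- move=> x; apply: le_trans (Fg x); apply: le_Rintegral => //.
  + by apply: rintegrable_norm; case: (iF x).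
  + exact: cintegrable_norm1c.
  + by move=> y _; exact: norm1c_Re.
- by move=> x; case: (iF x).
- move=> x; apply: le_trans (Fg x); apply: le_Rintegral => //.
  + by apply: rintegrable_norm; case: (iF x).
  + exact: cintegrable_norm1c.
  + by move=> y _; exact: norm1c_Im.
Qed.

Lemma cintegral_prod (F : T1 * T2 -> R[i]) :
  cintegrable (m1 \x m2)%E F -> (forall x, cintegrable m2 (fun y => F (x, y))) ->
  cintegral (m1 \x m2)%E setT F =
  cintegral m1 setT (fun x => cintegral m2 setT (fun y => F (x, y))).
Proof.
move=> [ir ii] iF; apply: complex_ext.
  by apply: (Rintegral_prod ir) => x; case: (iF x).
by apply: (Rintegral_prod ii) => x; case: (iF x).
Qed.

Lemma cintegrable_fubini (F : T1 * T2 -> R[i]) :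
  cintegrable (m1 \x m2)%E F -> (forall x, cintegrable m2 (fun y => F (x, y))) ->
  cintegrable m1 (fun x => cintegral m2 setT (fun y => F (x, y))).
Proof.
move=> [ir ii] iF; split.
  by apply: (rintegrable_fubini ir) => x; case: (iF x).
by apply: (rintegrable_fubini ii) => x; case: (iF x).
Qed.

Lemma cintegral_fubini (F : T1 * T2 -> R[i]) :
  cintegrable (m1 \x m2)%E F -> (forall x, cintegrable m2 (fun y => F (x, y))) ->
  (forall y, cintegrable m1 (fun x => F (x, y))) ->
  cintegral m1 setT (fun x => cintegral m2 setT (fun y => F (x, y))) =
  cintegral m2 setT (fun y => cintegral m1 setT (fun x => F (x, y))).
Proof.
move=> [ir ii] iF iF'; apply: complex_ext.
  by apply: (Rintegral_fubini ir) => x; [case: (iF x)|case: (iF' x)].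
by apply: (Rintegral_fubini ii) => x; [case: (iF x)|case: (iF' x)].
Qed.

Lemma cintegrable_prod_swap (F : T1 * T2 -> R[i]) :
  cintegrable (m1 \x m2)%E F -> cintegrable (m2 \x m1)%E (fun p => F (p.2, p.1)).
Proof. by move=> [ir ii]; split; [exact: rintegrable_prod_swap ir|exact: rintegrable_prod_swap ii]. Qed.

End cfubini.

Section caffine.
Variable R : realType.
Notation lam := (@lebesgue_measure R).
Implicit Type f : R -> R[i].

Lemma cintegrable_shift f t : cintegrable lam f -> cintegrable lam (fun x => f (x + t)).
Proof.
have e1 x : x + t = 1 * x + t by rewrite mul1r.
move=> [fr fi]; split; under eq_fun do rewrite e1.
  exact: (rintegrable_affine t (oner_neq0 _) fr).
exact: (rintegrable_affine t (oner_neq0 _) fi).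
Qed.

Lemma cintegral_shift f t : cintegrable lam f ->
  cintegral lam setT (fun x => f (x + t)) = cintegral lam setT f.
Proof.
have e1 x : x + t = 1 * x + t by rewrite mul1r.
move=> [fr fi]; apply: complex_ext => /=.
  rewrite (Rintegral_affine t (oner_neq0 _) fr) normr1 mul1r.
  by apply: eq_Rintegral => x _; rewrite e1.
rewrite (Rintegral_affine t (oner_neq0 _) fi) normr1 mul1r.
by apply: eq_Rintegral => x _; rewrite e1.
Qed.

Lemma cintegrable_opp f : cintegrable lam f -> cintegrable lam (fun x => f (- x)).
Proof.
have e1 x : - x = (-1) * x + 0 :> R by rewrite mulN1r addr0.
have N1 : (-1 : R) != 0 by rewrite oppr_eq0 oner_neq0.
move=> [fr fi]; split; under eq_fun do rewrite e1.
  exact: (rintegrable_affine 0 N1 fr).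
exact: (rintegrable_affine 0 N1 fi).
Qed.

Lemma cintegral_opp f : cintegrable lam f ->
  cintegral lam setT (fun x => f (- x)) = cintegral lam setT f.
Proof.
have e1 x : - x = (-1) * x + 0 :> R by rewrite mulN1r addr0.
have N1 : (-1 : R) != 0 by rewrite oppr_eq0 oner_neq0.
move=> [fr fi]; apply: complex_ext => /=.
  rewrite (Rintegral_affine 0 N1 fr) normrN1 mul1r.
  by apply: eq_Rintegral => x _; rewrite e1.
rewrite (Rintegral_affine 0 N1 fi) normrN1 mul1r.
by apply: eq_Rintegral => x _; rewrite e1.
Qed.

End caffine.

(** * Fourier inversion and convolution *)

Section derive_rules.
Variable R : realType.
Implicit Types f g : R -> R.

Lemma is_derive_mul_fun f g (x df dg : R) : is_derive x 1 f df -> is_derive x 1 g dg ->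
  is_derive x 1 (fun y => f y * g y) (df * g x + f x * dg).
Proof.
move=> hf hg; apply: (is_derive_eq (is_deriveM hf hg)).
by rewrite addrC /GRing.scale /= (mulrC (g x)).
Qed.

Lemma is_derive_scale_fun f (c x df : R) : is_derive x 1 f df ->
  is_derive x 1 (fun y => c * f y) (c * df).
Proof.
move=> hf; apply: (is_derive_eq (is_derive_mul_fun (is_derive_cst c x 1) hf)).
by rewrite mul0r add0r.
Qed.

Lemma is_derive_comp_scale f (c x df : R) : is_derive (c * x) 1 f df ->
  is_derive x 1 (fun y => f (c * y)) (c * df).
Proof.
move=> hf; have h := is_derive_scale_fun c (is_derive_id x (1:R)).
by apply: (is_derive_eq (is_derive1_comp (g := fun y => c * y) hf h)); rewrite mulr1 mulrC.
Qed.
End derive_rules.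

(** * The Laplace integral behind the Poisson kernel *)

Section laplace.
Variable R : realType.
Notation lam := (@lebesgue_measure R).
Variables (e b : R).
Hypothesis e0 : 0 < e.

Let c := e ^+ 2 + b ^+ 2.
Let c_gt0 : 0 < c. Proof. by rewrite ltr_pwDl ?sqr_ge0 ?exprn_gt0. Qed.

(** An antiderivative of [f]. The 1 added to the cosine makes [f] nonnegative, as the fundamental
    theorem on a half-line used here requires; [integral_laplace] subtracts it again. *)
Let F (v : R) : R :=
  expR (- e * v) * (c^-1 * (b * sin (b * v) - e * cos (b * v)) - e^-1).
Let f (v : R) : R := expR (- e * v) * (1 + cos (b * v)).

Let dF (v : R) : is_derive v 1 F (f v).
Proof.
have d1 := is_derive_scale_fun b (is_derive_comp_scale (is_derive_sin (b * v))).
have d2 := is_derive_scale_fun e (is_derive_comp_scale (is_derive_cos (b * v))).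
have d3 := is_derive_scale_fun c^-1 (is_deriveB d1 d2).
have d5 := is_deriveB d3 (is_derive_cst (e^-1) v 1).
have d6 := is_derive_mul_fun (is_derive_comp_scale (is_derive_expR (- e * v))) d5.
apply: (is_derive_eq d6); rewrite /f /cst /= !fctE.
have cn0 : e ^+ 2 + b ^+ 2 != 0 by rewrite gt_eqF.
have en0 : e != 0 by rewrite gt_eqF.
by rewrite /c; field; rewrite cn0 en0.
Qed.

Let cf : continuous f.
Proof.
move=> x; apply: cvgM; first last.
  apply: cvgD; first exact: cvg_cst.
  apply: (@continuous_comp _ _ _ (fun y => b * y) cos); last exact: continuous_cos.
  by apply: cvgM; [exact: cvg_cst|exact: cvg_id].
apply: (@continuous_comp _ _ _ (fun y => - e * y) expR); last exact: continuous_expR.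
by apply: cvgM; [exact: cvg_cst|exact: cvg_id].
Qed.

Let f_ge0 x : 0 <= f x.
Proof.
by rewrite mulr_ge0 ?expR_ge0//; have := cos_geN1 (b * x); lra.
Qed.

Let Finf : F x @[x --> +oo] --> 0.
Proof.
pose M := c^-1 * (`|b| + e) + e^-1.
have M0 : 0 <= M.
  apply: addr_ge0; last by rewrite invr_ge0 ltW.
  by apply: mulr_ge0; [rewrite invr_ge0 ltW|apply: addr_ge0 => //; exact: ltW].
apply: norm_cvg0; apply: (@squeeze_cvgr _ _ _ _ (cst 0) (fun v => M * expR (- (e * v)))).
- near=> v; rewrite normr_ge0 /= normrM gtr0_norm ?expR_gt0// mulrC mulNr.
  apply: ler_wpM2r; first exact: expR_ge0.
  apply: (le_trans (ler_normB _ _)); apply: lerD; last by rewrite gtr0_norm ?invr_gt0.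
  rewrite normrM gtr0_norm ?invr_gt0// ler_wpM2l ?invr_ge0 ?(ltW c_gt0)//.
  apply: (le_trans (ler_normB _ _)); apply: lerD.
    by rewrite normrM ler_piMr// ler_norml sin_geN1 sin_le1.
  by rewrite normrM gtr0_norm// ler_piMr ?(ltW e0)// ler_norml cos_geN1 cos_le1.
- exact: cvg_cst.
- rewrite -[X in _ --> X](mulr0 M); apply: cvgM; first exact: cvg_cst.
  apply: (@cvg_comp _ _ _ (fun v => e * v) (fun w => expR (- w)) _ +oo); last exact: cvgr_expR.
  exact: gt0_cvgMry.
Unshelve. all: by end_near. Qed.

Lemma integral_laplace_half :
  (\int[lam]_(x in `[0%R, +oo[) (expR (- e * x) * (1 + cos (b * x)))%:E =
   (e^-1 + e / (e ^+ 2 + b ^+ 2))%:E)%E.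
Proof.
rewrite (@ge0_continuous_FTC2y _ f F _ _ _ _ Finf).
- rewrite /F !mulr0 sin0 cos0 expR0 mulr0 mul1r sub0r mulr1 -EFinB; congr EFin.
  by rewrite /c; ring.
- by [].
- exact: continuous_in_subspaceT.
- by move=> x _; exact: ex_derive.
- by apply: cvg_at_right_filter; apply/differentiable_continuous/derivable1_diffP.
- by move=> x _; rewrite derive1E; exact: derive_val.
Qed.

Lemma integral_laplace_cos :
  (\int[lam]_x (expR (- e * `|x|) * (1 + cos (b * x)))%:E =
   (2 * (e^-1 + e / (e ^+ 2 + b ^+ 2)))%:E)%E.
Proof.
rewrite ge0_symfun_integralT.
- rewrite EFinM -integral_laplace_half; congr (_ * _)%E.
  rewrite -set_itvcy; apply: eq_integral => x; rewrite inE /= in_itv/= andbT => x0.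
  by rewrite ger0_norm.
- by move=> x; rewrite mulr_ge0 ?expR_ge0//; have := cos_geN1 (b * x); lra.
- move=> x; apply: cvgM; first last.
    apply: cvgD; first exact: cvg_cst.
    apply: (@continuous_comp _ _ _ (fun y => b * y) cos); last exact: continuous_cos.
    by apply: cvgM; [exact: cvg_cst|exact: cvg_id].
  apply: (@continuous_comp _ _ _ (fun y => - e * `|y|) expR); last exact: continuous_expR.
  by apply: cvgM; [exact: cvg_cst|exact: norm_continuous].
- by move=> x /=; rewrite normrN mulrN cosN.
Qed.

End laplace.

Lemma Rintegral_dominated_cvg d (T : measurableType d) (R : realType)
    (mu : {measure set T -> \bar R}) (f_ : nat -> T -> R) (f g : T -> R) :
  (forall n, measurable_fun setT (f_ n)) -> measurable_fun setT f ->
  rintegrable mu g -> (forall n x, `|f_ n x| <= g x) ->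
  (forall x, f_ n x @[n --> \oo] --> f x) ->
  (\int[mu]_x f_ n x) @[n --> \oo] --> \int[mu]_x f x.
Proof.
move=> mf_ mf ig fg ff.
have [] := @dominated_convergence _ _ _ mu setT measurableT (fun n x => (f_ n x)%:E)
  (EFin \o f) (EFin \o g).
- by move=> n; exact/measurable_EFinP.
- exact/measurable_EFinP.
- by apply: aeW => x _; apply: cvg_EFin; [exact: nearW|exact: ff].
- exact: ig.
- by apply: aeW => x n _ /=; rewrite lee_fin.
move=> fi _ h.
apply: fine_cvg; rewrite fineK; last exact: integrable_fin_num.
exact: h.
Qed.

(** * The real cosine transform and its inversion *)

Section cosine_transform.
Variable R : realType.
Notation lam := (@lebesgue_measure R).

Definition cosft (f : R -> R) (u : R) : R := \int[lam]_x (f x * cos (2 * pi * x * u)).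

Lemma measurable_cos_mul (a : R) : measurable_fun setT (fun x : R => cos (a * x)).
Proof.
apply: continuous_measurable_fun => x.
apply: (@continuous_comp _ _ _ (fun y => a * y) cos); last exact: continuous_cos.
by apply: cvgM; [exact: cvg_cst|exact: cvg_id].
Qed.

Lemma measurable_cosft_kernel : measurable_fun setT (fun p : R * R => cos (2 * pi * p.1 * p.2)).
Proof.
apply: (@measurableT_comp _ _ _ _ _ _ (@cos R)).
  by apply: continuous_measurable_fun; exact: continuous_cos.
apply: measurable_funM; last exact: measurable_snd.
by apply: measurable_funM => //; exact: measurable_fst.
Qed.

Lemma norm_cos_le1 (x : R) : `|cos x| <= 1.
Proof. by rewrite ler_norml cos_geN1 cos_le1. Qed.

Lemma rintegrable_mulcos (f : R -> R) (u : R) : rintegrable lam f ->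
  rintegrable lam (fun x => f x * cos (2 * pi * x * u)).
Proof.
move=> fi; apply: (@rintegrable_mulr _ _ _ _ _ _ 1) => //; last first.
  by move=> x; exact: norm_cos_le1.
under eq_fun do rewrite -mulrA (mulrC _ u) mulrA; exact: measurable_cos_mul.
Qed.

Lemma measurable_cosft (f : R -> R) : measurable_fun setT f ->
  measurable_fun setT (cosft f).
Proof.
move=> mf.
apply: (measurable_Rintegral_param lam (F := fun p : R * R => f p.2 * cos (2 * pi * p.2 * p.1))).
apply: measurable_funM; first exact: (measurableT_comp mf measurable_snd).
apply: (measurableT_comp measurable_cosft_kernel (g := fun p : R * R => (p.2, p.1))).
by apply: measurable_fun_pair; [exact: measurable_snd|exact: measurable_fst].
Qed.

Lemma cosft_le (f : R -> R) u : rintegrable lam f -> `|cosft f u| <= \int[lam]_x `|f x|.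
Proof.
move=> fi; have fci := rintegrable_mulcos u fi.
apply: (le_trans (le_normr_Rintegral _ fci)) => //.
apply: le_Rintegral => //; [exact: rintegrable_norm|exact: rintegrable_norm|].
by move=> x _; rewrite normrM ler_piMr// norm_cos_le1.
Qed.

Let E (e x : R) := expR (- e * `|x|).

Let measurable_E e : measurable_fun setT (E e).
Proof.
apply: continuous_measurable_fun => x.
apply: (@continuous_comp _ _ _ (fun y => - e * `|y|) expR); last exact: continuous_expR.
by apply: cvgM; [exact: cvg_cst|exact: norm_continuous].
Qed.

Let laplace_integrable e b : 0 < e -> rintegrable lam (fun x => E e x * (1 + cos (b * x))).
Proof.
move=> e0; apply/integrableP; split.
  apply/measurable_EFinP; apply: measurable_funM; first exact: measurable_E.
  by apply: measurable_funD => //; exact: measurable_cos_mul.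
rewrite [X in (X < _)%E](_ : _ = (\int[lam]_x (E e x * (1 + cos (b * x)))%:E)%E).
  by rewrite integral_laplace_cos// ltry.
apply: eq_integral => x _ /=; rewrite ger0_norm// mulr_ge0 ?expR_ge0//.
Qed.

Let E_integrable e : 0 < e -> rintegrable lam (E e).
Proof.
move=> e0; have h := rintegrableZ 2^-1 (laplace_integrable 0 e0).
apply: eq_integrable h => // x _ /=; congr EFin.
by rewrite mul0r cos0; lra.
Qed.

Let integral_E e : 0 < e -> \int[lam]_x (E e x) = 2 / e.
Proof.
move=> e0.
have : \int[lam]_x (E e x * (1 + cos (0 * x))) = 2 * (e^-1 + e / (e ^+ 2 + 0 ^+ 2)).
  by rewrite /Rintegral integral_laplace_cos.
have -> : \int[lam]_x (E e x * (1 + cos (0 * x))) = 2 * \int[lam]_x (E e x).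
  rewrite -RintegralZl//; last exact: E_integrable.
  by apply: eq_Rintegral => x _; rewrite mul0r cos0 mulrC.
move=> h; have e1 : e != 0 by rewrite gt_eqF.
apply: (@mulfI _ 2) => //; by rewrite h expr0n /= addr0; field.
Qed.

Lemma integral_laplace e b : 0 < e ->
  \int[lam]_x (E e x * cos (b * x)) = 2 * e / (e ^+ 2 + b ^+ 2).
Proof.
move=> e0.
have h : \int[lam]_x (E e x * (1 + cos (b * x))) = 2 * (e^-1 + e / (e ^+ 2 + b ^+ 2)).
  by rewrite /Rintegral integral_laplace_cos.
transitivity (\int[lam]_x (E e x * (1 + cos (b * x)) - E e x)).
  by apply: eq_Rintegral => x _; lra.
rewrite RintegralB//; [|exact: laplace_integrable|exact: E_integrable].
rewrite h integral_E//.
have e1 : e != 0 by rewrite gt_eqF.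
have e2 : e ^+ 2 + b ^+ 2 != 0 by rewrite gt_eqF// ltr_pwDl ?sqr_ge0 ?exprn_gt0.
by field; rewrite e1 e2.
Qed.

Let Ecos_integrable e (g : R -> R) : 0 < e -> measurable_fun setT g ->
  (forall x, `|g x| <= 1) -> rintegrable lam (fun x => E e x * g x).
Proof. by move=> e0 mg g1; apply: (@rintegrable_mulr _ _ _ _ _ _ 1) => //; exact: E_integrable. Qed.

Let cauchy_ge0 (t : R) : 0 <= (1 + t ^+ 2)^-1.
Proof. by rewrite invr_ge0 addr_ge0// sqr_ge0. Qed.

Let integral_cauchy_ereal : (\int[lam]_t ((1 + t ^+ 2)^-1)%:E = (pi : R)%:E)%E.
Proof.
rewrite (@ge0_symfun_integralT _ (fun t : R => (1 + t ^+ 2)^-1)).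
- rewrite -set_itvcy [X in (_ * X)%E](_ : _ = (pi / 2)%:E); last exact: integral0y_oneDsqr.
  by rewrite -EFinM; congr EFin; field.
- exact: cauchy_ge0.
- exact: continuous_oneDsqrV.
- by move=> x /=; rewrite sqrrN.
Qed.

Let measurable_cauchy : measurable_fun setT (fun t : R => (1 + t ^+ 2)^-1).
Proof. by apply: continuous_measurable_fun; exact: continuous_oneDsqrV. Qed.

Let cauchy_integrable : rintegrable lam (fun t => (1 + t ^+ 2)^-1).
Proof.
apply/integrableP; split; first exact/measurable_EFinP.
rewrite [X in (X < _)%E](_ : _ = (pi : R)%:E) ?ltry//.
rewrite -integral_cauchy_ereal; apply: eq_integral => x _ /=.
by rewrite ger0_norm.
Qed.

Let integral_cauchy : \int[lam]_t (1 + t ^+ 2)^-1 = pi :> R.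
Proof. by rewrite /Rintegral integral_cauchy_ereal. Qed.

Lemma rintegrable_schwartz (g : R -> R) (M0 M2 : R) : measurable_fun setT g ->
  (forall x, `|g x| <= M0) -> (forall x, `|x ^+ 2 * g x| <= M2) -> rintegrable lam g.
Proof.
move=> mg g0 g2.
apply: (@rintegrable_dom _ _ _ lam g _ mg (rintegrableZ (M0 + M2) cauchy_integrable)) => x.
rewrite ler_pdivlMr; last by rewrite ltr_pwDl ?sqr_ge0.
by rewrite mulrDr mulr1 lerD//; have := g2 x; rewrite normrM (ger0_norm (sqr_ge0 _)) mulrC.
Qed.

Section inversion.
Variables (f : R -> R) (M : R).
Hypotheses (f_even : forall x, f (- x) = f x) (f_cont : continuous f)
  (f_le : forall x, `|f x| <= M) (f_int : rintegrable lam f)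
  (ft_int : rintegrable lam (cosft f)).

Let K e (b : R) := 2 * e / (e ^+ 2 + b ^+ 2).

Let K_bound e b : 0 < e -> `|K e b| <= 2 / e.
Proof.
move=> e0; rewrite /K ger0_norm; last first.
  by rewrite divr_ge0 ?mulr_ge0 ?addr_ge0 ?sqr_ge0// ltW.
rewrite ler_pdivrMr; last by rewrite ltr_pwDl ?sqr_ge0 ?exprn_gt0.
rewrite mulrAC ler_pdivlMr//; have := sqr_ge0 b; nra.
Qed.

Let measurable_f : measurable_fun setT f.
Proof. exact: continuous_measurable_fun. Qed.

Let measurable_K e : 0 < e -> measurable_fun setT (fun y => K e (2 * pi * y)).
Proof.
move=> e0; apply: continuous_measurable_fun => x; rewrite /K.
apply: cvgM; first exact: cvg_cst.
apply: cvgV; first by rewrite gt_eqF// ltr_pwDl ?sqr_ge0 ?exprn_gt0.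
apply: cvgD; first exact: cvg_cst.
by apply: cvgM; apply: cvgM; [exact: cvg_cst|exact: cvg_id|exact: cvg_cst|exact: cvg_id].
Qed.

(** The damping makes Fubini available. The product of two cosines yields Poisson kernels centred at
    x and - x, which have the same integral against the even function [f]. *)
Let damped e x : 0 < e ->
  \int[lam]_v (E e v * cos (2 * pi * x * v) * cosft f v) =
  \int[lam]_y (f y * K e (2 * pi * (y - x))).
Proof.
move=> e0.
pose G (p : R * R) := E e p.1 * cos (2 * pi * x * p.1) * (f p.2 * cos (2 * pi * p.2 * p.1)).
transitivity (\int[lam]_v \int[lam]_y G (v, y)).
  apply: eq_Rintegral => v _; rewrite /cosft -RintegralZl//.
  exact: rintegrable_mulcos.
have mG : measurable_fun setT G.
  apply: measurable_funM.
    apply: measurable_funM; first exact: (measurableT_comp (measurable_E e) measurable_fst).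
    exact: (measurableT_comp (measurable_cos_mul (2 * pi * x)) measurable_fst).
  apply: measurable_funM; first exact: (measurableT_comp measurable_f measurable_snd).
  apply: (measurableT_comp measurable_cosft_kernel (g := fun p : R * R => (p.2, p.1))).
  by apply: measurable_fun_pair; [exact: measurable_snd|exact: measurable_fst].
have G2 v : rintegrable lam (fun y => G (v, y)).
  exact: (rintegrableZ (E e v * cos (2 * pi * x * v)) (rintegrable_mulcos v f_int)).
have G1 y : rintegrable lam (fun v => G (v, y)).
  rewrite /G /=; under eq_fun do rewrite -mulrA.
  apply: (@rintegrable_mulr _ _ _ _ _ _ (M + M)); first exact: E_integrable.
  - apply: measurable_funM; first exact: measurable_cos_mul.
    by apply: measurable_funM => //; exact: measurable_cos_mul.
  - move=> v; rewrite mulrCA normrM (le_trans (ler_piMr _ _))//.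
      by rewrite normrM mulr_ile1// norm_cos_le1.
    by rewrite (le_trans (f_le y))// lerDl (le_trans _ (f_le 0)).
rewrite Rintegral_fubini//; last first.
  apply: (@rintegrable_prod _ _ _ _ _ lam lam G (fun v => E e v * \int[lam]_y `|f y|) mG) => //.
    under eq_fun do rewrite mulrC; apply: rintegrableZ; exact: E_integrable.
  move=> v; rewrite -RintegralZl//; last exact: rintegrable_norm.
  apply: le_Rintegral => //; first exact: rintegrable_norm.
    by apply: rintegrableZ; exact: rintegrable_norm.
  move=> y _; rewrite /G /= !normrM -mulrA (ger0_norm (expR_ge0 _)).
  rewrite ler_wpM2l ?expR_ge0// mulrCA ler_piMr// mulr_ile1// norm_cos_le1//.
have inner y : \int[lam]_v G (v, y) =
    2^-1 * (f y * K e (2 * pi * (y - x)) + f y * K e (2 * pi * (y + x))).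
  transitivity (\int[lam]_v (2^-1 * f y * (E e v * cos (2 * pi * (y - x) * v)) +
      2^-1 * f y * (E e v * cos (2 * pi * (y + x) * v)))).
    apply: eq_Rintegral => v _; rewrite /G /=.
    have -> : 2 * pi * (y - x) * v = 2 * pi * y * v - 2 * pi * x * v by ring.
    have -> : 2 * pi * (y + x) * v = 2 * pi * y * v + 2 * pi * x * v by ring.
    by rewrite cosB cosD; field.
  rewrite RintegralD//; try apply: rintegrableZ.
  - rewrite !RintegralZl//; try by apply: Ecos_integrable => //;
      [exact: measurable_cos_mul|move=> ?; exact: norm_cos_le1].
    rewrite !integral_laplace//; rewrite /K; ring.
  - by apply: Ecos_integrable => //; [exact: measurable_cos_mul|move=> ?; exact: norm_cos_le1].
  - by apply: Ecos_integrable => //; [exact: measurable_cos_mul|move=> ?; exact: norm_cos_le1].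
have Ki z : rintegrable lam (fun y => f y * K e (2 * pi * (y + z))).
  apply: (@rintegrable_mulr _ _ _ _ _ _ (2 / e)) => //; last by move=> ?; exact: K_bound.
  have mz : measurable_fun setT (fun y : R => y + z) by exact: measurable_funD.
  exact: (measurableT_comp (measurable_K e0) mz).
under eq_Rintegral do rewrite inner.
have KiN : rintegrable lam (fun y => f y * K e (2 * pi * (y - x))) by exact: Ki.
rewrite RintegralZl//; last exact: (rintegrableD KiN (Ki x)).
rewrite RintegralD//; last exact: Ki.
rewrite [X in _ * (_ + X)](_ : _ = \int[lam]_y (f y * K e (2 * pi * (y - x)))); first lra.
have N1 : (-1 : R) != 0 by rewrite oppr_eq0 oner_neq0.
rewrite (Rintegral_affine 0 N1 (Ki x)).
rewrite normrN1 mul1r; apply: eq_Rintegral => y _.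
rewrite mulN1r addr0 f_even; congr (_ * _).
by have -> : - y + x = - (y - x) by [rewrite opprB addrC]; rewrite /K mulrN sqrrN.
Qed.

(** The substitution y = a t + x turns the kernel of width proportional to a into the fixed Cauchy
    density, so that a tends to 0 inside [f] only. *)
Let scaled (a x : R) : 0 < a ->
  \int[lam]_y (f y * K (2 * pi * a) (2 * pi * (y - x))) =
  pi^-1 * \int[lam]_t (f (a * t + x) * (1 + t ^+ 2)^-1).
Proof.
move=> a0; have p0 := pi_gt0 R.
have e0 : 0 < 2 * pi * a by rewrite !mulr_gt0.
have fK : rintegrable lam (fun y => f y * K (2 * pi * a) (2 * pi * (y - x))).
  apply: (@rintegrable_mulr _ _ _ _ _ _ (2 / (2 * pi * a))) => //.
    have mx : measurable_fun setT (fun y : R => y - x) by exact: measurable_funB.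
    exact: (measurableT_comp (measurable_K e0) mx).
  by move=> y; exact: K_bound.
rewrite (Rintegral_affine (a := a) x _ fK); last by rewrite gt_eqF.
have fc : rintegrable lam (fun t => f (a * t + x) * (1 + t ^+ 2)^-1).
  have ma : measurable_fun setT (fun t : R => a * t + x).
    by apply: measurable_funD => //; exact: measurable_funM.
  under eq_fun do rewrite mulrC.
  apply: (@rintegrable_mulr _ _ _ _ _ _ M cauchy_integrable) => //.
  exact: (measurableT_comp measurable_f ma).
have a1 : a != 0 by rewrite gt_eqF.
have fKa := rintegrable_affine x a1 fK.
rewrite -(RintegralZl _ measurableT fKa) -(RintegralZl _ measurableT fc).
apply: eq_Rintegral => t _; rewrite gtr0_norm// addrK /K.
have p1 : (pi : R) != 0 by rewrite gt_eqF.
have t1 : 1 + t ^+ 2 != 0 by rewrite gt_eqF// ltr_pwDl ?sqr_ge0.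
move: (@pi R) p1 => p p1; field; rewrite t1 p1 /=.
have -> : (2 * p * a) ^+ 2 + (2 * p * (a * t)) ^+ 2 = (2 * p * a) ^+ 2 * (1 + t ^+ 2) by ring.
by rewrite mulf_neq0// expf_neq0// !mulf_neq0.
Qed.

(** Both forms of the damped integral converge by domination, the first under the absolute value of
    [cosft f], the second under [M] times the Cauchy density; their limits must agree. *)
Lemma cosft_inversion x : \int[lam]_v (cosft f v * cos (2 * pi * x * v)) = f x.
Proof.
have p0 := pi_gt0 R.
pose a (n : nat) : R := n.+1%:R^-1.
have a_gt0 n : 0 < a n by rewrite invr_gt0.
have e_gt0 n : 0 < 2 * pi * a n by rewrite !mulr_gt0.
have a_cvg : a n @[n --> \oo] --> 0 by exact: cvg_harmonic.
have mft : measurable_fun setT (cosft f) by exact: rintegrable_meas ft_int.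
have lim1 : (\int[lam]_v (E (2 * pi * a n) v * cos (2 * pi * x * v) * cosft f v)) @[n --> \oo]
    --> \int[lam]_v (cosft f v * cos (2 * pi * x * v)).
  apply: (Rintegral_dominated_cvg _ _ (rintegrable_norm ft_int)).
  - by move=> n; apply: measurable_funM => //; apply: measurable_funM; [exact: measurable_E|exact: measurable_cos_mul].
  - by apply: measurable_funM => //; exact: measurable_cos_mul.
  - move=> n v; rewrite normrM ler_piMl// normrM mulr_ile1// ?norm_cos_le1//.
    rewrite ger0_norm ?expR_ge0// -[X in _ <= X]expR0 ler_expR mulNr oppr_le0 mulr_ge0 ?(ltW (e_gt0 n))//.
  - move=> v; rewrite [X in _ --> X]mulrC.
    apply: cvgM; last exact: cvg_cst.
    rewrite -[X in _ --> X]mul1r; apply: cvgM; last exact: cvg_cst.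
    have h : (fun n => - (2 * pi * a n) * `|v|) n @[n --> \oo] --> (0 : R).
      have -> : (0 : R) = - (2 * pi * 0) * `|v| by rewrite mulr0 oppr0 mul0r.
      apply: cvgM; last exact: cvg_cst.
      by apply: cvgN; apply: cvgM => //; exact: cvg_cst.
    rewrite -[X in _ --> X]expR0.
    exact: (cvg_comp _ _ h (@continuous_expR R 0)).
have lim2 : (pi^-1 * \int[lam]_t (f (a n * t + x) * (1 + t ^+ 2)^-1)) @[n --> \oo] --> f x.
  rewrite [X in _ --> X](_ : _ = pi^-1 * \int[lam]_t (f x * (1 + t ^+ 2)^-1)); last first.
    by rewrite RintegralZl// integral_cauchy mulrCA mulVf ?mulr1// gt_eqF.
  apply: cvgM; first exact: cvg_cst.
  apply: (Rintegral_dominated_cvg _ _ (rintegrableZ M cauchy_integrable)).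
  - move=> n; apply: measurable_funM => //.
    have ma : measurable_fun setT (fun t : R => a n * t + x).
      by apply: measurable_funD => //; exact: measurable_funM.
    exact: (measurableT_comp measurable_f ma).
  - exact: measurable_funM.
  - by move=> n t; rewrite normrM (ger0_norm (cauchy_ge0 t)) ler_wpM2r.
  - move=> t; apply: cvgM; last exact: cvg_cst.
    have h : (fun n => a n * t + x) n @[n --> \oo] --> x.
      have {2}-> : x = 0 * t + x by rewrite mul0r add0r.
      apply: cvgD; last exact: cvg_cst.
      by apply: cvgM => //; exact: cvg_cst.
    exact: (cvg_comp _ _ h (@f_cont x)).
have lim12 : (pi^-1 * \int[lam]_t (f (a n * t + x) * (1 + t ^+ 2)^-1)) @[n --> \oo]
    --> \int[lam]_v (cosft f v * cos (2 * pi * x * v)).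
  apply: cvg_trans lim1; apply: near_eq_cvg; apply: nearW => n.
  by rewrite damped// scaled.
exact: (cvg_unique _ lim12 lim2).
Qed.

End inversion.

End cosine_transform.

(** * Complex cosine transforms of products *)

Section complex_cosine.
Variable R : realType.
Notation lam := (@lebesgue_measure R).
Implicit Types f g : R -> R[i].

Definition cft f (u : R) : R[i] :=
  cintegral lam setT (fun x => f x * (cos (2 * pi * x * u))%:C).

Lemma Re_cft f u : complex.Re (cft f u) = cosft (fun x => complex.Re (f x)) u.
Proof. by apply: eq_Rintegral => x _; rewrite Re_mul /= mulr0 subr0. Qed.

Lemma Im_cft f u : complex.Im (cft f u) = cosft (fun x => complex.Im (f x)) u.
Proof. by apply: eq_Rintegral => x _; rewrite Im_mul /= mulr0 add0r. Qed.

Lemma cft_even f u : cft f (- u) = cft f u.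
Proof. by apply: eq_cintegral => x; rewrite mulrN cosN. Qed.

Let sin_odd_integral (g : R -> R) u : (forall x, g (- x) = g x) -> rintegrable lam g ->
  rintegrable lam (fun x => g x * sin (2 * pi * x * u)) /\
  \int[lam]_x (g x * sin (2 * pi * x * u)) = 0.
Proof.
move=> ge gi.
have gs : rintegrable lam (fun x => g x * sin (2 * pi * x * u)).
  apply: (@rintegrable_mulr _ _ _ _ _ _ 1) => //; last first.
    by move=> x; rewrite ler_norml sin_geN1 sin_le1.
  under eq_fun do rewrite -mulrA (mulrC _ u) mulrA.
  apply: continuous_measurable_fun => x.
  apply: (@continuous_comp _ _ _ (fun y => 2 * pi * u * y) sin); last exact: continuous_sin.
  by apply: cvgM; [exact: cvg_cst|exact: cvg_id].
split=> //.
have N1 : (-1 : R) != 0 by rewrite oppr_eq0 oner_neq0.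
set I := \int[lam]_x _.
have : I = - I; last by lra.
rewrite {1}/I (Rintegral_affine 0 N1 gs) normrN1 mul1r -[RHS]mulN1r -RintegralZl//.
apply: eq_Rintegral => x _; rewrite mulN1r addr0 ge mulrN mulNr sinN; ring.
Qed.

Lemma fourier_cft f u : even_function f -> cintegrable lam f -> fourier f u = cft f u.
Proof.
move=> fe [fr fi].
have [sr1 sr2] := sin_odd_integral u (fun x => congr1 (@complex.Re R) (fe x)) fr.
have [si1 si2] := sin_odd_integral u (fun x => congr1 (@complex.Im R) (fe x)) fi.
have cr := rintegrable_mulcos u fr; have ci := rintegrable_mulcos u fi.
apply: complex_ext; [rewrite Re_cft|rewrite Im_cft].
- transitivity (\int[lam]_x (complex.Re (f x) * cos (2 * pi * x * u) +
      complex.Im (f x) * sin (2 * pi * x * u))).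
    by apply: eq_Rintegral => x _; rewrite Re_mul /= cosN sinN mulrN opprK.
  by rewrite (RintegralD measurableT cr si1) si2 addr0.
- transitivity (\int[lam]_x (complex.Im (f x) * cos (2 * pi * x * u) -
      complex.Re (f x) * sin (2 * pi * x * u))).
    by apply: eq_Rintegral => x _; rewrite Im_mul /= cosN sinN mulrN addrC.
  by rewrite (RintegralB measurableT ci sr1) sr2 subr0.
Qed.

Lemma cft_bounded g : cintegrable lam g ->
  exists M, forall u, norm1c (cft g u) <= M.
Proof.
move=> [gr gi].
exists (\int[lam]_x `|complex.Re (g x)| + \int[lam]_x `|complex.Im (g x)|) => u.
by rewrite /norm1c Re_cft Im_cft lerD// cosft_le.
Qed.

Lemma cmeasurable_cft g : cmeasurable g -> cmeasurable (cft g).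
Proof.
move=> [mr mi]; split.
  by under eq_fun do rewrite Re_cft; exact: measurable_cosft.
by under eq_fun do rewrite Im_cft; exact: measurable_cosft.
Qed.

(** These are the properties that survive multiplication by an [invertible] function; the inversion
    formula is required of the new factor alone. *)
Record nice g : Prop := Nice {
  nice_even : even_function g;
  nice_int : cintegrable lam g;
  nice_cft_int : cintegrable lam (cft g) }.

Record invertible f : Prop := Invertible {
  invertible_nice : nice f;
  invertible_bounded : exists M, forall x, norm1c (f x) <= M;
  invertible_inv : forall x, cintegral lam setT (fun v => cft f v * (cos (2 * pi * x * v))%:C) = f x }.

Let cosC (x u : R) : R[i] := (cos (2 * pi * x * u))%:C.

Let norm_cosC x u : norm1c (cosC x u) <= 1.
Proof. by rewrite norm1c_real norm_cos_le1. Qed.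

Let cosCM (x u v : R) : cosC x u * cosC x v = 2^-1%:C * (cosC x (u - v) + cosC x (u + v)).
Proof.
rewrite /cosC -!rmorphM -rmorphD -rmorphM; congr (_%:C).
have -> : 2 * pi * x * (u - v) = 2 * pi * x * u - 2 * pi * x * v by ring.
have -> : 2 * pi * x * (u + v) = 2 * pi * x * u + 2 * pi * x * v by ring.
by rewrite cosB cosD; field.
Qed.

Let cmeasurable_cosC : cmeasurable (fun p : R * R => cosC p.1 p.2).
Proof. by apply: cmeasurable_real; exact: measurable_cosft_kernel. Qed.

Let cmeasurable_cosC1 u : cmeasurable (fun x => cosC x u).
Proof.
apply: cmeasurable_real; under eq_fun do rewrite -mulrA (mulrC _ u) mulrA.
exact: measurable_cos_mul.
Qed.

Let cintegrable_mulcosC g u : cintegrable lam g -> cintegrable lam (fun x => g x * cosC x u).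
Proof.
move=> gi; under eq_fun do rewrite mulrC.
apply: (@cintegrable_bddM _ _ _ _ _ _ 1) gi; first exact: cmeasurable_cosC1.
by move=> x; exact: norm_cosC.
Qed.

Let cintegrable_mulcosC2 g x : cintegrable lam g -> cintegrable lam (fun v => g v * cosC x v).
Proof.
move=> gi; under eq_fun do rewrite mulrC.
apply: (@cintegrable_bddM _ _ _ _ _ _ 1) gi; last by move=> v; exact: norm_cosC.
exact: (cmeasurable_real (measurable_cos_mul (2 * pi * x))).
Qed.

Section convolution.
Variables f g : R -> R[i].
Hypotheses (fI : invertible f) (gN : nice g).

Let fN := invertible_nice fI.
Let fhi := nice_cft_int fN.
Let ghi := nice_cft_int gN.
Let gi := nice_int gN.

Let cft_mul_integrable u : cintegrable lam (fun v => cft g (u + v) * cft f v).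
Proof.
have [M gM] := cft_bounded gi.
apply: (@cintegrable_bddM _ _ _ _ _ _ M) => //.
apply: (cmeasurable_comp (cintegrable_meas ghi)); exact: measurable_funD.
Qed.

(** [f] is replaced by its inversion formula and the integrals are exchanged. The product of cosines
    gives the mean of the integrals with u - v and u + v, which coincide because [cft f] is even. *)
Lemma cft_mul u : cft (fun x => f x * g x) u =
  cintegral lam setT (fun v => cft g (u + v) * cft f v).
Proof.
pose G (p : R * R) := (g p.1 * cosC p.1 u) * (cft f p.2 * cosC p.1 p.2).
have G2 x : cintegrable lam (fun v => G (x, v)).
  by rewrite /G /=; apply: cintegrableZ; exact: cintegrable_mulcosC2.
have G1 v : cintegrable lam (fun x => G (x, v)).
  rewrite /G /=; under eq_fun do rewrite mulrCA.
  apply: cintegrableZ.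
  by apply: (@cintegrable_mulcosC (fun x => g x * cosC x u)); exact: cintegrable_mulcosC.
have mG : cmeasurable G.
  apply: cmeasurableM; apply: cmeasurableM.
  - exact: (cmeasurable_comp (cintegrable_meas gi) measurable_fst).
  - exact: (cmeasurable_comp (cmeasurable_cosC1 u) measurable_fst).
  - exact: (cmeasurable_comp (cintegrable_meas fhi) measurable_snd).
  - exact: cmeasurable_cosC.
transitivity (cintegral lam setT (fun x => cintegral lam setT (fun v => G (x, v)))).
  apply: eq_cintegral => x; rewrite /G /= cintegralZ; last exact: cintegrable_mulcosC2.
  by rewrite (invertible_inv fI) mulrC mulrA mulrC mulrA.
have iG : cintegrable (lam \x lam)%E G.
  apply: (@cintegrable_prod _ _ _ _ _ lam lam G
    (fun x => norm1c (g x) * \int[lam]_v norm1c (cft f v))) => //.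
    under eq_fun do rewrite mulrC; apply: rintegrableZ; exact: cintegrable_norm1c.
  move=> x; rewrite -RintegralZl//; last exact: cintegrable_norm1c.
  apply: le_Rintegral => //.
  - exact: (cintegrable_norm1c (G2 x)).
  - by apply: rintegrableZ; exact: cintegrable_norm1c.
  move=> v _; rewrite /G /=.
  apply: (le_trans (norm1cM _ _)); apply: ler_pM; rewrite ?norm1c_ge0//.
    by apply: (le_trans (norm1cM _ _)); rewrite ler_piMr ?norm1c_ge0.
  by apply: (le_trans (norm1cM _ _)); rewrite ler_piMr ?norm1c_ge0.
rewrite cintegral_fubini//.
transitivity (cintegral lam setT (fun v => 2^-1%:C * (cft g (u - v) * cft f v + cft g (u + v) * cft f v))).
  apply: eq_cintegral => v; rewrite /G /=.
  transitivity (cintegral lam setT (fun x => 2^-1%:C * cft f v *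
      (g x * cosC x (u - v) + g x * cosC x (u + v)))).
    by apply: eq_cintegral => x; rewrite mulrACA cosCM; ring.
  rewrite cintegralZ; last by apply: cintegrableD; exact: cintegrable_mulcosC.
  rewrite cintegralD; try exact: cintegrable_mulcosC.
  by rewrite -/(cft g (u - v)) -/(cft g (u + v)); ring.
have i1 : cintegrable lam (fun v => cft g (u - v) * cft f v).
  have := cintegrable_opp (cft_mul_integrable u).
  by under eq_fun do rewrite cft_even.
rewrite cintegralZ; last exact: cintegrableD.
rewrite cintegralD//.
have -> : cintegral lam setT (fun v => cft g (u - v) * cft f v) =
    cintegral lam setT (fun v => cft g (u + v) * cft f v).
  rewrite -(cintegral_opp (cft_mul_integrable u)).
  by apply: eq_cintegral => v; rewrite cft_even.
have h : (2^-1 : R)%:C + (2^-1 : R)%:C = 1 by rewrite -rmorphD -[RHS](rmorph1 (real_complex R)); congr (_%:C); field.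
by rewrite mulrDr -mulrDl h mul1r.
Qed.

(** In this weak form a new factor merely shifts the argument of the test function. Bounded
    measurable test functions are needed since the kernels are built from indicators; [phi] = 1
    gives the integrability in [nice_mul]. *)
Lemma cintegral_cft_mul (phi : R -> R[i]) (M : R) : cmeasurable phi ->
  (forall u, norm1c (phi u) <= M) ->
  cintegrable lam (fun u => phi u * cft (fun x => f x * g x) u) /\
  cintegral lam setT (fun u => phi u * cft (fun x => f x * g x) u) =
  cintegral lam setT (fun v => cft f v *
    cintegral lam setT (fun u => phi (u + v) * cft g u)).
Proof.
move=> mphi phiM.
have M0 : 0 <= M by exact: le_trans (norm1c_ge0 _) (phiM 0).
pose G (p : R * R) := cft f p.1 * (phi p.2 * cft g (p.2 - p.1)).
have [C gC] := cft_bounded gi.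
have mgB v : measurable_fun setT (fun u : R => u - v) by exact: measurable_funB.
have ghv v : cintegrable lam (fun u => cft g (u - v)) by exact: cintegrable_shift.
have phig v : cintegrable lam (fun u => phi u * cft g (u - v)).
  by apply: (@cintegrable_bddM _ _ _ _ _ _ M).
have G2 v : cintegrable lam (fun u => G (v, u)) by exact: (cintegrableZ (cft f v) (phig v)).
have G1 u : cintegrable lam (fun v => G (v, u)).
  rewrite /G /=; under eq_fun do rewrite mulrCA.
  apply: cintegrableZ; have := cintegrable_opp (cft_mul_integrable u).
  by under eq_fun do rewrite cft_even mulrC.
have mG : cmeasurable G.
  apply: cmeasurableM; last apply: cmeasurableM.
  - exact: (cmeasurable_comp (cintegrable_meas fhi) measurable_fst).
  - exact: (cmeasurable_comp mphi measurable_snd).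
  - apply: (cmeasurable_comp (cintegrable_meas ghi) (h := fun p : R * R => p.2 - p.1)).
    by apply: measurable_funB; [exact: measurable_snd|exact: measurable_fst].
have iG : cintegrable (lam \x lam)%E G.
  apply: (@cintegrable_prod _ _ _ _ _ lam lam G
    (fun v => norm1c (cft f v) * (M * \int[lam]_u norm1c (cft g u)))) => //.
    by under eq_fun do rewrite mulrC; apply: rintegrableZ; exact: cintegrable_norm1c.
  move=> v; have ign := cintegrable_norm1c (ghv v).
  have -> : \int[lam]_u norm1c (cft g u) = \int[lam]_u norm1c (cft g (u - v)).
    rewrite (Rintegral_affine (- v) (oner_neq0 _) (cintegrable_norm1c ghi)) normr1 mul1r.
    by apply: eq_Rintegral => u _; rewrite mul1r.
  rewrite -RintegralZl// -RintegralZl//; last exact: rintegrableZ.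
  apply: le_Rintegral => //.
  - exact: (cintegrable_norm1c (G2 v)).
  - by apply: rintegrableZ; exact: rintegrableZ.
  move=> u _; rewrite /G /=.
  apply: (le_trans (norm1cM _ _)); rewrite ler_wpM2l ?norm1c_ge0//.
  by apply: (le_trans (norm1cM _ _)); rewrite ler_wpM2r ?norm1c_ge0.
(* This is [cft_mul] after the substitution of - v for v. *)
have e1 u : cintegral lam setT (fun v => G (v, u)) = phi u * cft (fun x => f x * g x) u.
  rewrite cft_mul -(cintegralZ (phi u) (cft_mul_integrable u)).
  rewrite -[RHS]cintegral_opp; last by apply: cintegrableZ; exact: cft_mul_integrable.
  by apply: eq_cintegral => v; rewrite /G /= cft_even; ring.
split.
  have := cintegrable_fubini (cintegrable_prod_swap iG) G1.
  by under eq_fun do rewrite e1.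
transitivity (cintegral lam setT (fun u => cintegral lam setT (fun v => G (v, u)))).
  by apply: eq_cintegral => u; rewrite e1.
rewrite -(cintegral_fubini iG)//; apply: eq_cintegral => v.
transitivity (cft f v * cintegral lam setT (fun u => phi u * cft g (u - v))).
  exact: (cintegralZ (cft f v) (phig v)).
rewrite -(cintegral_shift v (phig v)).
by under eq_cintegral do rewrite addrK.
Qed.

Lemma nice_mul : nice (fun x => f x * g x).
Proof.
have [M fM] := invertible_bounded fI.
split.
- by move=> x; rewrite (nice_even fN) (nice_even gN).
- apply: (@cintegrable_bddM _ _ _ _ _ _ M) => //.
  exact: cintegrable_meas (nice_int fN).
- have [] := @cintegral_cft_mul (fun=> 1) 1.
  + exact: cmeasurable_cst.
  + by move=> u; rewrite /norm1c /= normr1 normr0 addr0.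
  by under eq_fun do rewrite mul1r.
Qed.

End convolution.
End complex_cosine.

Section schwartz_invertible.
Variable R : realType.
Notation lam := (@lebesgue_measure R).

Let real_schwartz_continuous (g : R -> R) : real_schwartz g -> continuous g.
Proof.
by move=> [dg _] x; apply/differentiable_continuous/derivable1_diffP; exact: (dg 0%N x).
Qed.

Let real_schwartz_bounded (g : R -> R) : real_schwartz g -> exists M, forall x, `|g x| <= M.
Proof.
move=> [_ /(_ 0%N 0%N)[M gM]]; exists M => x.
by have := gM x; rewrite expr0 mul1r.
Qed.

Let real_schwartz_integrable (g : R -> R) : real_schwartz g -> rintegrable lam g.
Proof.
move=> sg; have [M gM] := real_schwartz_bounded sg.
have [_ /(_ 2%N 0%N)[M2 gM2]] := sg.
apply: (rintegrable_schwartz _ gM gM2).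
by apply: continuous_measurable_fun; exact: real_schwartz_continuous.
Qed.

(** The transform is bounded with compact support, hence integrable; no estimate of its decay
    enters. *)
Lemma schwartz_invertible (f : R -> R[i]) (s : R) : schwartz f -> even_function f ->
  supp (fourier f) `<=` `[- s, s]%classic -> invertible f.
Proof.
move=> [fr fi] fe fs.
have ir := real_schwartz_integrable fr; have ii := real_schwartz_integrable fi.
have ic : cintegrable lam f by split.
have [M fM] := cft_bounded ic.
have cfti : cintegrable lam (cft f).
  apply: (@cintegrable_dom _ _ _ lam (cft f) (fun u => M * \1_(`[- s, s]%classic : set R) u)).
  - exact: cmeasurable_cft (cintegrable_meas ic).
  - by apply: rintegrableZ; exact: integrable_indic_itv.
  - move=> u; rewrite indicE; case: (boolP (u \in _)) => us; first by rewrite mulr1.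
    suff -> : cft f u = 0 by rewrite /norm1c /= normr0 addr0 mulr0.
    apply/eqP; apply: contraNT us => u0; rewrite inE; apply: fs.
    by apply: subset_closure; rewrite /= fourier_cft.
have [Mr frM] := real_schwartz_bounded fr; have [Mi fiM] := real_schwartz_bounded fi.
split=> //.
- by exists (Mr + Mi) => x; exact: lerD.
- have [cr ci] := cfti.
  move=> x; apply: complex_ext.
    rewrite -[RHS](@cosft_inversion R (fun y => complex.Re (f y)) Mr)//.
    + by apply: eq_Rintegral => v _; rewrite Re_mul Re_cft /= mulr0 subr0.
    + by move=> y; rewrite fe.
    + exact: real_schwartz_continuous fr.
    + by move: cr; under eq_fun do rewrite Re_cft.
  rewrite -[RHS](@cosft_inversion R (fun y => complex.Im (f y)) Mi)//.
  + by apply: eq_Rintegral => v _; rewrite Im_mul Im_cft /= mulr0 add0r.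
  + by move=> y; rewrite fe.
  + exact: real_schwartz_continuous fi.
  + by move: ci; under eq_fun do rewrite Im_cft.
Qed.

End schwartz_invertible.

(** * Iterated integrals against densities in each coordinate *)

Section iterated.
Variable R : realType.
Notation lam := (@lebesgue_measure R).
Notation density := (option (R -> R[i])).

(* None stands for the Dirac mass at 0, the Fourier transform of an empty product *)
Definition opt_int (o : density) (phi : R -> R[i]) : R[i] :=
  if o is Some h then cintegral lam setT (fun u => phi u * h u) else phi 0.

(** Iterated rather than multiple, so that the density of one coordinate can be changed while the
    other coordinates stay fixed. *)
Fixpoint iter_int k : ('I_k -> density) -> (k.-tuple R -> R[i]) -> R[i] :=
  if k is k'.+1 then fun o K =>
    opt_int (o ord0) (fun t => iter_int (fun i => o (lift ord0 i)) (fun v => K (tcons (t, v))))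
  else fun _ K => K [tuple].

Definition opt_integrable (o : density) := if o is Some h then cintegrable lam h else True.

Let opt_norm (o : density) : R := if o is Some h then \int[lam]_u norm1c (h u) else 1.

Lemma opt_int_param d (T : measurableType d) (o : density) (Phi : T * R -> R[i]) (M : R) :
  opt_integrable o -> cmeasurable Phi -> (forall p, norm1c (Phi p) <= M) ->
  cmeasurable (fun p => opt_int o (fun t => Phi (p, t))) /\
  forall p, norm1c (opt_int o (fun t => Phi (p, t))) <= M * opt_norm o.
Proof.
move=> io mPhi PhiM.
have mPhi2 p : cmeasurable (fun t => Phi (p, t)).
  exact: (cmeasurable_comp mPhi (pair1_measurable p)).
case: o io => [h ih|_] /=; last first.
  split; last by move=> p; rewrite mulr1.
  exact: (cmeasurable_comp mPhi (pair2_measurable (0 : R))).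
split.
  apply: (@cmeasurable_param _ _ _ _ _ lam (fun q : T * R => Phi q * h q.2)).
  apply: cmeasurableM => //.
  exact: (cmeasurable_comp (cintegrable_meas ih) measurable_snd).
move=> p.
have i1 := @cintegrable_bddM _ _ _ lam _ _ M (mPhi2 p) (fun t => PhiM (p, t)) ih.
apply: (le_trans (norm1c_cintegral i1)).
rewrite -RintegralZl//; last exact: cintegrable_norm1c.
apply: le_Rintegral => //; first exact: cintegrable_norm1c.
  by apply: rintegrableZ; exact: cintegrable_norm1c.
by move=> t _; apply: (le_trans (norm1cM _ _)); rewrite ler_wpM2r ?norm1c_ge0.
Qed.

(** The parameter space is general because each variable integrated later joins it in the
    induction. *)
Lemma iter_int_param k d (T : measurableType d) (o : 'I_k -> density)
    (K : T * k.-tuple R -> R[i]) (M : R) :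
  (forall i, opt_integrable (o i)) -> cmeasurable K -> (forall p, norm1c (K p) <= M) ->
  exists M', cmeasurable (fun p => iter_int o (fun v => K (p, v))) /\
    forall p, norm1c (iter_int o (fun v => K (p, v))) <= M'.
Proof.
elim: k d T o K M => [|k IH] d T o K M io mK KM /=.
  exists M; split => //.
  exact: (cmeasurable_comp mK (pair2_measurable [tuple])).
have mc : measurable_fun setT (fun q : (T * R) * k.-tuple R => (q.1.1, tcons (q.1.2, q.2))).
  apply: measurable_fun_pair.
    exact: (measurableT_comp measurable_fst measurable_fst).
  apply: (measurableT_comp (@measurable_tcons R k)).
  apply: measurable_fun_pair; last exact: measurable_snd.
  exact: (measurableT_comp measurable_snd measurable_fst).
have [M1 [m1 h1]] := IH _ (T * R)%type (fun i => o (lift ord0 i))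
  (fun q => K (q.1.1, tcons (q.1.2, q.2))) M (fun i => io _) (cmeasurable_comp mK mc) (fun q => KM _).
have [m2 h2] := opt_int_param (io ord0) m1 h1.
by exists (M1 * opt_norm (o ord0)).
Qed.

Lemma opt_int_swap (o : density) (h : R -> R[i]) (Phi : R * R -> R[i]) (M : R) :
  opt_integrable o -> cintegrable lam h -> cmeasurable Phi -> (forall p, norm1c (Phi p) <= M) ->
  opt_int o (fun s => cintegral lam setT (fun t => Phi (s, t) * h t)) =
  cintegral lam setT (fun t => opt_int o (fun s => Phi (s, t)) * h t).
Proof.
move=> io ih mPhi PhiM; case: o io => [g ig|//] /=.
have M0 : 0 <= M by exact: le_trans (norm1c_ge0 _) (PhiM (0, 0)).
pose G (p : R * R) := Phi p * (g p.1 * h p.2).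
have mP1 s : cmeasurable (fun t => Phi (s, t)) by exact: (cmeasurable_comp mPhi (pair1_measurable s)).
have mP2 t : cmeasurable (fun s => Phi (s, t)) by exact: (cmeasurable_comp mPhi (pair2_measurable t)).
have P1 s := @cintegrable_bddM _ _ _ lam _ _ M (mP1 s) (fun t => PhiM (s, t)) ih.
have P2 t := @cintegrable_bddM _ _ _ lam _ _ M (mP2 t) (fun s => PhiM (s, t)) ig.
have G1 s : cintegrable lam (fun t => G (s, t)).
  have := cintegrableZ (g s) (P1 s); congr cintegrable.
  by apply/funext => t; rewrite /G /=; ring.
have G2 t : cintegrable lam (fun s => G (s, t)).
  have := cintegrableZ (h t) (P2 t); congr cintegrable.
  by apply/funext => s; rewrite /G /=; ring.
have mG : cmeasurable G.
  apply: cmeasurableM => //; apply: cmeasurableM.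
    exact: (cmeasurable_comp (cintegrable_meas ig) measurable_fst).
  exact: (cmeasurable_comp (cintegrable_meas ih) measurable_snd).
have iG : cintegrable (lam \x lam)%E G.
  apply: (@cintegrable_prod _ _ _ _ _ lam lam G
    (fun s => norm1c (g s) * (M * \int[lam]_t norm1c (h t)))) => //.
    by under eq_fun do rewrite mulrC; apply: rintegrableZ; exact: cintegrable_norm1c.
  move=> s; have ihn := cintegrable_norm1c ih; have iMn := rintegrableZ M ihn.
  rewrite -(RintegralZl _ measurableT ihn) -(RintegralZl _ measurableT iMn).
  apply: le_Rintegral => //.
  - exact: (cintegrable_norm1c (G1 s)).
  - by apply: rintegrableZ.
  move=> t _; rewrite /G /= [leRHS]mulrCA.
  apply: (le_trans (norm1cM _ _)); apply: ler_pM; rewrite ?norm1c_ge0//.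
  exact: norm1cM.
transitivity (cintegral lam setT (fun s => cintegral lam setT (fun t => G (s, t)))).
  apply: eq_cintegral => s; rewrite mulrC -(cintegralZ (g s) (P1 s)).
  by apply: eq_cintegral => t; rewrite /G /=; ring.
rewrite (cintegral_fubini iG G1 G2); apply: eq_cintegral => t.
rewrite mulrC -(cintegralZ (h t) (P2 t)).
by apply: eq_cintegral => s; rewrite /G /=; ring.
Qed.

End iterated.

Section iterated_lebesgue.
Variable R : realType.
Notation lam := (@lebesgue_measure R).
Notation leb k := (@lebesgue_tuple R k).

Let measurable_tcons_lam k :
  measurable_fun (setT : set (measurableTypeR R * k.-tuple R)) (@tcons R k).
Proof. exact: measurable_tcons. Qed.

Lemma cintegrable_lebesgue_tupleS k (F : k.+1.-tuple R -> R[i]) :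
  cmeasurable F -> cintegrable (lam \x leb k)%E (fun p => F (tcons p)) ->
  cintegrable (leb k.+1) F.
Proof.
move=> [mr mi] [ir ii]; split.
  exact: (@integrable_pushforward _ _ _ _ R _ (@measurable_tcons_lam k)
    (lam \x leb k)%E setT _ (iffRL (measurable_EFinP _ _) mr) ir measurableT).
exact: (@integrable_pushforward _ _ _ _ R _ (@measurable_tcons_lam k)
  (lam \x leb k)%E setT _ (iffRL (measurable_EFinP _ _) mi) ii measurableT).
Qed.

Lemma cintegral_lebesgue_tupleS k (F : k.+1.-tuple R -> R[i]) :
  cmeasurable F -> cintegrable (lam \x leb k)%E (fun p => F (tcons p)) ->
  cintegral (leb k.+1) setT F = cintegral (lam \x leb k)%E setT (fun p => F (tcons p)).
Proof.
move=> [mr mi] [ir ii]; apply: complex_ext; congr fine.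
  exact: (@integral_pushforward _ _ _ _ R _ (@measurable_tcons_lam k)
    (lam \x leb k)%E setT _ (iffRL (measurable_EFinP _ _) mr) ir measurableT).
exact: (@integral_pushforward _ _ _ _ R _ (@measurable_tcons_lam k)
  (lam \x leb k)%E setT _ (iffRL (measurable_EFinP _ _) mi) ii measurableT).
Qed.

Lemma cintegral_lebesgue_tuple0 (F : 0.-tuple R -> R[i]) :
  cintegrable (leb 0) F /\ cintegral (leb 0) setT F = F [tuple].
Proof.
have mF (g : 0.-tuple R -> R) : measurable_fun setT g.
  by rewrite (_ : g = cst (g [tuple])) //; apply/funext => t; rewrite /cst (tuple0 t).
have gi (g : 0.-tuple R -> R) : rintegrable (leb 0) g.
  apply/integrableP; split; first exact/measurable_EFinP.
  by rewrite integral_dirac// ?diracT ?mul1e ?ltry//; apply: measurableT_comp => //; exact/measurable_EFinP.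
have gE (g : 0.-tuple R -> R) : \int[leb 0]_x g x = g [tuple].
  by rewrite /Rintegral integral_dirac// ?diracT ?mul1e//; exact/measurable_EFinP.
by split; [split; exact: gi|apply: complex_ext; exact: gE].
Qed.

Lemma cintegral_lebesgue_tuple k (h : 'I_k -> R -> R[i]) (K : k.-tuple R -> R[i]) (M : R) :
  (forall i, cintegrable lam (h i)) -> cmeasurable K -> (forall v, norm1c (K v) <= M) ->
  cintegrable (leb k) (fun v => K v * \prod_(i < k) h i (tnth v i)) /\
  cintegral (leb k) setT (fun v => K v * \prod_(i < k) h i (tnth v i)) =
  iter_int (fun i => Some (h i)) K.
Proof.
elim: k h K M => [|k IH] h K M ih mK KM.
  have [i0 e0] := cintegral_lebesgue_tuple0 (fun v => K v * \prod_(i < 0) h i (tnth v i)).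
  by split=> //; rewrite e0 big_ord0 mulr1.
pose h' i := h (lift ord0 i).
have mP n (g : 'I_n -> R -> R[i]) : (forall i, cintegrable lam (g i)) ->
    cmeasurable (fun v : n.-tuple R => \prod_(i < n) g i (tnth v i)).
  move=> ig; apply: cmeasurable_prod => i.
  exact: (cmeasurable_comp (cintegrable_meas (ig i)) (measurable_tnth i)).
have mKt t : cmeasurable (fun v => K (tcons (t, v))).
  by apply: (cmeasurable_comp mK); exact: (measurableT_comp (@measurable_tcons R k) (pair1_measurable t)).
have IHt t := IH h' (fun v => K (tcons (t, v))) M (fun i => ih _) (mKt t) (fun v => KM _).
have M0 : 0 <= M by exact: le_trans (norm1c_ge0 _) (KM (nseq_tuple k.+1 0)).
(* The kernel 1 supplies the integrability of the product of the remaining densities, which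
   dominates the sections. *)
have [] := IH h' (fun=> 1) 1 (fun i => ih _) (cmeasurable_cst _ _).
  by move=> _; rewrite /norm1c /= normr1 normr0 addr0.
under eq_fun do rewrite mul1r.
move=> iP _.
set F := fun v => _.
have mF : cmeasurable F by apply: cmeasurableM => //; exact: mP.
have FE p : F (tcons p) = h ord0 p.1 * (K (tcons (p.1, p.2)) * \prod_(i < k) h' i (tnth p.2 i)).
  case: p => t v; rewrite /F big_ord_recl /= mulrCA; congr (_ * (_ * _)).
  by apply: eq_bigr => i _; rewrite tnthS.
have i2 t : cintegrable (leb k) (fun v => F (tcons (t, v))).
  under eq_fun do rewrite FE /=.
  by apply: cintegrableZ; have [] := IHt t.
have iF : cintegrable (lam \x leb k)%E (fun p => F (tcons p)).
  apply: (@cintegrable_prod _ _ _ _ _ lam (leb k) (fun p => F (tcons p))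
    (fun t => norm1c (h ord0 t) * (M * \int[leb k]_v norm1c (\prod_(i < k) h' i (tnth v i))))) => //.
  - exact: (cmeasurable_comp mF (@measurable_tcons R k)).
  - under eq_fun do rewrite mulrC; apply: rintegrableZ; exact: cintegrable_norm1c.
  - move=> t; have iPn := cintegrable_norm1c iP; have iMn := rintegrableZ M iPn.
    rewrite -(RintegralZl _ measurableT iPn) -(RintegralZl _ measurableT iMn).
    apply: le_Rintegral => //.
    + exact: (cintegrable_norm1c (i2 t)).
    + exact: rintegrableZ.
    + move=> v _; rewrite FE.
      apply: (le_trans (norm1cM _ _)); rewrite ler_wpM2l ?norm1c_ge0//.
      by apply: (le_trans (norm1cM _ _)); rewrite ler_wpM2r ?norm1c_ge0.
split; first exact: cintegrable_lebesgue_tupleS.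
rewrite cintegral_lebesgue_tupleS// cintegral_prod//=.
apply: eq_cintegral => t.
have [i3 <-] := IHt t; rewrite mulrC -(cintegralZ (h ord0 t) i3).
by apply: eq_cintegral => v; rewrite FE.
Qed.

End iterated_lebesgue.

(** * From block variables to block sums of single variables *)

Section add_factor.
Variable R : realType.
Notation lam := (@lebesgue_measure R).
Notation density := (option (R -> R[i])).

Definition opt_nice (o : density) := if o is Some g then nice g else True.

Definition opt_mul (f : R -> R[i]) (o : density) : density :=
  Some (if o is Some g then (fun x => f x * g x) else f).

Definition opt_cft (o : density) : density := omap (@cft R) o.

Lemma opt_nice_mul f o : invertible f -> opt_nice o -> opt_nice (opt_mul f o).
Proof. by case: o => [g|] fI /= gN; [exact: nice_mul|exact: invertible_nice]. Qed.

Lemma opt_nice_integrable o : opt_nice o -> opt_integrable (opt_cft o).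
Proof. by case: o => [g|] //= /nice_cft_int. Qed.

Lemma opt_int_mul f o (phi : R -> R[i]) (M : R) : invertible f -> opt_nice o ->
  cmeasurable phi -> (forall u, norm1c (phi u) <= M) ->
  opt_int (opt_cft (opt_mul f o)) phi =
  cintegral lam setT (fun t => opt_int (opt_cft o) (fun u => phi (u + t)) * cft f t).
Proof.
case: o => [g|] fI /= gN mphi phiM; last by apply: eq_cintegral => t; rewrite add0r.
have [_ ->] := cintegral_cft_mul fI gN mphi phiM.
by apply: eq_cintegral => t; rewrite mulrC.
Qed.

Definition tshift k (l : 'I_k) (t : R) (v : k.-tuple R) : k.-tuple R :=
  [tuple tnth v i + (if i == l then t else 0) | i < k].

Lemma tshift0 k t s (v : k.-tuple R) : tshift ord0 t (tcons (s, v)) = tcons (s + t, v).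
Proof.
apply: eq_from_tnth => i; rewrite tnth_mktuple.
by have [j ->|->] := unliftP ord0 i; rewrite ?tnthS /= ?tnth0 ?addr0.
Qed.

Lemma tshift_lift k (l : 'I_k) t s (v : k.-tuple R) :
  tshift (lift ord0 l) t (tcons (s, v)) = tcons (s, tshift l t v).
Proof.
apply: eq_from_tnth => i; rewrite tnth_mktuple.
have [j ->|->] := unliftP ord0 i; rewrite ?tnthS /= ?tnth0 ?addr0//.
by rewrite tnth_mktuple (inj_eq lift_inj).
Qed.

Lemma measurable_tshift k (l : 'I_k) :
  measurable_fun setT (fun p : R * k.-tuple R => tshift l p.1 p.2).
Proof.
apply/measurable_fun_tnthP => i; rewrite /comp.
under eq_fun do rewrite tnth_mktuple.
apply: measurable_funD; first exact: (measurableT_comp (measurable_tnth i) measurable_snd).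
by case: (i == l) => //; exact: measurable_fst.
Qed.

(** At the coordinate [l] this is the weak convolution formula; the new integral over t is then
    moved outwards past the preceding coordinates by [opt_int_swap]. *)
Lemma iter_int_mul k (l : 'I_k) f (o : 'I_k -> density) (K : k.-tuple R -> R[i]) (M : R) :
  invertible f -> (forall i, opt_nice (o i)) -> cmeasurable K -> (forall v, norm1c (K v) <= M) ->
  iter_int (fun i => opt_cft (if i == l then opt_mul f (o i) else o i)) K =
  cintegral lam setT (fun t => iter_int (fun i => opt_cft (o i)) (fun v => K (tshift l t v)) * cft f t).
Proof.
move=> fI; elim: k l o K M => [|k IH] l o K M oN mK KM; first by case: l.
have [l' ->|->] := unliftP ord0 l => /=.
  have fci := nice_cft_int (invertible_nice fI).
  have oI i : opt_integrable (opt_cft (o (lift ord0 i))) by exact: opt_nice_integrable.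
  have mL : measurable_fun setT (fun q : (R * R) * k.-tuple R => tcons (q.1.1, tshift l' q.1.2 q.2)).
    apply: (measurableT_comp (@measurable_tcons R k)); apply: measurable_fun_pair.
      exact: (measurableT_comp measurable_fst measurable_fst).
    apply: (measurableT_comp (measurable_tshift l') (g := fun q : (R * R) * k.-tuple R => (q.1.2, q.2))).
    apply: measurable_fun_pair; last exact: measurable_snd.
    exact: (measurableT_comp measurable_snd measurable_fst).
  have [M' [mP PM]] := iter_int_param oI (cmeasurable_comp mK mL) (fun q => KM _).
  transitivity (opt_int (opt_cft (o ord0)) (fun s => cintegral lam setT (fun t =>
      iter_int (fun i => opt_cft (o (lift ord0 i)))
        (fun v => K (tcons (s, tshift l' t v))) * cft f t))).
    congr opt_int; apply/funext => s.
    have mKs : cmeasurable (fun v => K (tcons (s, v))).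
      by apply: (cmeasurable_comp mK); exact: (measurableT_comp (@measurable_tcons R k) (pair1_measurable s)).
    have <- := IH l' (fun i => o (lift ord0 i)) _ M (fun i => oN _) mKs (fun v => KM _).
    by congr iter_int; apply/funext => i; rewrite (inj_eq lift_inj).
  rewrite (opt_int_swap (opt_nice_integrable (oN ord0)) fci mP PM).
  apply: eq_cintegral => t; congr (_ * _); congr opt_int; apply/funext => s; congr iter_int.
  by apply/funext => v; rewrite tshift_lift.
pose phi s := iter_int (fun i => opt_cft (o (lift ord0 i))) (fun v => K (tcons (s, v))).
have oI i : opt_integrable (opt_cft (o (lift ord0 i))) by exact: opt_nice_integrable.
have [M' [mphi phiM]] := iter_int_param oI (cmeasurable_comp mK (@measurable_tcons R k)) (fun q => KM _).
apply: etrans (opt_int_mul fI (oN ord0) mphi phiM) _; apply: eq_cintegral => t.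
congr (_ * _); congr opt_int.
by apply/funext => s; congr iter_int; apply/funext => v; rewrite tshift0.
Qed.

(** A colouring, unlike a partition, may have empty classes, so an induction can remove indices one
    at a time while the number of coordinates stays [k]. *)
Definition colour_class n k (c : 'I_n -> 'I_k) (f : 'I_n -> R -> R[i]) (l : 'I_k) : density :=
  if [exists i, c i == l] then Some (fun x => \prod_(i | c i == l) f i x) else None.

Definition colour_sum n k (c : 'I_n -> 'I_k) (v : n.-tuple R) : k.-tuple R :=
  [tuple \sum_(i | c i == l) tnth v i | l < k].

Lemma colour_class_recl n k (c : 'I_n.+1 -> 'I_k) f l : colour_class c f l =
  if l == c ord0 then opt_mul (f ord0) (colour_class (fun i => c (lift ord0 i)) (fun i => f (lift ord0 i)) l)
  else colour_class (fun i => c (lift ord0 i)) (fun i => f (lift ord0 i)) l.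
Proof.
rewrite /colour_class.
have -> : [exists i, c i == l] = (l == c ord0) || [exists i, c (lift ord0 i) == l].
  apply/existsP/orP => [[i +]|[/eqP -> | /existsP[i ci]]].
  - have [j ->|->] := unliftP ord0 i; last by rewrite eq_sym; left.
    by move=> cj; right; apply/existsP; exists j.
  - by exists ord0.
  - by exists (lift ord0 i).
case: eqVneq => [lc|lc] /=; last first.
  case: existsP => // _; congr Some; apply/funext => x.
  by rewrite big_mkcond big_ord_recl /= eq_sym (negbTE lc) mul1r -big_mkcond.
congr Some; apply/funext => x; rewrite big_mkcond big_ord_recl /= -lc eqxx -big_mkcond /=.
case: ifPn => // /existsPn h; rewrite big1 ?mulr1// => i ci.
by have := h i; rewrite ci.
Qed.

Lemma colour_class0 k (c : 'I_0 -> 'I_k) f l : colour_class c f l = None.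
Proof. by rewrite /colour_class; case: existsP => [[i _]|//]; case: i. Qed.

Lemma colour_class_nice n k (c : 'I_n -> 'I_k) f l :
  (forall i, invertible (f i)) -> opt_nice (colour_class c f l).
Proof.
elim: n c f => [|n IH] c f fI; first by rewrite colour_class0.
rewrite colour_class_recl; have h := IH (fun i => c (lift ord0 i)) (fun i => f (lift ord0 i)) (fun i => fI _).
by case: ifP => // _; exact: opt_nice_mul.
Qed.

Lemma iter_int_none k (K : k.-tuple R -> R[i]) :
  iter_int (fun=> None) K = K [tuple 0 | _ < k].
Proof.
elim: k K => [|k IH] K /=; first by congr K; apply: eq_from_tnth => -[].
rewrite IH; congr K; apply: eq_from_tnth => i; rewrite tnth_mktuple.
by have [j ->|->] := unliftP ord0 i; rewrite ?tnthS ?tnth_mktuple.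
Qed.

(** With no index left every class is the Dirac mass at 0; each index put back adds its own variable
    to the coordinate of its colour. *)
Lemma iter_int_colour n k (c : 'I_n -> 'I_k) f (K : k.-tuple R -> R[i]) (M : R) :
  (forall i, invertible (f i)) -> cmeasurable K -> (forall v, norm1c (K v) <= M) ->
  iter_int (fun l => opt_cft (colour_class c f l)) K =
  iter_int (fun i => Some (cft (f i))) (fun v => K (colour_sum c v)).
Proof.
elim: n c f K M => [|n IH] c f K M fI mK KM.
  rewrite (_ : (fun l => _) = (fun=> None)); last first.
    by apply/funext => l; rewrite colour_class0.
  rewrite iter_int_none /=; congr K; apply: eq_from_tnth => l.
  by rewrite !tnth_mktuple big_ord0.
pose c' i := c (lift ord0 i); pose f' i := f (lift ord0 i).
have f'I i : invertible (f' i) by exact: fI.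
have cN l : opt_nice (colour_class c' f' l) by exact: colour_class_nice.
under eq_fun do rewrite colour_class_recl.
rewrite (iter_int_mul _ (fI ord0) cN mK KM) /=.
apply: eq_cintegral => t; congr (_ * _).
have mKt : cmeasurable (fun v => K (tshift (c ord0) t v)).
  by apply: (cmeasurable_comp mK); exact: (measurableT_comp (measurable_tshift (c ord0)) (pair1_measurable t)).
rewrite (IH c' f' _ M)//; congr iter_int; apply/funext => v; congr K.
apply: eq_from_tnth => l; rewrite !tnth_mktuple [RHS]big_mkcond big_ord_recl /= tnth0.
rewrite addrC eq_sym; congr (_ + _); rewrite big_mkcond; apply: eq_bigr => i _.
by rewrite tnthS.
Qed.

End add_factor.

Section bounded_measurable.
Context d (T : measurableType d) (R : realType).

Definition bmeas (K : T -> R) := measurable_fun setT K /\ exists M, forall x, `|K x| <= M.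

Lemma bmeas_cst (c : R) : bmeas (fun=> c).
Proof. by split; [exact: measurable_cst|exists `|c|]. Qed.

Lemma bmeasD K L : bmeas K -> bmeas L -> bmeas (fun x => K x + L x).
Proof.
move=> [mK [M KM]] [mL [N LN]]; split; first exact: measurable_funD.
by exists (M + N) => x; rewrite (le_trans (ler_normD _ _))// lerD.
Qed.

Lemma bmeasM K L : bmeas K -> bmeas L -> bmeas (fun x => K x * L x).
Proof.
move=> [mK [M KM]] [mL [N LN]]; split; first exact: measurable_funM.
by exists (M * N) => x; rewrite normrM ler_pM.
Qed.

Lemma bmeas_sum I (r : seq I) (P : pred I) (F : I -> T -> R) :
  (forall i, bmeas (F i)) -> bmeas (fun x => \sum_(i <- r | P i) F i x).
Proof.
move=> bF; elim: r => [|i r IH].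
  by under eq_fun do rewrite big_nil; exact: bmeas_cst.
under eq_fun do rewrite big_cons.
by case: (P i) => //; exact: bmeasD.
Qed.

Lemma bmeas_prod I (r : seq I) (P : pred I) (F : I -> T -> R) :
  (forall i, bmeas (F i)) -> bmeas (fun x => \prod_(i <- r | P i) F i x).
Proof.
move=> bF; elim: r => [|i r IH].
  by under eq_fun do rewrite big_nil; exact: bmeas_cst.
under eq_fun do rewrite big_cons.
by case: (P i) => //; exact: bmeasM.
Qed.

Lemma bmeas_cmeasurable (K : T -> R) : bmeas K ->
  cmeasurable (fun x => (K x)%:C) /\ exists M, forall x, norm1c (K x)%:C <= M.
Proof.
move=> [mK [M KM]]; split; first exact: cmeasurable_real.
by exists M => x; rewrite norm1c_real.
Qed.

End bounded_measurable.

Lemma bmeas_comp d d' (S : measurableType d) (T : measurableType d') (R : realType)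
    (K : T -> R) (h : S -> T) : bmeas K -> measurable_fun setT h -> bmeas (fun x => K (h x)).
Proof. by move=> [mK [M KM]] mh; split; [exact: (measurableT_comp mK)|exists M]. Qed.

(** * The kernel of a partition as a function of all n variables *)

Section block_kernel.
Variable R : realType.

Lemma measurable_tuple_sum k (P : pred 'I_k) (s : 'I_k -> 'I_k) :
  measurable_fun setT (fun u : k.-tuple R => \sum_(j < k | P j) tnth u (s j)).
Proof.
rewrite (_ : (fun _ => _) = (fun u => \sum_(j < k) (if P j then tnth u (s j) else 0))).
  by apply: measurable_sum => j; case: (P j) => //; exact: measurable_tnth.
by apply/funext => u; rewrite big_mkcond.
Qed.

Lemma bmeas_chi : bmeas (@chi R).
Proof.
split; first by apply: measurable_indic.
by exists 1 => x; rewrite /chi indicE normr_nat; case: (_ \in _).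
Qed.

Lemma bmeas_chi_star k : bmeas (@chi_star R k).
Proof.
apply: bmeas_sum => s; apply: bmeas_prod => i.
apply: (bmeas_comp bmeas_chi); apply: measurable_funB; exact: measurable_tuple_sum.
Qed.

Definition block_tuple n (F : {set {set 'I_n}}) (v : n.-tuple R) : #|F|.-tuple R :=
  [tuple \sum_(i in enum_val l) tnth v i | l < #|F|].

Definition block_kernel n (F : {set {set 'I_n}}) (v : n.-tuple R) : R :=
  mobius_top R F + (- 1) ^+ #|F| * chi_star (block_tuple F v).

Lemma bmeas_block_kernel n (F : {set {set 'I_n}}) : bmeas (block_kernel F).
Proof.
apply: bmeasD; first exact: bmeas_cst.
apply: bmeasM; first exact: bmeas_cst.
apply: (bmeas_comp (@bmeas_chi_star _)); apply/measurable_fun_tnthP => l; rewrite /comp.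
under eq_fun do rewrite tnth_mktuple.
exact: (measurable_tuple_sum (mem (enum_val l)) id).
Qed.

Lemma partition_colouring n (F : {set {set 'I_n}}) :
  F \in set_partitions n ->
  exists c : 'I_n -> 'I_#|F|, forall i l, (c i == l) = (i \in enum_val l).
Proof.
rewrite inE => pF; have /and3P[/eqP cF tF nF] := pF.
have mF i : finset.pblock F i \in F by rewrite finset.pblock_mem// cF inE.
exists (fun i => enum_rank_in (mF i) (finset.pblock F i)) => i l.
have lF : enum_val l \in F by exact: enum_valP.
apply/eqP/idP => [<-|il].
  by rewrite enum_rankK_in// finset.mem_pblock cF inE.
apply: enum_val_inj; rewrite enum_rankK_in//.
exact: finset.def_pblock.
Qed.

Lemma C_termE n (f : 'I_n -> R -> R[i]) (F : {set {set 'I_n}}) :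
  (forall i, invertible (f i)) -> F \in set_partitions n ->
  C_term f F = 2^-1 * cintegral (@lebesgue_tuple R n) setT
    (fun v => (block_kernel F v)%:C * \prod_(i < n) cft (f i) (tnth v i)).
Proof.
move=> fI pF; have [c cE] := partition_colouring pF.
rewrite /C_term; congr (_ * _).
pose g l : R -> R[i] := fun x => \prod_(i | c i == l) f i x.
(* Blocks are nonempty, so no colour class degenerates to [None]. *)
have gE l : colour_class c f l = Some (g l).
  rewrite /colour_class; case: existsP => // -[].
  move: pF; rewrite inE => /and3P[_ _ nF].
  have /set0Pn[i il] : enum_val l != finset.set0.
    by apply: contraNneq nF => <-; exact: enum_valP.
  by exists i; rewrite cE.
have gN l : nice (g l) by have := colour_class_nice c l fI; rewrite gE.
have bE l : block_prod f (enum_val l) = g l.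
  by apply/funext => x; apply: eq_bigl => i; rewrite cE.
have [mK [M KM]] := bmeas_cmeasurable (bmeasD (bmeas_cst _ (mobius_top R F))
  (bmeasM (bmeas_cst _ ((- 1) ^+ #|F|)) (@bmeas_chi_star #|F|))).
have [mK' [M' KM']] := bmeas_cmeasurable (bmeas_block_kernel F).
rewrite (cintegral_lebesgue_tuple (fun i => nice_cft_int (invertible_nice (fI i))) mK' KM').2.
have := iter_int_colour c fI mK KM.
have -> : (fun l => opt_cft (colour_class c f l)) = (fun l => Some (cft (g l))).
  by apply/funext => l; rewrite gE.
rewrite -(cintegral_lebesgue_tuple (fun l => nice_cft_int (gN l)) mK KM).2 => e.
under [LHS]eq_cintegral do under eq_bigr do rewrite bE (fourier_cft _ (nice_even (gN _)) (nice_int (gN _))).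
rewrite [LHS]e; congr iter_int; apply/funext => v; congr (_%:C); congr (_ + _ * chi_star _).
apply: eq_from_tnth => l; rewrite !tnth_mktuple; apply: eq_bigl => i; exact: cE.
Qed.

End block_kernel.

(** * Sign changes of the variables and reduction to the orthant *)

Section reflections.
Variable R : realType.
Notation lam := (@lebesgue_measure R).

Definition flip n (s : 'I_n -> bool) (v : n.-tuple R) : n.-tuple R :=
  [tuple (-1) ^+ s i * tnth v i | i < n].

Lemma flip_tcons n (s : 'I_n.+1 -> bool) t (v : n.-tuple R) :
  flip s (tcons (t, v)) = tcons ((-1) ^+ s ord0 * t, flip (fun i => s (lift ord0 i)) v).
Proof.
apply: eq_from_tnth => i; rewrite tnth_mktuple.
by have [j ->|->] := unliftP ord0 i; rewrite ?tnthS ?tnth_mktuple //= !tnth0.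
Qed.

Lemma measurable_flip n (s : 'I_n -> bool) : measurable_fun setT (flip s).
Proof.
apply/measurable_fun_tnthP => i; rewrite /comp.
under eq_fun do rewrite tnth_mktuple.
by apply: measurable_funM => //; exact: measurable_tnth.
Qed.

Let section_int n (h : 'I_n.+1 -> R -> R[i]) (K : n.+1.-tuple R -> R[i]) (M : R) :
  (forall i, cintegrable lam (h i)) -> cmeasurable K -> (forall v, norm1c (K v) <= M) ->
  cintegrable lam (fun t => iter_int (fun i => Some (h (lift ord0 i))) (fun v => K (tcons (t, v))) * h ord0 t).
Proof.
move=> ih mK KM.
have hI i : opt_integrable (Some (h (lift ord0 i))) by exact: ih.
have [M' [mphi phiM]] := iter_int_param hI (cmeasurable_comp mK (@measurable_tcons R n)) (fun q => KM _).
exact: (@cintegrable_bddM _ _ _ lam _ _ M' mphi phiM (ih ord0)).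
Qed.

Let mtc n (K : n.+1.-tuple R -> R[i]) t : cmeasurable K -> cmeasurable (fun v => K (tcons (t, v))).
Proof.
by move=> mK; apply: (cmeasurable_comp mK); exact: (measurableT_comp (@measurable_tcons R n) (pair1_measurable t)).
Qed.

Lemma iter_int_flip n (h : 'I_n -> R -> R[i]) (s : 'I_n -> bool) (K : n.-tuple R -> R[i]) (M : R) :
  (forall i, cintegrable lam (h i)) -> (forall i x, h i (- x) = h i x) ->
  cmeasurable K -> (forall v, norm1c (K v) <= M) ->
  iter_int (fun i => Some (h i)) (fun v => K (flip s v)) = iter_int (fun i => Some (h i)) K.
Proof.
elim: n h s K => [|n IH] h s K ih he mK KM; first by congr K; apply: eq_from_tnth => -[].
pose phi t := iter_int (fun i => Some (h (lift ord0 i))) (fun v => K (tcons (t, v))).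
transitivity (cintegral lam setT (fun t => phi ((-1) ^+ s ord0 * t) * h ord0 t)).
  apply: eq_cintegral => t; congr (_ * _); rewrite /phi.
  rewrite -(IH (fun i => h (lift ord0 i)) (fun i => s (lift ord0 i))
    (fun v => K (tcons ((-1) ^+ s ord0 * t, v))))//; last exact: mtc.
  by congr iter_int; apply/funext => v; rewrite flip_tcons.
case: (s ord0); last by apply: eq_cintegral => t; rewrite expr0 mul1r.
rewrite -[RHS](cintegral_opp (section_int ih mK KM)); apply: eq_cintegral => t.
by rewrite expr1 mulN1r he.
Qed.

(** The point 0 is kept, in accordance with the closed orthant in [E_singletons]. *)
Definition half (h : R -> R[i]) (t : R) : R[i] := if 0 <= t then h t else 0.

Lemma cintegrable_half h : cintegrable lam h -> cintegrable lam (half h).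
Proof.
move=> ih; rewrite (_ : half h = (fun t => (\1_(`[0, +oo[%classic : set R) t)%:C * h t)); last first.
  apply/funext => t; rewrite /half indicE mem_setE in_itv /= andbT.
  by case: (0 <= t); rewrite ?mul1r ?mul0r.
apply: (@cintegrable_bddM _ _ _ _ _ _ 1) => //.
  by apply: cmeasurable_real; exact: measurable_indic.
by move=> t; rewrite norm1c_real indicE normr_nat; case: (_ \in _).
Qed.

Let Rintegral_half (g : R -> R) : (forall x, g (- x) = g x) -> rintegrable lam g ->
  \int[lam]_x g x = 2 * \int[lam]_x (if 0 <= x then g x else 0).
Proof.
move=> ge gi; have mg := rintegrable_meas gi.
have N1 : (-1 : R) != 0 by rewrite oppr_eq0 oner_neq0.
have E1 (x : R) : (if 0 <= x then g x else 0) = (g \_ `[0, +oo[) x.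
  by rewrite patchE mem_setE in_itv /= andbT.
have E2 (x : R) : (if 0 < x then g x else 0) = (g \_ `]0, +oo[) x.
  by rewrite patchE mem_setE in_itv /= andbT.
have mp : measurable_fun setT (fun x : R => if 0 <= x then g x else 0).
  by apply: measurable_fun_ifT => //; exact: measurable_fun_ler.
have mn : measurable_fun setT (fun x : R => if 0 <= x then 0 else g x).
  by apply: measurable_fun_ifT => //; exact: measurable_fun_ler.
have ip : rintegrable lam (fun x : R => if 0 <= x then g x else 0).
  apply: (@rintegrable_dom _ _ _ lam _ (fun x => `|g x|) mp (rintegrable_norm gi)) => x.
  by case: ifP => // _; rewrite normr0.
have in_ : rintegrable lam (fun x : R => if 0 <= x then 0 else g x).
  apply: (@rintegrable_dom _ _ _ lam _ (fun x => `|g x|) mn (rintegrable_norm gi)) => x.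
  by case: ifP => // _; rewrite normr0.
transitivity (\int[lam]_x ((if 0 <= x then g x else 0) + (if 0 <= x then 0 else g x))).
  by apply: eq_Rintegral => x _; case: ifP; rewrite ?addr0 ?add0r.
rewrite (RintegralD measurableT ip in_) mulr_natl mulr2n; congr (_ + _).
rewrite (Rintegral_affine 0 N1 in_) normrN1 mul1r.
transitivity (\int[lam]_x (g \_ `]0, +oo[) x).
  apply: eq_Rintegral => x _; rewrite mulN1r addr0 ge -E2 oppr_ge0 leNgt.
  by case: (0 < x).
(* The reflected half misses only the point 0, which is negligible. *)
rewrite -Rintegral_mkcond Rintegral_itv_obnd_cbnd; last first.
  by apply: (integrableS measurableT _ _ gi).
by rewrite Rintegral_mkcond; apply: eq_Rintegral => x _; rewrite E1.
Qed.

Lemma cintegral_half (phi h : R -> R[i]) : cintegrable lam (fun t => phi t * h t) ->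
  (forall t, phi (- t) * h (- t) = phi t * h t) ->
  cintegral lam setT (fun t => phi t * h t) = 2 * cintegral lam setT (fun t => phi t * half h t).
Proof.
move=> [ir ii] pe.
have eR (z : R[i]) : complex.Re (2 * z) = 2 * complex.Re z by rewrite !mulr_natl !mulr2n Re_add.
have eI (z : R[i]) : complex.Im (2 * z) = 2 * complex.Im z by rewrite !mulr_natl !mulr2n Im_add.
apply: complex_ext.
  rewrite eR [LHS](Rintegral_half _ ir); last by move=> x; rewrite pe.
  by congr (_ * _); apply: eq_Rintegral => x _; rewrite /half; case: ifP => //; rewrite mulr0.
rewrite eI [LHS](Rintegral_half _ ii); last by move=> x; rewrite pe.
by congr (_ * _); apply: eq_Rintegral => x _; rewrite /half; case: ifP => //; rewrite mulr0.
Qed.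

Lemma iter_int_half n (h : 'I_n -> R -> R[i]) (K : n.-tuple R -> R[i]) (M : R) :
  (forall i, cintegrable lam (h i)) -> (forall i x, h i (- x) = h i x) ->
  cmeasurable K -> (forall v, norm1c (K v) <= M) -> (forall s v, K (flip s v) = K v) ->
  iter_int (fun i => Some (h i)) K = 2 ^+ n * iter_int (fun i => Some (half (h i))) K.
Proof.
elim: n h K => [|n IH] h K ih he mK KM Ke; first by rewrite expr0 mul1r.
pose phi t := iter_int (fun i => Some (h (lift ord0 i))) (fun v => K (tcons (t, v))).
have ip := section_int ih mK KM.
have pe t : phi (- t) * h ord0 (- t) = phi t * h ord0 t.
  rewrite he; congr (_ * _); congr iter_int; apply/funext => v.
  (* Flipping only the first coordinate is a symmetry of [K], so the inner integral is even in
     [t]. *)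
  rewrite -(Ke (fun i => i == ord0) (tcons (t, v))) flip_tcons eqxx expr1 mulN1r.
  congr (K (tcons (_, _))); apply: eq_from_tnth => i.
  by rewrite tnth_mktuple eq_sym (negbTE (neq_lift _ _)) mul1r.
rewrite /= (cintegral_half ip pe).
have IHt t : phi t = 2 ^+ n * iter_int (fun i => Some (half (h (lift ord0 i)))) (fun v => K (tcons (t, v))).
  apply: (IH (fun i => h (lift ord0 i))) => //; first exact: mtc.
  move=> s v; pose s' i := if unlift ord0 i is Some j then s j else false.
  rewrite -[RHS](Ke s') flip_tcons /s' unlift_none expr0 mul1r; congr (K (tcons (_, _))).
  by apply: eq_from_tnth => i; rewrite !tnth_mktuple liftK.
rewrite exprS -mulrA; congr (_ * _).
have i2 := section_int (fun i => cintegrable_half (ih i)) mK KM.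
rewrite -(cintegralZ (2 ^+ n) i2); apply: eq_cintegral => t.
by rewrite -/(phi t) IHt mulrA.
Qed.

End reflections.

(** * The Fourier identity *)

Section kernel_identity.
Variables (R : realType) (n : nat) (v : n.-tuple R).
Hypotheses (n0 : (0 < n)%N) (v_ge0 : forall i, 0 <= tnth v i)
  (v_lt2 : \sum_(i < n) tnth v i < 2).
Implicit Types (x B S A : {set 'I_n}) (F : {set {set 'I_n}}).

Let w x : R := \sum_(i < n) (-1) ^+ (i \in x) * tnth v i.
Let g x : R := chi (w x).
Let p x : bool := 1 < w x.
Let V B : R := \sum_(i in B) tnth v i.

Let wC x : w (~: x)%SET = - w x.
Proof.
rewrite /w -sumrN; apply: eq_bigr => i _; rewrite finset.inE.
by case: (i \in x); rewrite ?expr0 ?expr1 ?mulN1r ?mul1r ?opprK.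
Qed.

Let gC x : g (~: x)%SET = g x.
Proof. by rewrite /g /chi wC !indicE !mem_setE !in_itv /= lerN2 (lerNl (w x)) andbC. Qed.

Let badE x : 1 - g x = (p x || p (~: x)%SET)%:R.
Proof.
rewrite /g /chi /p wC indicE mem_setE in_itv /=.
rewrite lerNl; have [h1|h1] := ltP 1 (w x); have [h2|h2] := ltP 1 (- w x);
  by rewrite /= ?mulr0n ?mulr1n ?subr0 ?subrr.
Qed.

Let p_excl x : p x -> ~~ p (~: x)%SET.
Proof. by rewrite /p wC -leNgt; lra. Qed.

Let p_down A B : A \subset B -> p B -> p A.
Proof.
move=> AB; rewrite /p => /lt_le_trans; apply; apply: ler_sum => i _; apply: ler_wpM2r => //.
have := fintype.subsetP AB i; case: (i \in A) => [->//|_].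
by case: (i \in B); rewrite ?expr0 ?expr1; lra.
Qed.

Let V0 : V finset.set0 = 0. Proof. by rewrite /V big_set0. Qed.

Let V_add B (D : {set 'I_n}) : B \subset D -> V D = V B + V (D :\: B)%SET.
Proof. by move=> BD; rewrite /V (big_setID B) /= (finset.setIidPr BD). Qed.

(** [w] falls from above 1 to below -1, while flipping [B] lowers it by at most twice the weight of
    [B]. *)
Let V_cross x B : p x -> p (~: sdiff x B)%SET -> 1 <= V B.
Proof.
rewrite /p wC => h1 h2.
suff : w x - w (sdiff x B) <= 2 * V B by lra.
rewrite /w /V -sumrB mulr_sumr big_mkcond /=; rewrite [leRHS]big_mkcond /=; apply: ler_sum => i _.
rewrite in_sdiff; have := v_ge0 i.
by case: (i \in x); case: (i \in B); rewrite /= ?expr0 ?expr1; lra.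
Qed.

Let V_T : V finset.setT < 2.
Proof. by rewrite /V (eq_bigl xpredT) // => i; rewrite finset.inE. Qed.

Let T0 : (0 < #|'I_n|)%N. Proof. by rewrite card_ord. Qed.

Let ordpart_enum F (s : 'S_#|F|) : F \in set_partitions n ->
  ordpart finset.setT [seq enum_val (s i) | i <- enum 'I_#|F|].
Proof.
rewrite finset.inE => pF; rewrite ordpartE map_inj_uniq ?enum_uniq; last first.
  by move=> i j /enum_val_inj/perm_inj.
rewrite /=; move: pF; congr finset.partition; apply/setP => B; rewrite finset.inE.
apply/idP/mapP => [BF|[i _ ->]]; last exact: enum_valP.
by exists ((s^-1)%g (enum_rank_in BF B)); rewrite ?mem_enum// permKV enum_rankK_in.
Qed.

(** [c i] is the position in [l] of the block containing [i]. *)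
Let foldl_take (c : 'I_n -> nat) (l : seq {set 'I_n}) x m :
  (forall j i, (j < size l)%N -> (i \in nth finset.set0 l j) = (c i == j)) -> (m <= size l)%N ->
  foldl (@sdiff _) x (take m l) = sdiff x [set i | (c i < m)%N]%SET.
Proof.
move=> cE; elim: m => [|m IH] ml.
  rewrite take0 /=; apply/setP => i; rewrite in_sdiff finset.inE ltn0 addbF//.
rewrite (take_nth finset.set0 ml) foldl_rcons IH 1?ltnW//.
apply/setP => i; rewrite !in_sdiff !finset.inE -addbA; congr (_ (+) _).
by rewrite cE// [RHS]ltnS [RHS]leq_eqVlt; case: (ltngtP (c i) m).
Qed.

(** The path starts at [~: S] because [chi] counts the blocks already visited with a plus: once
    flipped, an index carries the sign given by [S], and before that the opposite one. *)
Let block_path F S (s : 'S_#|F|) : F \in set_partitions n ->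
  let u := block_tuple F (flip (fun i => i \in S) v) in
  \prod_(i < #|F|) chi (\sum_(j < #|F| | (j <= i)%N) tnth u (s j)
                       - \sum_(j < #|F| | (i < j)%N) tnth u (s j)) =
  flip_path g (~: S)%SET [seq enum_val (s i) | i <- enum 'I_#|F|].
Proof.
move=> pF u; have [c cE] := partition_colouring pF.
set l := [seq _ | i <- _].
have sl : size l = #|F| by rewrite size_map size_enum_ord.
rewrite flip_path_prod sl; apply: eq_bigr => i _; rewrite /g; congr chi.
pose pos a : 'I_#|F| := (s^-1)%g (c a).
have posE a j : (pos a == j) = (a \in enum_val (s j)).
  by rewrite -cE /pos -(inj_eq (@perm_inj _ s)) permKV.
rewrite (@foldl_take pos); last 2 first.
- move=> j a; rewrite sl => jk.
  by rewrite (nth_map (Ordinal jk)) ?size_enum_ord// (nth_ord_enum _ (Ordinal jk)) -posE.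
- by rewrite sl.
have uE (P : pred 'I_#|F|) : \sum_(j | P j) tnth u (s j) =
    \sum_(a < n | P (pos a)) (-1) ^+ (a \in S) * tnth v a.
  rewrite (partition_big pos P)//=; apply: eq_bigr => j Pj.
  rewrite tnth_mktuple; apply: eq_big => [a|a _]; last by rewrite tnth_mktuple.
  by rewrite -posE andbC; have [->|] := eqVneq (pos a) j.
rewrite (uE (fun j => (j <= i)%N)) (uE (fun j => (i < j)%N)).
rewrite big_mkcond [X in _ - X]big_mkcond -sumrB /w; apply: eq_bigr => a _.
rewrite in_sdiff !finset.inE ltnS ltnNge.
by case: (pos a <= i)%N; case: (a \in S); rewrite /= ?expr0 ?expr1; lra.
Qed.

Let partition_gt0 F : F \in set_partitions n -> (0 < #|F|)%N.
Proof.
rewrite finset.inE => pF; rewrite card_gt0; apply: contraTneq n0 => F0.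
have := finset.cover_partition pF; rewrite F0 /finset.cover big_set0 => e.
by have := card_ord n; rewrite -cardsT -e cards0 => <-.
Qed.

Let sum_chi_star F : F \in set_partitions n ->
  \sum_(S : {set 'I_n}) chi_star (block_tuple F (flip (fun i => i \in S) v)) =
  #|F|%:R^-1 * \sum_(s : 'S_#|F|) \sum_x flip_path g x [seq enum_val (s i) | i <- enum 'I_#|F|].
Proof.
move=> pF; have F0 := partition_gt0 pF; pose j0 := Ordinal F0.
have k0 : (#|F|%:R : R) != 0 by rewrite pnatr_eq0 -lt0n.
apply: (mulfI k0); rewrite mulrA mulfV// mul1r.
rewrite -(@sum_flip_path_perm _ _ g gC _ _ (fun s => ordpart_enum s pF) j0 j0); congr (_ * _).
rewrite exchange_big /=; apply: eq_big => [s|s _].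
  apply/forallP/eqP => [/(_ j0) /eqP //|sj i].
  by apply/implyP => /eqP i0; rewrite (_ : i = j0) ?sj//; exact: val_inj.
rewrite [RHS](reindex_inj (@finset.setC_inj _)) /=; apply: eq_bigr => S _; exact: block_path.
Qed.

Let kdiag1 : kdiag (fun=> 1) = 1 :> kern 'I_n R.
Proof. by apply/ffunP => -[x D]; rewrite kern1 ffunE mulr1. Qed.

Let flip_path1 x l : flip_path (fun=> 1 : R) x l = 1.
Proof. by elim: l x => //= B l IH x; rewrite IH mulr1. Qed.

(** This is the case g = 1, where all k! orders of the k blocks and all patterns count 1: (-1)^k / k
    times k! is minus the value of [mobius_top]. *)
Let sum_mobius : \sum_(S : {set 'I_n}) \sum_(F in set_partitions n) mobius_top R F = - ktrace_log (kstep 'I_n R).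
Proof.
rewrite -[kstep _ _]mulr1 -kdiag1 ktrace_log_partition// -sumrN exchange_big /=.
apply: eq_big => [F|F pF]; first by rewrite finset.inE.
have F0 := partition_gt0 pF.
have k0 : (#|F|%:R : R) != 0 by rewrite pnatr_eq0 -lt0n.
pose N : R := #|{: {set 'I_n}}|%:R.
have e1 : \sum_(S : {set 'I_n}) mobius_top R F = N * mobius_top R F.
  by rewrite sumr_const mulr_natl.
have e2 : \sum_(s : 'S_#|F|) \sum_x flip_path (fun=> 1 : R) x [seq enum_val (s i) | i <- enum 'I_#|F|] =
    #|F|%:R * #|F|.-1`!%:R * N.
  rewrite (eq_bigr (fun=> N)) => [|s _]; last first.
    by rewrite (eq_bigr (fun=> 1)) => [|x _]; [rewrite sumr_const|exact: flip_path1].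
  by rewrite sumr_const card_Sn -[LHS]mulr_natl -natrM -(prednK F0) -factS.
rewrite e1 e2 /mobius_top -[in RHS](prednK F0) exprS mulN1r prednK//.
have key (a b K M : R) : K != 0 -> M * (a * b) = - (- a / K * (K * b * M)).
  by move=> K0; field.
exact: key.
Qed.

Lemma kernel_identity :
  \sum_(S : {set 'I_n}) \sum_(F in set_partitions n) block_kernel F (flip (fun i => i \in S) v) =
  2 * \sum_(I : {set 'I_n}) (- 1) ^+ (#|I| + 1) *
         chi_tilde (\sum_(i in I) tnth v i - \sum_(i | i \notin I) tnth v i).
Proof.
rewrite /block_kernel; under eq_bigr do rewrite big_split /=.
rewrite big_split /= sum_mobius [X in _ + X]exchange_big /=.
rewrite (eq_bigr (fun F => (-1) ^+ #|F| / #|F|%:R *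
    \sum_(s : 'S_#|F|) \sum_x flip_path g x [seq enum_val (s i) | i <- enum 'I_#|F|])); last first.
  by move=> F pF; rewrite -mulr_sumr sum_chi_star// mulrA.
have -> : \sum_(F in set_partitions n) (-1) ^+ #|F| / #|F|%:R *
    \sum_(s : 'S_#|F|) \sum_x flip_path g x [seq enum_val (s i) | i <- enum 'I_#|F|] =
  ktrace_log (kstep 'I_n R * kdiag g).
  by rewrite ktrace_log_partition//; apply: eq_bigl => F; rewrite finset.inE.
(* The trace of the logarithm of 1 + [kstep] cancels here against the constants [mobius_top]. *)
rewrite ktrace_log_step// addKr.
have -> : kdiag (fun x => 1 - g x) = kdiag (fun x => (p x || p (~: x)%SET)%:R).
  by congr kdiag; apply/funext => x; exact: badE.
rewrite (ktrace_log_bad T0 p_excl p_down V0 V_add V_cross V_T) card_ord.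
rewrite -mulrA mulNr -mulrN; congr (_ * _).
(* [A] collects the minus signs, whereas [I] collects the plus signs, so the two indexings are
   complementary. *)
rewrite mulr_sumr -sumrN [RHS](reindex_inj (@finset.setC_inj _)) /= big_mkcond /=.
apply: eq_bigr => A _.
have -> : \sum_(i in (~: A)%SET) tnth v i - \sum_(i | i \notin (~: A)%SET) tnth v i = w A.
  rewrite /w big_mkcond [X in _ - X]big_mkcond -sumrB; apply: eq_bigr => i _.
  by rewrite finset.inE; case: (i \in A); rewrite /= ?expr0 ?expr1; lra.
rewrite /chi_tilde indicE mem_setE in_itv /= andbT -/(p A).
case: (p A); last by rewrite mulr0.
have nE : n = (#|A| + #|~: A|)%N by rewrite cardsC card_ord.
rewrite mulr1 {1}nE exprD exprD expr1 mulrN1; congr (- _).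
have s2 : (-1) ^+ #|A| * (-1) ^+ #|A| = 1 :> R by rewrite -expr2 sqrr_sign.
set s := (-1) ^+ #|A| in s2 *.
by rewrite mulrAC s2 mul1r.
Qed.

End kernel_identity.

(** * Assembly of the integral identity *)

Section assembly.
Variable R : realType.
Notation lam := (@lebesgue_measure R).

Lemma flip_xor n (s t : 'I_n -> bool) (v : n.-tuple R) :
  flip s (flip t v) = flip (fun i => s i (+) t i) v.
Proof.
apply: eq_from_tnth => i; rewrite !tnth_mktuple mulrA; congr (_ * _).
by case: (s i); case: (t i); rewrite ?expr0 ?expr1 ?mulrNN ?mul1r ?mulr1.
Qed.

Lemma sum_flip_even n (K : n.-tuple R -> R) (s : 'I_n -> bool) v :
  \sum_(S : {set 'I_n}) K (flip (fun i => i \in S) (flip s v)) =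
  \sum_(S : {set 'I_n}) K (flip (fun i => i \in S) v).
Proof.
pose D := [set i | s i]%SET.
pose g (S : {set 'I_n}) := [set i | (i \in S) (+) s i]%SET.
have gK : involutive g.
  by move=> S; apply/setP => i; rewrite !inE -addbA addbb addbF.
rewrite [RHS](reindex_inj (inv_inj gK)) /=.
apply: eq_bigr => S _; rewrite flip_xor; congr (K (flip _ v)).
by apply/funext => i; rewrite inE.
Qed.

Lemma fourier_identity n (f : 'I_n -> R -> R[i]) : (0 < n)%N ->
  (forall i, even_function (f i)) -> (forall i, schwartz (f i)) ->
  fourier_supported f 2 ->
  \sum_(F in set_partitions n) C_term f F = E_singletons f.
Proof.
move=> n0 fe fs [sigma [sig0 sig sig2]].
have fI i : invertible (f i) := schwartz_invertible (fs i) (fe i) (sig i).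
pose h i := cft (f i).
have ih i : cintegrable lam (h i) := nice_cft_int (invertible_nice (fI i)).
have he i x : h i (- x) = h i x by exact: cft_even.
have fourierE i u : fourier (f i) u = h i u.
  exact: fourier_cft (fe i) (nice_int (invertible_nice (fI i))).
have h0 i u : sigma i < `|u| -> h i u = 0.
  move=> su; apply/eqP; apply: contraTT isT => hu.
  have /(sig i) /= : supp (fourier (f i)) u by apply: subset_closure; rewrite /= fourierE.
  by rewrite in_itv /= -ler_norml leNgt su.
pose Ktot (v : n.-tuple R) := \sum_(F in set_partitions n) block_kernel F v.
pose Ksym (v : n.-tuple R) := \sum_(S : {set 'I_n}) Ktot (flip (fun i => i \in S) v).
have bKtot : bmeas Ktot by apply: bmeas_sum => F; exact: bmeas_block_kernel.
have bKflip S : bmeas (fun v => Ktot (flip S v)) by exact: (bmeas_comp bKtot (measurable_flip S)).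
have bKsym : bmeas Ksym by apply: bmeas_sum => S; exact: bKflip.
have [mKtot [M1 Ktot1]] := bmeas_cmeasurable bKtot.
have [mKsym [M2 Ksym2]] := bmeas_cmeasurable bKsym.
pose iT := iter_int (fun i => Some (h i)) (fun v => (Ktot v)%:C).
have bk F := bmeas_cmeasurable (@bmeas_block_kernel R n F).
have iF F : cintegrable (@lebesgue_tuple R n)
    (fun v => (block_kernel F v)%:C * \prod_(i < n) h i (tnth v i)).
  by have [mk [M kM]] := bk F; exact: (cintegral_lebesgue_tuple ih mk kM).1.
have -> : \sum_(F in set_partitions n) C_term f F = 2^-1 * iT.
  rewrite (eq_bigr _ (fun F pF => C_termE fI pF)) -mulr_sumr; congr (_ * _).
  rewrite -cintegral_sum// /iT -(cintegral_lebesgue_tuple ih mKtot Ktot1).2.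
  by apply: eq_cintegral => v; rewrite -mulr_suml -rmorph_sum.
(* Summing the kernel over the 2^n sign changes multiplies the integral by 2^n, and so does passing
   from the orthant to the whole space for the symmetric kernel [Ksym]. *)
have iTE : iT = iter_int (fun i => Some (half (h i))) (fun v => (Ksym v)%:C).
  have n2 : (2 ^+ n : R[i]) != 0 by rewrite expf_neq0// pnatr_eq0.
  apply: (mulfI n2); rewrite -(iter_int_half ih he mKsym Ksym2); last first.
    by move=> s v; rewrite /Ksym sum_flip_even.
  rewrite -(cintegral_lebesgue_tuple ih mKsym Ksym2).2.
  have iS (S : {set 'I_n}) : cintegrable (@lebesgue_tuple R n)
      (fun v => (Ktot (flip (fun i => i \in S) v))%:C * \prod_(i < n) h i (tnth v i)) /\
      cintegral (@lebesgue_tuple R n) setT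
      (fun v => (Ktot (flip (fun i => i \in S) v))%:C * \prod_(i < n) h i (tnth v i)) = iT.
    have [mk [M kM]] := bmeas_cmeasurable (bKflip (fun i => i \in S)).
    have [i1 i2] := cintegral_lebesgue_tuple ih mk kM; split => //.
    rewrite i2; exact: (iter_int_flip _ ih he mKtot Ktot1).
  transitivity (\sum_(S : {set 'I_n}) iT).
    have e : #|{: {set 'I_n}}| = (2 ^ n)%N by rewrite -cardsT -powersetT card_powerset cardsT card_ord.
    by rewrite sumr_const e -[RHS]mulr_natl natrX.
  rewrite (eq_bigr _ (fun S _ => esym (iS S).2)) -cintegral_sum; last by move=> S; exact: (iS S).1.
  by apply: eq_cintegral => v; rewrite -mulr_suml -rmorph_sum.
have ihh i := cintegrable_half (ih i).
have [i3 i4] := cintegral_lebesgue_tuple ihh mKsym Ksym2.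
rewrite iTE -i4 -(cintegralZ _ i3) /E_singletons.
set D := [set u : n.-tuple R | forall i, 0 <= tnth u i].
set G := fun u : n.-tuple R => (_ * \prod_(i < n) fourier (f i) (tnth u i)).
have -> : cintegral (@lebesgue_tuple R n) D G = cintegral (@lebesgue_tuple R n) setT (fun u => if u \in D then G u else 0).
  apply: complex_ext; rewrite /= Rintegral_mkcond; apply: eq_Rintegral => u _;
    by rewrite patchE; case: ifP.
apply: eq_cintegral => u.
case: ifPn => [|/negP]; rewrite inE => uD; last first.
  have [i ui] : exists i, ~~ (0 <= tnth u i).
    by apply/existsP; rewrite -negb_forall; apply/negP => /forallP.
  by rewrite (bigD1 i)//= /half (negbTE ui) mul0r !mulr0.
rewrite /G; have -> : \prod_(i < n) half (h i) (tnth u i) = \prod_(i < n) fourier (f i) (tnth u i).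
  by apply: eq_bigr => i _; rewrite /half uD fourierE.
(* Outside the supports both integrands vanish. Inside, the coordinates sum to less than 2, so
   [kernel_identity] applies, and its factor 2 cancels the 1/2 from [C_term]. *)
have [[i si]|us] := pselect (exists i, sigma i < `|tnth u i|).
  by rewrite (bigD1 i)//= fourierE h0// mul0r !mulr0.
rewrite mulrA; congr (_ * _); rewrite /Ksym /Ktot (kernel_identity n0 uD); last first.
  apply: le_lt_trans sig2; apply: ler_sum => i _.
  rewrite leNgt; apply/negP => si; apply: us; exists i.
  exact: lt_le_trans si (ler_norm _).
rewrite rmorphM (rmorph_nat (real_complex R)) mulrA mulVf ?mul1r// pnatr_eq0//.
Qed.

End assembly.

Theorem theorem3p14 (R : realType) (n : nat) (f : 'I_n -> R -> R[i])
    (n_range : (1 <= n <= 7)%N)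
    (f_even : forall i, even_function (f i))
    (f_schwartz : forall i, schwartz (f i))
    (f_supp : fourier_supported f 2) :
  \sum_(F in set_partitions n) C_term f F = E_singletons f.
Proof.
by case/andP: n_range => n0 _; exact: fourier_identity.
Qed.
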